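(* Let $V$ be a convex polynomial of even degree $p\ge 2$ and let $\beta>0$. Then the sequence of distributions of $(\lambda_{(N)},\mu_N)_N$ under $\mathbb P^N_{V,\beta}$ satisfies a weak large deviation principle on $\mathbb R\times M_1^p(\mathbb R^+)$, equipped with the product topology ($M_1^p(\mathbb R^+)$ being equipped with $d_{W_p}$), at speed $\beta N^2/2$ with rate function $\mathcal I_V$.
   Context: Let $\mathbb P^N_{V,\beta}$ be the probability measure on $\mathbb R^N$ given by $$\mathbb P^N_{V,\beta}(d\lambda_1,\dots,d\lambda_N) = (Z^N_{V,\beta})^{-1}\,|\Delta(\lambda)|^\beta \exp\Big(-\frac{N\beta}{2}\sum_{k=1}^N V(\lambda_k)\Big)\prod_{k=1}^N d\lambda_k ,$$ where $\Delta(\lambda)=\prod_{i<j}(\lambda_j-\lambda_i)$ is the Vandermonde determinant and $Z^N_{V,\beta}$ is the normalizing constant. Let $\lambda_{(1)}<\dots<\lambda_{(N)}$ be the increasing rearrangement of $\lambda_1,\dots,\lambda_N$ (a.s. distinct). For $N\ge 2$ define the random probability measure on $\mathbb R^+=[0,\infty)$ $$\mu_N := \frac1{N-1}\sum_{k=1}^{N-1}\delta_{\lambda_{(N)}-\lambda_{(k)}} .$$ $M_1(E)$ denotes the set of Borel probability measures on $E$, and $M_1^p(E)$ the set of $\nu\in M_1(E)$ with $\int |x|^p d\nu(x)<\infty$. The Wasserstein distance is $d_{W_p}(\mu,\nu)=\big(\inf_{\pi\in\Pi(\mu,\nu)}\int |x-y|^p d\pi(x,y)\big)^{1/p}$, where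 $\Pi(\mu,\nu)$ is the set of couplings of $\mu$ and $\nu$. For a measure $\mu$ put $\Sigma(\mu)=\iint \ln|x-y|\,d\mu(x)d\mu(y)$, $c_V=\inf_{\nu}\big(-\Sigma(\nu)+\int V d\nu\big)$ (infimum over probability measures $\nu$ on $\mathbb R$ with $\int|V|d\nu<\infty$), and $I_V(\mu)=-\Sigma(\mu)+\int V d\mu-c_V$ if $\int|V|d\mu<\infty$, $I_V(\mu)=+\infty$ otherwise. For $c\in\mathbb R$, $\tau_c\mu$ is the probability defined by $\int f(x)\,\tau_c\mu(dx)=\int f(c-x)\,\mu(dx)$, and $$\mathcal I_V(c,\nu):=I_V(\tau_c\nu)=-\Sigma(\nu)+\int V(c-x)\,d\nu(x)-c_V .$$ A sequence of random variables $X_N$ with values in a topological space satisfies a weak large deviation principle at speed $v_N$ with rate function $I$ (a lower semicontinuous function with values in $[0,\infty]$) if $\liminf_N v_N^{-1}\ln \mathbb P(X_N\in G)\ge -\inf_G I$ for every open $G$, and $\limsup_N v_N^{-1}\ln\mathbb P(X_N\in K)\le -\inf_K I$ for every compact $K$. *)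

(* Defs.v *)
From HB Require Import structures.
From mathcomp Require Import all_boot all_order all_algebra.
From mathcomp Require Import all_classical all_reals all_analysis.
From mathcomp Require Import measurable_realfun.

Set Implicit Arguments.
Unset Strict Implicit.
Unset Printing Implicit Defensive.

Import Order.TTheory GRing.Theory Num.Theory.
Import numFieldNormedType.Exports.

Local Open Scope classical_set_scope.
Local Open Scope ring_scope.

Section weak_ldp.
Local Open Scope ereal_scope.

(* [ln 0 = -oo] and [inf set0 = +oo] here, by [lne] and [ereal_inf]. *)
Definition weak_LDP (R : realType) (T : topologicalType)
    (d : nat -> measure_display) (Omega : forall n, measurableType (d n))
    (P : forall n, probability (Omega n) R) (X : forall n, Omega n -> T)
    (v : nat -> R) (I : T -> \bar R) : Prop :=
  [/\ forall x, 0 <= I x,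
      lower_semicontinuous I,
      forall G : set T, open G ->
        - ereal_inf (I @` G) <=
        limn_einf (fun n => ((v n)^-1)%:E * lne (P n (X n @^-1` G))) &
      forall K : set T, compact K ->
        limn_esup (fun n => ((v n)^-1)%:E * lne (P n (X n @^-1` K))) <=
        - ereal_inf (I @` K)].

End weak_ldp.

Section lebesgue_tuple.
Local Open Scope ereal_scope.
Variable R : realType.
Local Notation mR := (measurableTypeR R).

Definition cons_pair n (x : mR * n.-tuple mR) : n.+1.-tuple mR :=
  [tuple of x.1 :: x.2].

Lemma measurable_cons_pair n : measurable_fun [set: mR * n.-tuple mR] (@cons_pair n).
Proof. exact: measurable_cons. Qed.

Section step.
Variables (n : nat) (m : {sigma_finite_measure set (n.-tuple mR) -> \bar R}).

Definition lebesgue_cons : set (n.+1.-tuple mR) -> \bar R :=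
  pushforward (lebesgue_measure \x m) (@cons_pair n).

Fact lebesgue_cons0 : lebesgue_cons set0 = 0.
Proof. by rewrite /lebesgue_cons /pushforward preimage_set0 measure0. Qed.

Fact lebesgue_cons_ge0 A : 0 <= lebesgue_cons A.
Proof. by rewrite /lebesgue_cons /pushforward. Qed.

Fact lebesgue_cons_sigma_additive : semi_sigma_additive lebesgue_cons.
Proof.
move=> F mF tF mUF; rewrite /lebesgue_cons /pushforward preimage_bigcup.
have mp A : measurable A -> measurable (@cons_pair n @^-1` A).
  by move=> mA; rewrite -[X in measurable X]setTI; exact: measurable_cons_pair.
apply: measure_semi_sigma_additive.
- by move=> k; exact: mp.
- apply/trivIsetP => /= i j _ _ ij; rewrite -preimage_setI.
  by move/trivIsetP : tF => /(_ _ _ _ _ ij) ->//; rewrite preimage_set0.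
- by rewrite -preimage_bigcup; exact: mp.
Qed.

HB.instance Definition _ := isMeasure.Build _ _ _ lebesgue_cons
  lebesgue_cons0 lebesgue_cons_ge0 lebesgue_cons_sigma_additive.

Fact lebesgue_cons_sigma_finite : sigma_finite setT lebesgue_cons.
Proof.
have /sigma_finiteP[F [TF ndF Foo]] := sigma_finiteT
  (lebesgue_measure : {sigma_finite_measure set mR -> \bar R}).
have /sigma_finiteP[G [TG ndG Goo]] := sigma_finiteT m.
pose u (t : n.+1.-tuple mR) : mR * n.-tuple mR := (thead t, [tuple of behead t]).
have uK : cancel (@cons_pair n) u.
  by move=> [x t]; congr (_, _); exact: val_inj.
have mu : measurable_fun setT u.
  by apply: measurable_fun_pair => //=;
    [exact: measurable_tnth|exact: measurable_behead].
exists (fun k => u @^-1` (F k `*` G k)).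
  apply/esym/seteqP; split=> // t _.
  have [k _ Fk] : (\bigcup_i F i) (thead t) by rewrite -TF.
  have [l _ Gl] : (\bigcup_i G i) [tuple of behead t] by rewrite -TG.
  exists (maxn k l) => //; split=> /=.
    by move: Fk; exact/subsetPset/ndF/leq_maxl.
  by move: Gl; exact/subsetPset/ndG/leq_maxr.
move=> k; have [mF Fy] := Foo k; have [mG Gy] := Goo k; split.
  by rewrite -[X in measurable X]setTI; apply: mu => //; exact: measurableX.
rewrite /lebesgue_cons /pushforward (_ : _ @^-1` _ = F k `*` G k).
  by rewrite product_measure1E// lte_mul_pinfty// ge0_fin_numE.
by apply/funext => x; rewrite /preimage /mkset uK.
Qed.

HB.instance Definition _ := Measure_isSigmaFinite.Build _ _ _ lebesgue_cons
  lebesgue_cons_sigma_finite.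

End step.

Fixpoint lebesgue_tuple n : {sigma_finite_measure set (n.-tuple mR) -> \bar R} :=
  match n with
  | 0 => \d_ ([tuple] : 0.-tuple mR)
  | k.+1 => lebesgue_cons (lebesgue_tuple k)
  end.

End lebesgue_tuple.

Section gibbs.
Variables (R : realType) (n : nat) (V : {poly R}) (beta : R).
Local Notation mR := (measurableTypeR R).
Implicit Type l : n.-tuple mR.

Definition vandermonde l : R :=
  \prod_(i < n) \prod_(j < n | (i < j)%N) ((tnth l j : R) - tnth l i).

Definition gibbs_density l : R :=
  `|vandermonde l| `^ beta *
  expR (- (n%:R * beta / 2 * \sum_(k < n) V.[tnth l k])).

Lemma gibbs_density_ge0 l : 0 <= gibbs_density l.
Proof. by rewrite mulr_ge0 ?powR_ge0 ?expR_ge0. Qed.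

Lemma measurable_gibbs_density : measurable_fun [set: n.-tuple mR] gibbs_density.
Proof.
have mt (i : 'I_n) : measurable_fun [set: n.-tuple mR] (fun l => tnth l i : R).
  exact: measurable_tnth.
apply: measurable_funM.
  apply: (@measurableT_comp _ _ _ _ _ _ (@powR R ^~ beta)).
    exact: measurable_powR.
  apply: (@measurableT_comp _ _ _ _ _ _ (@Num.norm R R)) => //.
  apply: measurable_prod => i _.
  rewrite (_ : (fun _ => _) = fun l : n.-tuple mR => \prod_(j < n)
      if (i < j)%N then (tnth l j : R) - tnth l i else 1); last first.
    by apply/funext => l; rewrite big_mkcond.
  apply: measurable_prod => j _.
  by case: (i < j)%N; [exact: measurable_funB|exact: measurable_cst].
apply: (@measurableT_comp _ _ _ _ _ _ (@expR R)) => //.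
apply: (@measurableT_comp _ _ _ _ _ _ (@GRing.opp R)) => //.
apply: measurable_funM => //.
apply: measurable_sum => k.
rewrite (_ : (fun _ => _) = fun l : n.-tuple mR =>
    \sum_(i < size V) V`_i * (tnth l k : R) ^+ i); last first.
  by apply/funext => l; rewrite horner_coef.
by apply: measurable_sum => i; apply: measurable_funM => //; exact: measurable_funX.
Qed.

Definition gibbs_weight (A : set (n.-tuple mR)) : \bar R :=
  (\int[@lebesgue_tuple R n]_(l in A) (gibbs_density l)%:E)%E.

Fact gibbs_weight0 : gibbs_weight set0 = 0%E.
Proof. by rewrite /gibbs_weight integral_set0. Qed.

Fact gibbs_weight_ge0 A : (0 <= gibbs_weight A)%E.
Proof.
by apply: integral_ge0 => l _; rewrite lee_fin gibbs_density_ge0.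
Qed.

Fact gibbs_weight_sigma_additive : semi_sigma_additive gibbs_weight.
Proof.
move=> /= F mF tF mUF; rewrite /gibbs_weight; apply: cvg_toP.
  apply: ereal_nondecreasing_is_cvgn => m k mk.
  by apply: lee_sum_nneg_natr => // i _ _; exact: gibbs_weight_ge0.
rewrite ge0_integral_bigcup//=.
- apply: measurable_funTS; apply: measurableT_comp => //.
  exact: measurable_gibbs_density.
- by move=> l _; rewrite lee_fin gibbs_density_ge0.
Qed.

HB.instance Definition _ := isMeasure.Build _ _ _ gibbs_weight
  gibbs_weight0 gibbs_weight_ge0 gibbs_weight_sigma_additive.

End gibbs.

(* [mnormalize] divides by [Z = gibbs_weight setT]. The Dirac mass is only its
   default value when [Z] is 0 or +oo, which does not happen for [0 < beta] and
   [V] of even degree with positive leading coefficient. *)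
Definition gibbs (R : realType) (n : nat) (V : {poly R}) (beta : R) :
    probability (n.-tuple (measurableTypeR R)) R :=
  mnormalize (gibbs_weight V beta)
    (\d_ [tuple (0 : measurableTypeR R) | _ < n]).

Section borel_part.
Local Open Scope ereal_scope.
Context d (T : measurableType d) (R : realType).

(* Measures of the library are functions on all subsets of [T], constrained on
   the measurable ones only; [borel_part m] is the representative of [m] that
   vanishes on the nonmeasurable sets. *)
Definition borel_part (m : set T -> \bar R) (A : set T) : \bar R :=
  if A \in measurable then m A else 0.

Variable m : {measure set T -> \bar R}.

Fact borel_part0 : borel_part m set0 = 0.
Proof. by rewrite /borel_part measure0 if_same. Qed.

Fact borel_part_ge0 A : 0 <= borel_part m A.
Proof. by rewrite /borel_part; case: ifP. Qed.

Fact borel_part_sigma_additive : semi_sigma_additive (borel_part m).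
Proof.
move=> F mF tF mUF; rewrite /borel_part mem_set//.
under eq_fun do under eq_bigr do rewrite mem_set//.
exact: measure_semi_sigma_additive.
Qed.

HB.instance Definition _ := isMeasure.Build _ _ _ (borel_part m)
  borel_part0 borel_part_ge0 borel_part_sigma_additive.

End borel_part.

Section wasserstein.
Local Open Scope ereal_scope.
Variable R : realType.
Local Notation mR := (measurableTypeR R).

Definition couplings (mu nu : probability mR R) :
    set (probability (mR * mR)%type R) :=
  [set pi | (forall A, measurable A -> pi (A `*` setT) = mu A) /\
            (forall B, measurable B -> pi (setT `*` B) = nu B)].

Definition wasserstein (p : nat) (mu nu : probability mR R) : \bar R :=
  poweR (ereal_inf [set \int[pi]_z ((`|(z.1 : R) - z.2| ^+ p)%:E)
                   | pi in couplings mu nu]) (p%:R^-1)%R.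

(* The Borel probability measures on [E] with finite [p]-th moment, seen as
   measures on the line carried by [E]. The last field selects the
   representative vanishing outside the Borel sets, so that two elements are
   equal iff they agree on the Borel sets. *)
Record M1p (E : set mR) (p : nat) := MkM1p {
  M1p_val :> probability mR R;
  M1p_carrier : M1p_val E = 1;
  M1p_moment : \int[M1p_val]_x ((`|x : R| ^+ p)%:E) < +oo;
  M1p_borel : forall A, ~ measurable A -> M1p_val A = 0 }.

Variables (E : set mR) (p : nat).

HB.instance Definition _ := gen_eqMixin (M1p E p).
HB.instance Definition _ := gen_choiceMixin (M1p E p).

Definition wasserstein_ball (mu : M1p E p) (e : R) : set (M1p E p) :=
  [set nu | wasserstein p mu nu < e%:E].

(* The metric topology of [wasserstein p], given by its open sets because this
   requires no proof of the triangle inequality. *)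
Definition wasserstein_open (G : set (M1p E p)) : Prop :=
  forall mu, G mu -> exists2 e : R, (0 < e)%R & wasserstein_ball mu e `<=` G.

Fact wasserstein_openT : wasserstein_open setT.
Proof. by move=> mu _; exists 1%R. Qed.

Fact wasserstein_openI : setI_closed wasserstein_open.
Proof.
move=> G H oG oH mu [/oG[e e0 eG] /oH[f f0 fH]].
exists (Num.min e f); first by rewrite lt_min e0.
move=> nu; rewrite /wasserstein_ball /= EFin_min lt_min => /andP[ne nf].
by split; [exact: eG|exact: fH].
Qed.

Fact wasserstein_open_bigU (I : Type) (f : I -> set (M1p E p)) :
  (forall i, wasserstein_open (f i)) -> wasserstein_open (\bigcup_i f i).
Proof.
move=> fo mu [i _ /fo[e e0 ef]]; exists e => //.
by move=> nu /ef fnu; exists i.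
Qed.

HB.instance Definition _ := isOpenTopological.Build (M1p E p)
  wasserstein_openT wasserstein_openI wasserstein_open_bigU.

End wasserstein.

Section order_statistics.
Local Open Scope ring_scope.
Variable R : realType.
Local Notation mR := (measurableTypeR R).

(* 0-based: [order_stat l k] is the [k.+1]-st smallest entry of [l]. *)
Definition order_stat n (l : n.-tuple mR) (k : nat) : R :=
  nth 0 (sort <=%R (l : seq R)) k.

Variables (n : nat) (l : n.+2.-tuple mR).

Definition largest : R := order_stat l n.+1.

(* [mu_N] for [N = n.+2]. *)
Definition gap_measure : set mR -> \bar R :=
  mscale (n.+1%:R^-1)%:nng
    (msum (fun k => \d_ (largest - order_stat l k : mR)) n.+1).

HB.instance Definition _ := Measure.on gap_measure.

Definition gap_borel : set mR -> \bar R := borel_part gap_measure.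

HB.instance Definition _ := Measure.on gap_borel.

Lemma order_stat_le_largest k : (k < n.+1)%N -> order_stat l k <= largest.
Proof.
move=> kn; apply: (@le_sorted_leq_nth _ _ (0 : R) (sort <=%R (l : seq R))).
- exact: (sort_le_sorted (l : seq R)).
- by rewrite inE size_sort size_tuple leqW.
- by rewrite inE size_sort size_tuple.
- exact: ltnW.
Qed.

Lemma gap_borelE (A : set mR) : measurable A ->
  gap_borel A = (n.+1%:R^-1 *
    (\sum_(k < n.+1) \1_A (largest - order_stat l k)))%:E.
Proof.
move=> mA; rewrite /gap_borel /borel_part mem_set// /gap_measure /mscale/=.
by rewrite /msum/= EFinM -sumEFin.
Qed.

Lemma gap_borel_full (A : set mR) : measurable A ->
  (forall k, (k < n.+1)%N -> A (largest - order_stat l k)) -> gap_borel A = 1%E.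
Proof.
move=> mA hA; rewrite gap_borelE//; congr (_%:E).
rewrite (eq_bigr (fun=> 1)) => [|k _]; last by rewrite indicE mem_set//; exact: hA.
by rewrite sumr_const card_ord mulVf.
Qed.

Fact gap_borelT : gap_borel setT = 1%E.
Proof. exact: gap_borel_full. Qed.

HB.instance Definition _ :=
  Measure_isProbability.Build _ _ _ gap_borel gap_borelT.

Lemma gap_borel_carrier : gap_borel `[0, +oo[%classic = 1%E.
Proof.
apply: gap_borel_full => [|k kn]; first exact: measurable_itv.
by rewrite /= in_itv/= andbT subr_ge0 order_stat_le_largest.
Qed.

Lemma gap_borel_moment p :
  (\int[gap_borel]_x ((`|x : R| ^+ p)%:E) < +oo)%E.
Proof.
have mf : measurable_fun [set: mR] (fun x : mR => (`|x : R| ^+ p)%:E).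
  apply/measurable_EFinP; apply: (@measurable_funX _ mR).
  exact: (@measurableT_comp _ _ _ _ _ _ (@Num.norm R R)).
rewrite (@eq_measure_integral _ _ _ _ gap_measure); last first.
  by move=> A mA _; rewrite /= /gap_borel /borel_part ifT ?mem_set.
rewrite ge0_integral_mscale//=.
rewrite ge0_integral_measure_sum//.
rewrite lte_mul_pinfty// ?lee_fin// lte_sum_pinfty// => k _.
by rewrite integral_dirac// diracT mul1e ltry.
Qed.

Lemma gap_borel_nonmeasurable (A : set mR) : ~ measurable A -> gap_borel A = 0%E.
Proof. by move=> mA; rewrite /gap_borel /borel_part memNset. Qed.

Definition gap_M1p (p : nat) : M1p (`[0, +oo[%classic : set mR) p :=
  MkM1p gap_borel_carrier (gap_borel_moment p) gap_borel_nonmeasurable.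

End order_statistics.

Section energy.
Local Open Scope ereal_scope.
Variable R : realType.
Local Notation mR := (measurableTypeR R).
Implicit Type mu : set mR -> \bar R.

(* [lne 0 = -oo], whereas the real-valued [ln] has [ln 0 = 0]. *)
Definition log_energy mu : \bar R :=
  \int[mu \x mu]_z lne `|(z.1 : R) - z.2|%:E.

Variable V : {poly R}.

Definition V_integrable mu : Prop := \int[mu]_x `|V.[x]|%:E < +oo.

Definition c_V : \bar R :=
  ereal_inf [set - log_energy nu + \int[nu]_x V.[x]%:E
            | nu in [set nu : probability mR R | V_integrable nu]].

Definition I_V mu : \bar R :=
  if `[< V_integrable mu >]
  then - log_energy mu + \int[mu]_x V.[x]%:E - c_V
  else +oo.

Definition tau (c : R) mu : set mR -> \bar R :=
  pushforward mu (fun x : mR => (c - x)%R : mR).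

Definition rate_V (E : set mR) (p : nat) (x : R * M1p E p) : \bar R :=
  I_V (tau x.1 x.2).

End energy.

(* Main.v *)
(* Write [U] for [V] shifted by a constant so that it dominates [4 |x|], and [k]
   for the kernel [(U x + U y) / 2 - ln |x - y|], which is then nonnegative. Up to
   normalization the density of the ensemble is [exp (- beta / 2 * H)], where the
   energy [H] of a configuration is the sum of [k] over the pairs of distinct
   particles plus the sum of [U]; the latter makes the integrals of upper bounds
   converge.

   Upper bound. Replacing [k] by its truncated [m]-Lipschitz minorant makes the
   double integral against the empirical measure finite on the diagonal, at the
   cost of [O(m N)], and continuous for the transport distance; by compactness
   one [m] serves all points of a compact set.

   Lower bound. Cut the line into [n + 1] cells of equal mass for a measure of
   finite energy, which has no atom. Points drawn independently in the cells
   have on average at most the right energy and the right transport cost, hence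
   some choice of points does. In boxes of side [N ^ -3] around these points the
   energy changes by [O(N ln N)] only, and so does the logarithm of the volume.

   The partition function is bounded below in the same manner. Above, smearing
   each particle uniformly compares the energy of any configuration with that of
   a probability measure. *)

Require Import Defs.
From HB Require Import structures.
From mathcomp Require Import all_boot all_order all_algebra.
From mathcomp Require Import all_classical all_reals all_analysis.
From mathcomp Require Import measurable_realfun ring lra.

Set Implicit Arguments.
Unset Strict Implicit.
Unset Printing Implicit Defensive.

Import Order.TTheory GRing.Theory Num.Theory.
Import numFieldNormedType.Exports.

Local Open Scope classical_set_scope.
Local Open Scope ring_scope.

(** * Polynomial growth of the confining potential *)

(** The obstacle is the diagonal: an empirical measure has infinite energy, so the rate function is
    useless at it, and configurations must be compared with measures at a cost negligible against
    N^2. The factor 4 in the lower bound of [U] makes ln |x - y| at most (U x + U y) / 4, so that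
    half of the potential survives in the kernel; this part controls the sum of [U] over a
    configuration by its energy, and hence the price of moving the particles.

    The largest particle is not an atom of mu_N. In the upper bound its interactions are nonnegative
    and are dropped; in the lower bound it is an additional particle placed at c, to the right of
    all the others because nu is carried by the half-line.

    Drawing points in cells of equal mass asks nothing of the measure beyond finite energy, so no
    approximation by smooth measures is made.

    The events are never shown to be measurable: integrals of nonnegative functions are monotone in
    the function and in the domain without it, and the estimates use nothing else. *)

Section ereal_sequences.
Local Open Scope ereal_scope.
Context {R : realType}.
Implicit Types (x y l : \bar R) (u : (\bar R)^nat).

Lemma lee_real_upper x y : (forall b : R, y < b%:E -> x <= b%:E) -> x <= y.
Proof.
move: y => [r| |] H; last 2 first.
- exact: leey.
- move: x H => [s| |] // H.
  + have := H (s - 1)%R (ltNyr _); rewrite lee_fin => h; exfalso.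
    by move: h; apply/negP; rewrite -ltNge gtrBl.
  + by have := H 0%R (ltNyr _).
- apply/lee_addgt0Pr => e e0; rewrite -EFinD; apply: H.
  by rewrite lte_fin ltrDl.
Qed.

Lemma lee_real_lower x y : (forall b : R, b%:E < x -> b%:E <= y) -> x <= y.
Proof.
move=> H; rewrite -leeN2; apply: lee_real_upper => b.
by rewrite lteNl leeNl -EFinN; exact: H.
Qed.

Lemma limn_esup_le u l :
  (forall b : R, l < b%:E -> \forall n \near \oo, u n <= b%:E) ->
  limn_esup u <= l.
Proof.
move=> H; apply: lee_real_upper => b /H ub; rewrite /limn_esup limf_esupE.
apply: (@le_trans _ _ (ereal_sup (u @` [set n | u n <= b%:E]))).
  by apply: ereal_inf_lbound; exists [set n | u n <= b%:E].
by apply: ge_ereal_sup => _ [n /= ? <-].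
Qed.

Lemma limn_einf_ge u l :
  (forall b : R, b%:E < l -> \forall n \near \oo, b%:E <= u n) ->
  l <= limn_einf u.
Proof.
move=> H; rewrite /limn_einf leeNr; apply: limn_esup_le => b.
rewrite lteNl -EFinN => /H; apply: filterS => n /=.
by rewrite leeNl -EFinN.
Qed.

Lemma lne_ge_expR (a : R) x : (expR a)%:E <= x -> a%:E <= lne x.
Proof.
move: x => [r| |] /=; [|move=> _; exact: leey|by []].
rewrite lee_fin => h; have r0 : (0 < r)%R by rewrite (lt_le_trans _ h)// expR_gt0.
by rewrite (lt_geF r0) lee_fin -(expRK a) ler_ln// posrE expR_gt0.
Qed.

Lemma lne_le_expR (a : R) x : x <= (expR a)%:E -> lne x <= a%:E.
Proof.
move: x => [r| |] /=; [|by []|move=> _; exact: leNye].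
rewrite lee_fin => h; have [r0|r0] := leP r 0%R; first by rewrite leNye.
by rewrite lee_fin -(expRK a) ler_ln// posrE expR_gt0.
Qed.

End ereal_sequences.

Section nonneg_integral.
Local Open Scope ereal_scope.
Context d (T : measurableType d) (R : realType) (mu : {measure set T -> \bar R}).

(* Unlike [ge0_le_integral], neither function nor domain needs to be measurable. *)
Lemma ge0_le_integralT (f g : T -> \bar R) :
  (forall x, 0 <= f x) -> (forall x, f x <= g x) ->
  \int[mu]_x f x <= \int[mu]_x g x.
Proof.
move=> f0 fg; rewrite !ge0_integralTE//; last first.
  by move=> x; exact: le_trans (fg x).
apply: ge_ereal_sup => _ [h /= hf <-]; apply: ereal_sup_ubound; exists h => //= x.
exact: le_trans (fg x).
Qed.

Lemma ge0_le_integral_subset (A B : set T) (f : T -> \bar R) :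
  (forall x, 0 <= f x) -> A `<=` B ->
  \int[mu]_(x in A) f x <= \int[mu]_(x in B) f x.
Proof.
move=> f0 AB; rewrite (integral_mkcond A) (integral_mkcond B).
apply: ge0_le_integralT => x; rewrite /patch; case: ifPn => // xA; last by case: ifPn.
by case: ifPn => //; rewrite notin_setE => xB; move: xA; rewrite inE => /AB.
Qed.

End nonneg_integral.

Section polynomial_growth.
Context {R : realType}.
Implicit Types (V : {poly R}) (p : nat).

(** The lower-order terms are absorbed one by one: for [0 < d <= 1] and [i < p], [|x|^i] is at most
    [d |x|^p] when [|x| > 1/d] and at most [d^-p] otherwise. The choice of [d] makes [d] times the
    sum of the lower coefficients at most [e]. *)
Lemma poly_lead_approx V p : size V = p.+1 -> forall e : R, 0 < e ->
  exists K, forall x, `|V.[x] - V`_p * x ^+ p| <= e * `|x| ^+ p + K.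
Proof.
move=> sV e e0; pose S : R := \sum_(i < p) `|V`_i|.
have S0 : 0 <= S by apply: sumr_ge0.
pose d : R := Num.min 1 (e / (S + 1)).
have d0 : 0 < d by rewrite lt_min ltr01/= divr_gt0// ltr_wpDl.
have d1 : d <= 1 by rewrite ge_min lexx.
have Sd : S * d <= e.
  have : d <= e / (S + 1) by rewrite ge_min lexx orbT.
  rewrite ler_pdivlMr ?ltr_wpDl//; nra.
exists (S * d ^- p) => x.
rewrite horner_coef sV big_ord_recr/= addrK (le_trans (ler_norm_sum _ _ _))//.
have key i : (i < p)%N -> `|x| ^+ i <= d * `|x| ^+ p + d ^- p.
  move=> ip; case: (lerP `|x| d^-1) => xd.
    apply: (@le_trans _ _ (d^-1 ^+ p)).
      apply: (@le_trans _ _ (d^-1 ^+ i)); first by rewrite lerXn2r// nnegrE// invr_ge0 ltW.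
      by apply: ler_weXn2l; [rewrite invf_ge1|exact: ltnW].
    by rewrite exprVn lerDr mulr_ge0// ?exprn_ge0// ltW.
  have x1 : 1 <= `|x| by rewrite (le_trans _ (ltW xd))// invf_ge1.
  apply: (@le_trans _ _ (d * `|x| ^+ p)); last by rewrite lerDl invr_ge0 exprn_ge0// ltW.
  have p1 : (i <= p.-1)%N by case: (p) ip.
  have -> : `|x| ^+ p = `|x| * `|x| ^+ p.-1 by rewrite -exprS prednK//; case: (p) ip.
  rewrite mulrA; apply: (@le_trans _ _ (1 * `|x| ^+ p.-1)).
    by rewrite mul1r ler_weXn2l.
  by rewrite ler_wpM2r ?exprn_ge0// -ler_pdivrMl// mulr1 ltW.
apply: (@le_trans _ _ (\sum_(i < p) `|V`_i| * (d * `|x| ^+ p + d ^- p))).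
  apply: ler_sum => i _; rewrite normrM normrX ler_wpM2l//; exact: key.
rewrite -mulr_suml -/S mulrDr lerD2r mulrA ler_wpM2r ?exprn_ge0//.
Qed.

Lemma convex_functionE (f : R -> R) : convex_function [set: R] f ->
  forall t x y, 0 <= t -> t <= 1 -> f (t * x + (1 - t) * y) <= t * f x + (1 - t) * f y.
Proof.
move=> cf t x y t0 t1.
have := cf (Itv01 t0 t1) x y (in_setT _) (in_setT _).
by rewrite !convRE.
Qed.

(** Since [p] is even, a negative leading coefficient sends [V] to minus infinity on both sides,
    against convexity at the midpoint 0 of [-x] and [x]. *)
Lemma convex_poly_lead_gt0 V p : convex_function [set: R] (fun x : R => V.[x]) ->
  size V = p.+1 -> ~~ odd p -> (2 <= p)%N -> 0 < V`_p.
Proof.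
move=> cV sV pe p2; rewrite ltNge; apply/negP => a0.
have a_neq0 : V`_p != 0.
  have := lead_coef_eq0 V; rewrite lead_coefE sV/= => ->.
  by apply: contra_eqN sV => /eqP ->; rewrite size_poly0.
have {a0}a0 : V`_p < 0 by rewrite lt_neqAle a_neq0.
set a := V`_p in a_neq0 a0.
have e0 : 0 < - a / 2 by lra.
have [K HK] := poly_lead_approx sV e0.
(* At [x] and [-x] the value of [V] is at most [a/2 x^p + K]; this [x] is so large that the bound
   lies below [V.[0]]. *)
pose x : R := 1 + 2 * (`|K| + `|V.[0]|) / - a.
have x1 : 1 <= x by rewrite lerDl mulr_ge0 ?invr_ge0 ?mulr_ge0 ?addr_ge0//; lra.
have xp : x <= x ^+ p by rewrite -{1}(expr1 x) ler_weXn2l// ltnW.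
have := convex_functionE cV (t := 1/2) x (- x) ltac:(lra) ltac:(lra).
have -> : 1 / 2 * x + (1 - 1 / 2) * - x = 0 by field.
have := HK x; have := HK (- x).
rewrite normrN exprNn -signr_odd (negbTE pe) expr0 mul1r (ger0_norm (le_trans ler01 x1)).
rewrite -/a !ler_norml => /andP[_ h1] /andP[_ h2] h3.
have xa : x * - a = - a + 2 * (`|K| + `|V.[0]|).
  by rewrite /x mulrDl mul1r divfK// oppr_eq0.
have : 0 <= (x ^+ p - x) * - a by apply: mulr_ge0; lra.
have := ler_norm K; have := ler_norm (- V.[0]); rewrite normrN.
nra.
Qed.

End polynomial_growth.

(** [confining_linear] beats the logarithm. [confining_shift] bounds the price of moving a particle
    by the potential it already has, so that the total price is controlled by the energy; moves to
    the right suffice because cells and boxes are placed to the right of the points.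
    [confining_lower] turns finite energy into a finite moment of order [p]. *)
Record confining {R : realType} (p : nat) (U : R -> R) : Prop := Confining {
  confining_continuous : continuous U;
  confining_linear : forall x, 4 * `|x| <= U x;
  confining_shift : exists2 C, 0 <= C &
    forall x h, 0 <= h <= 1 -> U (x + h) <= U x + C * h * (U x + 1);
  confining_lower : exists2 k, 0 < k & forall x, k * `|x| ^+ p <= U x;
  confining_upper : exists K, forall x, U x <= K * (1 + `|x| ^+ p) }.

Lemma convex_poly_confining {R : realType} (V : {poly R}) (p : nat) :
  convex_function [set: R] (fun x : R => V.[x]) -> size V = p.+1 ->
  ~~ odd p -> (2 <= p)%N ->
  exists C : R, confining p (fun x => V.[x] + C).
Proof.
move=> cV sV pe p2.
have a0 := convex_poly_lead_gt0 cV sV pe p2; set a := V`_p in a0.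
have e0 : 0 < a / 4 by lra.
have [K HK] := poly_lead_approx sV e0.
have xpE (x : R) : x ^+ p = `|x| ^+ p.
  by rewrite -normrX ger0_norm// exprn_even_ge0.
have lin (x : R) : `|x| <= a / 16 * `|x| ^+ p + (1 + 16 / a).
  have [xs|xb] := lerP `|x| (1 + 16 / a).
    by rewrite (le_trans xs)// lerDr mulr_ge0// ?exprn_ge0//; lra.
  have ia : 0 < 16 / a by rewrite divr_gt0.
  have x1 : 1 <= `|x| by lra.
  have x2 : `|x| ^+ 2 <= `|x| ^+ p by rewrite ler_weXn2l.
  have : `|x| <= a / 16 * `|x| ^+ 2.
    have : 16 / a <= `|x| by lra.
    rewrite ler_pdivrMr// => h; rewrite expr2; nra.
  nra.
have low (x : R) : 3 / 4 * a * `|x| ^+ p - K <= V.[x].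
  by have := HK x; rewrite -/a xpE ler_norml => /andP[]; lra.
have upp (x : R) : V.[x] <= 5 / 4 * a * `|x| ^+ p + K.
  by have := HK x; rewrite -/a xpE ler_norml => /andP[]; lra.
pose C := `|K| + 4 * (1 + 16 / a) + 1.
have ia : 0 < 16 / a by rewrite divr_gt0.
have K0 := ler_norm K.
have CU (x : R) : 0 <= `|x| ^+ p by rewrite exprn_ge0.
have lowU (x : R) : a / 4 * `|x| ^+ p <= V.[x] + C.
  by have := low x; have := CU x; rewrite /C; nra.
exists C; split.
- move=> x; apply: cvgD; [exact: continuous_horner|exact: cvg_cst].
- move=> x; have := lin x; have := low x; have := CU x; rewrite /C; nra.
- pose L := 2 ^+ p * (5 / 4 * a).
  have shift1 (x : R) : `|x + 1| ^+ p <= 2 ^+ p * (`|x| ^+ p + 1).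
    have [x1|x1] := lerP `|x| 1.
      apply: (@le_trans _ _ (2 ^+ p)).
        rewrite lerXn2r ?nnegrE// (le_trans (ler_normD _ _))// normr1; lra.
      by rewrite ler_peMr// ?exprn_ge0// lerDr.
    apply: (@le_trans _ _ (2 ^+ p * `|x| ^+ p)).
      rewrite -exprMn lerXn2r ?nnegrE// (le_trans (ler_normD _ _))// normr1; lra.
    by rewrite ler_wpM2l ?exprn_ge0// lerDl.
  pose D := 2 ^+ p * 5 + `|K| + C.
  have C0 : 0 <= C by rewrite /C; have := normr_ge0 K; lra.
  have p0 : 0 <= (2 : R) ^+ p by rewrite exprn_ge0.
  exists (2 ^+ p * 5 + 2 ^+ p * (5 / 4 * a) + `|K| + C).
    have := normr_ge0 K; nra.
  (* Convexity between [x] and [x + 1] bounds the increment by [h (V(x+1) - V(x))], and the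
     two-sided growth bounds [V(x+1)] by a constant multiple of [V(x) + C + 1]. *)
  move=> x h /andP[h0 h1].
  have := convex_functionE cV (t := h) (x + 1) x h0 h1.
  have -> : h * (x + 1) + (1 - h) * x = x + h by ring.
  have := upp (x + 1); have := shift1 x; have := lowU x.
  set y := `|x| ^+ p; set z := `|x + 1| ^+ p; set q := 2 ^+ p.
  rewrite -/q in p0.
  have y0 : 0 <= y by exact: CU.
  move=> h2 h3 h4 h5.
  have h6 : V.[x + 1] <= (q * 5) * (V.[x] + C) + q * (5/4 * a) + `|K|.
    have : 5 / 4 * a * z <= 5 / 4 * a * (q * (y + 1)) by rewrite ler_wpM2l//; nra.
    have : q * (a / 4 * y) <= q * (V.[x] + C) by rewrite ler_wpM2l.
    nra.
  have W0 : 0 <= V.[x] + C by nra.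
  set W := V.[x] + C in W0 h6 h2 *.
  have VW : V.[x] = W - C by rewrite /W; ring.
  rewrite VW in h5.
  have h7 : V.[x + 1] + C - W <= (q * 5 + q * (5 / 4 * a) + `|K| + C) * (W + 1).
    have : 0 <= (q * (5 / 4 * a) + `|K| + C) * W by rewrite mulr_ge0//; have := normr_ge0 K; nra.
    nra.
  have : h * (V.[x + 1] + C - W) <= h * ((q * 5 + q * (5 / 4 * a) + `|K| + C) * (W + 1)).
    by rewrite ler_wpM2l.
  lra.
- exists (a / 4) => //; exact: lowU.
- exists (5 / 4 * a + `|K| + C) => x.
  have := upp x; have := CU x; have := normr_ge0 K.
  have : 0 <= C by rewrite /C; have := normr_ge0 K; lra.
  nra.
Qed.

(** * The Gibbs density as a function of the logarithmic energy of a configuration *)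

Section hamiltonian.
Context {R : realType}.
Implicit Types (U : R -> R) (s : seq R).

(* The diagonal terms vanish because [ln 0 = 0]. *)
Definition log_pairs s : R := \sum_(x <- s) \sum_(y <- s) ln `|x - y|.

(** Of the [size s] copies of the sum of [U], all but one come from the terms (U x + U y) / 2 over
    ordered pairs of distinct particles; the last one is the additional sum of [U]. *)
Definition hamiltonian U s : R := (size s)%:R * (\sum_(x <- s) U x) - log_pairs s.

Lemma log_pairs_perm s t : perm_eq s t -> log_pairs s = log_pairs t.
Proof.
move=> st; rewrite /log_pairs (perm_big _ st)/=.
by apply: eq_bigr => x _; exact: perm_big.
Qed.

Lemma hamiltonian_perm U s t : perm_eq s t -> hamiltonian U s = hamiltonian U t.
Proof.
by move=> st; rewrite /hamiltonian (log_pairs_perm st) (perm_size st) (perm_big _ st).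
Qed.

Lemma log_pairs_sum n (f : nat -> R) :
  \sum_(i < n) \sum_(j < n) ln `|f i - f j| =
  (\sum_(i < n) \sum_(j < n | (i < j)%N) ln `|f j - f i|) *+ 2.
Proof.
rewrite mulr2n [X in _ = _ + X](exchange_big_dep predT)//=.
rewrite -big_split/=; apply: eq_bigr => i _.
rewrite (bigID (fun j : 'I_n => (i < j)%N))/=; congr (_ + _).
  by apply: eq_bigr => j _; rewrite distrC.
rewrite (bigD1 i) ?ltnn//= subrr normr0 ln0// add0r.
apply: eq_bigl => j; rewrite -leqNgt [in RHS]ltn_neqAle andbC.
by [].
Qed.

Lemma log_pairs_tuple n (l : n.-tuple R) :
  log_pairs l =
  (\sum_(i < n) \sum_(j < n | (i < j)%N) ln `|tnth l j - tnth l i|) *+ 2.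
Proof.
pose f i := nth 0 l i.
have fE (i : 'I_n) : tnth l i = f i by rewrite (tnth_nth 0).
rewrite /log_pairs big_tuple; under eq_bigr do rewrite big_tuple.
under eq_bigr => i _ do under eq_bigr => j _ do rewrite !fE.
rewrite log_pairs_sum; congr (_ *+ 2).
by apply: eq_bigr => i _; apply: eq_bigr => j _; rewrite !fE.
Qed.

End hamiltonian.

Section density.
Context {R : realType}.
Variables (n : nat) (V : {poly R}) (C beta : R).
Hypothesis beta_gt0 : 0 < beta.
Local Notation mR := (measurableTypeR R).
Let U x := V.[x] + C.
Implicit Type l : n.-tuple mR.

(** [log_pairs] is twice the logarithm of the absolute Vandermonde determinant. Distinctness
    matters: with [ln 0 = 0] the right-hand side stays positive where the density vanishes. *)
Lemma gibbs_density_uniq l : uniq l -> gibbs_density V beta l =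
  expR (beta / 2 * (n%:R ^+ 2 * C - hamiltonian U l)).
Proof.
move=> ul.
have neq (i j : 'I_n) : (i < j)%N -> (tnth l j : R) - tnth l i != 0.
  move=> ij; rewrite subr_eq0 !(tnth_nth 0) nth_uniq ?size_tuple//.
  by rewrite gt_eqF.
have lnv : `|vandermonde l| = expR (log_pairs l / 2).
  rewrite log_pairs_tuple (_ : forall x : R, x *+ 2 / 2 = x); last by move=> x; field.
  rewrite /vandermonde normr_prod.
  rewrite expR_sum; apply: eq_bigr => i _.
  rewrite normr_prod expR_sum; apply: eq_bigr => j ij.
  by rewrite lnK// posrE normr_gt0 neq.
rewrite /gibbs_density lnv /powR gt_eqF ?expR_gt0// expRK -expRD; congr expR.
rewrite /hamiltonian size_tuple /U big_split/= big_tuple.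
rewrite big_const_seq count_predT size_tuple iter_addr_0 -[C *+ n]mulr_natl.
by field.
Qed.

Lemma gibbs_density_nuniq l : ~~ uniq l -> gibbs_density V beta l = 0.
Proof.
move=> /(uniqPn 0)[i [j [ij]]]; rewrite size_tuple => jn e.
rewrite /gibbs_density (_ : vandermonde l = 0) ?normr0 ?powR0 ?mul0r ?gt_eqF//.
have i_n := ltn_trans ij jn.
rewrite /vandermonde (bigD1 (Ordinal i_n))//= (bigD1 (Ordinal jn))//=.
by rewrite !(tnth_nth 0)/= e subrr !mul0r.
Qed.

End density.

Section lebesgue_tuple_integral.
Local Open Scope ereal_scope.
Context {R : realType}.
Local Notation mR := (measurableTypeR R).

Lemma measurable_prod_tuple n (f : nat -> R -> R) :
  (forall i, measurable_fun [set: mR] (f i : mR -> R)) ->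
  measurable_fun [set: n.-tuple mR]
    (fun l : n.-tuple mR => (\prod_(i < n) f i (tnth l i))%:E).
Proof.
move=> mf; apply/measurable_EFinP; apply: measurable_prod => i _.
by apply: (@measurableT_comp _ _ _ _ _ _ (f i : mR -> R)) => //; exact: measurable_tnth.
Qed.

Lemma integral_lebesgue_tuple_prod n (f : nat -> R -> R) :
  (forall i, measurable_fun [set: mR] (f i : mR -> R)) ->
  (forall i x, (0 <= f i x)%R) ->
  \int[@lebesgue_tuple R n]_l (\prod_(i < n) f i (tnth l i))%:E =
  \prod_(i < n) \int[@lebesgue_measure R]_x (f i x)%:E.
Proof.
elim: n f => [|n IH] f mf f0.
  rewrite big_ord0 /=.
  rewrite integral_dirac//; last exact: measurable_prod_tuple.
  by rewrite diracT mul1e big_ord0.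
rewrite big_ord_recl /= /lebesgue_cons ge0_integral_pushforward//; last 3 first.
- exact: measurable_cons_pair.
- exact: measurable_prod_tuple.
- by move=> l _; rewrite lee_fin prodr_ge0.
rewrite preimage_setT.
have mc := measurableT_comp (@measurable_prod_tuple n.+1 f mf) (@measurable_cons_pair R n).
rewrite fubini_tonelli1//=; last first.
  by move=> z; rewrite lee_fin prodr_ge0.
rewrite /fubini_F /=.
have E (x : mR) (y : n.-tuple mR) :
    (\prod_(i < n.+1) f i (tnth (cons_pair (x, y)) i))%:E =
    (f 0%N x)%:E * (\prod_(i < n) f i.+1 (tnth y i))%:E.
  rewrite big_ord_recl /= EFinM; congr (_%:E * _%:E).
  by apply: eq_bigr => i _; rewrite !(tnth_nth 0%R).
under eq_integral => x _.
  under eq_integral => y _ do rewrite E.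
  rewrite ge0_integralZl//=; last 3 first.
  - exact: (@measurable_prod_tuple n (fun i => f i.+1)).
  - by move=> y _; rewrite lee_fin prodr_ge0.
  - by rewrite lee_fin.
  rewrite (IH (fun i => f i.+1))//.
  over.
rewrite ge0_integralZr//=.
- by apply/measurable_EFinP; exact: mf.
- by move=> x _; rewrite lee_fin.
- by apply: prode_ge0 => i _; apply: integral_ge0 => x _; rewrite lee_fin.
Qed.

End lebesgue_tuple_integral.

Lemma integral_expR_square_lty {R : realType} (c : R) : 0 < c ->
  (\int[@lebesgue_measure R]_x (expR (- (c * x ^+ 2)))%:E < +oo)%E.
Proof.
move=> c0; pose s := Num.sqrt ((2 * c)^-1).
have s0 : s != 0 by rewrite gt_eqF// sqrtr_gt0 invr_gt0 mulr_gt0.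
have s2 : s ^+ 2 = (2 * c)^-1 by rewrite sqr_sqrtr// invr_ge0 mulr_ge0// ltW.
have pk := normal_peak_gt0 s0.
have E (x : R) : expR (- (c * x ^+ 2)) = (normal_peak s)^-1 * normal_pdf 0 s x.
  rewrite /normal_pdf (negbTE s0)/= /normal_fun mulKf ?gt_eqF// s2 subr0.
  by congr expR; field; rewrite gt_eqF.
under eq_integral do rewrite E EFinM.
rewrite ge0_integralZl_EFin//=.
- by rewrite integral_normal_pdf mule1 ltry.
- by move=> x _; rewrite lee_fin normal_pdf_ge0.
- by apply/measurable_EFinP; exact: measurable_normal_pdf.
- by rewrite invr_ge0 ltW.
Qed.

(** Comparison with a Gaussian, through [x^2 - 1 <= |x|^p]. *)
Lemma confining_integral_lty {R : realType} p (U : R -> R) (b : R) :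
  (2 <= p)%N -> confining p U -> 0 < b ->
  (\int[@lebesgue_measure R]_x (expR (- (b * U x)))%:E < +oo)%E.
Proof.
move=> p2 [_ _ _ [k k0 kU] _] b0.
apply: (@le_lt_trans _ _ (\int[@lebesgue_measure R]_x
   ((expR (b * k))%:E * (expR (- (b * k * x ^+ 2)))%:E))%E).
  apply: ge0_le_integralT => x; first by rewrite lee_fin expR_ge0.
  rewrite -EFinM -expRD lee_fin ler_expR.
  have : x ^+ 2 - 1 <= `|x| ^+ p.
    have [x1|x1] := lerP `|x| 1.
      rewrite (@le_trans _ _ 0) ?exprn_ge0// subr_le0 -real_normK ?num_real//.
      by rewrite exprn_ile1.
    rewrite -real_normK ?num_real// lerBlDr (@le_trans _ _ (`|x| ^+ p))//; last by lra.
    by rewrite ler_weXn2l// ltW.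
  have := kU x; set y := `|x| ^+ p => h1 h2.
  have : k * (x ^+ 2 - 1) <= U x by rewrite (le_trans _ h1)// ler_wpM2l// ltW.
  by move=> /(ler_wpM2l (ltW b0)); lra.
rewrite ge0_integralZl_EFin//=.
- by rewrite lte_mul_pinfty ?lee_fin ?expR_ge0// integral_expR_square_lty// mulr_gt0.
- apply/measurable_EFinP; apply: continuous_measurable_fun => x.
  apply: continuous_comp; last exact: continuous_expR.
  apply: cvgN; apply: cvgM; first exact: cvg_cst.
  exact: exprn_continuous.
Qed.

Section gibbs_bounds.
Local Open Scope ereal_scope.
Context {R : realType}.
Variables (n p : nat) (V : {poly R}) (C beta : R).
Hypothesis beta_gt0 : (0 < beta)%R.
Local Notation mR := (measurableTypeR R).
Let U x := (V.[x] + C)%R.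
Hypothesis confU : confining p U.

(** The sum of [U] kept in the hypothesis becomes a product of one-dimensional densities of total
    mass [D ^ n], so that a set of infinite Lebesgue measure costs only a factor exponential in
    [n]. *)
Lemma gibbs_weight_le (A : set (n.-tuple mR)) (M D : R) :
  \int[@lebesgue_measure R]_x (expR (- (beta / 2 * U x)))%:E = D%:E ->
  (forall l, A l -> uniq l ->
    (M + \sum_(x <- (l : seq R)) U x <= hamiltonian U (l : seq R))%R) ->
  gibbs_weight V beta A <= (expR (beta / 2 * (n%:R ^+ 2 * C - M)) * D ^+ n)%:E.
Proof.
move=> hD hA; rewrite /gibbs_weight integral_mkcond.
pose f (i : nat) (x : R) := expR (- (beta / 2 * U x)).
have mf i : measurable_fun [set: mR] (f i : mR -> R).
  apply: continuous_measurable_fun => x; rewrite /f.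
  apply: continuous_comp; last exact: continuous_expR.
  apply: cvgN; apply: cvgM; first exact: cvg_cst.
  exact: (confining_continuous confU).
have f0 i x : (0 <= f i x)%R by exact: expR_ge0.
rewrite EFinM; have -> : (D ^+ n)%:E = \prod_(i < n) \int[@lebesgue_measure R]_x (f i x)%:E.
  by rewrite (eq_bigr (fun=> D%:E))// prodEFin prodr_const card_ord.
rewrite -(@integral_lebesgue_tuple_prod _ n f mf f0).
rewrite -ge0_integralZl//=; last 2 first.
- exact: (@measurable_prod_tuple _ n f).
- by move=> l _; rewrite lee_fin prodr_ge0.
apply: ge0_le_integralT => l.
  by rewrite /patch; case: ifPn => // _; rewrite lee_fin gibbs_density_ge0.
have pos : 0 <= (expR (beta / 2 * (n%:R ^+ 2 * C - M)))%:E * (\prod_(i < n) f i (tnth l i))%:E.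
  by rewrite -EFinM lee_fin mulr_ge0 ?expR_ge0 ?prodr_ge0.
rewrite /patch; case: ifPn => // lA; rewrite inE in lA.
have [ul|ul] := boolP (uniq l); last by rewrite gibbs_density_nuniq.
rewrite (gibbs_density_uniq V C)// -EFinM lee_fin -expR_sum -expRD ler_expR.
have b2 : (0 <= beta / 2)%R by rewrite divr_ge0// ltW.
rewrite sumrN -mulr_sumr.
by have := ler_wpM2l b2 (hA l lA ul); rewrite big_tuple -/U; lra.
Qed.

Lemma gibbs_weight_ge (A : set (n.-tuple mR)) (a : nat -> R) (eta M : R) :
  (0 < eta)%R ->
  (forall l : n.-tuple mR, (forall i : 'I_n, a i <= tnth l i <= a i + eta)%R ->
    [/\ A l, uniq l & (hamiltonian U (l : seq R) <= M)%R]) ->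
  (expR (beta / 2 * (n%:R ^+ 2 * C - M)) * eta ^+ n)%:E <= gibbs_weight V beta A.
Proof.
move=> eta0 hA; rewrite /gibbs_weight integral_mkcond.
pose f (i : nat) (x : R) : R := \1_(`[a i, (a i + eta)%R]%classic : set R) x.
have mf i : measurable_fun [set: mR] (f i : mR -> R).
  by apply: measurable_indic; exact: measurable_itv.
have f0 i x : (0 <= f i x)%R by rewrite /f indicE.
have -> : (expR (beta / 2 * (n%:R ^+ 2 * C - M)) * eta ^+ n)%:E =
  (expR (beta / 2 * (n%:R ^+ 2 * C - M)))%:E *
  \prod_(i < n) \int[@lebesgue_measure R]_x (f i x)%:E.
  rewrite EFinM; congr (_ * _).
  rewrite (eq_bigr (fun=> eta%:E)) => [|i _]; last first.
    rewrite integral_indic//= setIT lebesgue_measure_itv/= lte_fin ltrDl eta0.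
    by rewrite -EFinB addrC addKr.
  by rewrite prodEFin prodr_const card_ord.
rewrite -(@integral_lebesgue_tuple_prod _ n f mf f0).
rewrite -ge0_integralZl//=; last 2 first.
- exact: (@measurable_prod_tuple _ n f).
- by move=> l _; rewrite lee_fin prodr_ge0.
apply: ge0_le_integralT => l.
  by rewrite -EFinM lee_fin mulr_ge0 ?expR_ge0 ?prodr_ge0.
have d0 : 0 <= ((fun l => (gibbs_density V beta l)%:E) \_ A) l.
  by rewrite /patch; case: ifPn => // _; rewrite lee_fin gibbs_density_ge0.
have [box|nbox] := pselect (forall i : 'I_n, (a i <= tnth l i <= a i + eta)%R).
  have [lA ul lM] := hA l box.
  rewrite /patch mem_set// big1 ?mule1; last first.
    by move=> i _; rewrite /f indicE mem_set//= in_itv/= box.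
  rewrite lee_fin (gibbs_density_uniq V C)// ler_expR ler_wpM2l ?divr_ge0//; last 2 first.
    exact: ltW.
  by rewrite lerB.
have [i hi] : exists i : 'I_n, ~ (a i <= tnth l i <= a i + eta)%R by exact/existsNP.
rewrite (bigD1 i)//= /f indicE memNset ?mul0r ?mule0//.
Qed.

End gibbs_bounds.

(** * The logarithmic kernel and its Lipschitz minorants *)

Section prob_image.
Local Open Scope ereal_scope.
Context d1 d2 (T1 : measurableType d1) (T2 : measurableType d2) (R : realType).
Variables (m : probability T1 R) (f : T1 -> T2) (mf : measurable_fun [set: T1] f).

(* [pushforward] carries no canonical measure unless [f] comes with [mf]. *)
Definition prob_image of measurable_fun [set: T1] f : set T2 -> \bar R :=
  pushforward m f.

Let mpre A : measurable A -> measurable (f @^-1` A).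
Proof. by move=> mA; rewrite -[X in measurable X]setTI; exact: mf. Qed.

Let prob_image0 : prob_image mf set0 = 0.
Proof. by rewrite /prob_image /pushforward preimage_set0 measure0. Qed.

Let prob_image_ge0 A : 0 <= prob_image mf A.
Proof. exact: measure_ge0. Qed.

Let prob_image_sigma_additive : semi_sigma_additive (prob_image mf).
Proof.
move=> F mF tF mUF; rewrite /prob_image /pushforward preimage_bigcup.
apply: measure_semi_sigma_additive.
- by move=> n; exact: mpre.
- apply/trivIsetP => /= i j _ _ ij; rewrite -preimage_setI.
  by move/trivIsetP : tF => /(_ _ _ _ _ ij) ->//; rewrite preimage_set0.
- by rewrite -preimage_bigcup; exact: mpre.
Qed.

HB.instance Definition _ := isMeasure.Build _ _ _ (prob_image mf)
  prob_image0 prob_image_ge0 prob_image_sigma_additive.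

Let prob_imageT : prob_image mf setT = 1.
Proof. by rewrite /prob_image /pushforward preimage_setT probability_setT. Qed.

HB.instance Definition _ := Measure_isProbability.Build _ _ _ (prob_image mf)
  prob_imageT.

Lemma ge0_integral_prob_image (g : T2 -> \bar R) :
  measurable_fun setT g -> (forall y, 0 <= g y) ->
  \int[prob_image mf]_y g y = \int[m]_x g (f x).
Proof.
move=> mg g0; rewrite /prob_image ge0_integral_pushforward//.
Qed.

End prob_image.

Section logker.
Local Open Scope ereal_scope.
Context {R : realType}.
Variables (p : nat) (U : R -> R).
Hypothesis confU : confining p U.
Local Notation mR := (measurableTypeR R).

(** With [lne] the kernel is +oo on the diagonal, as lower semicontinuity requires, whereas
    [log_pairs], built on [ln], omits the diagonal. *)
Definition logker (z : mR * mR) : \bar R :=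
  (((U z.1 + U z.2) / 2)%R)%:E - lne `|(z.1 : R) - z.2|%:E.

Lemma logker_diag x : logker (x, x) = +oo.
Proof. by rewrite /logker/= subrr normr0 lexx. Qed.

Lemma logker_neq (x y : R) : x != y ->
  logker (x, y) = ((U x + U y) / 2 - ln `|x - y|)%:E.
Proof.
by move=> xy; rewrite /logker lne_EFin ?EFinB// normr_gt0 subr_eq0.
Qed.

Lemma logker_sym x y : logker (x, y) = logker (y, x).
Proof. by rewrite /logker/= (addrC (U x)) distrC. Qed.

(** ln |x - y| <= |x| + |y| <= (U x + U y) / 4, by [confining_linear]. *)
Lemma logker_ge x y : ((U x + U y) / 4)%:E <= logker (x, y).
Proof.
have [->|xy] := eqVneq x y; first by rewrite logker_diag leey.
rewrite logker_neq// lee_fin.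
have d0 : (0 < `|(x : R) - y|)%R by rewrite normr_gt0 subr_eq0.
have := ln_sublinear d0; have := ler_normB x y.
have := confining_linear confU x; have := confining_linear confU y.
lra.
Qed.

Lemma confining_ge0 x : (0 <= U x)%R.
Proof. by apply: le_trans (confining_linear confU x); rewrite mulr_ge0. Qed.

Lemma logker_ge0 z : 0 <= logker z.
Proof.
case: z => x y; apply: le_trans (logker_ge x y).
by rewrite lee_fin divr_ge0// addr_ge0// confining_ge0.
Qed.

Lemma measurable_confining : measurable_fun [set: mR] (U : mR -> R).
Proof. exact: continuous_measurable_fun (confining_continuous confU). Qed.

Lemma measurable_logker : measurable_fun setT logker.
Proof.
rewrite /logker; apply: emeasurable_funB.
  apply/measurable_EFinP; apply: measurable_funM => //.
  apply: measurable_funD; apply: measurableT_comp => //; exact: measurable_confining.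
rewrite /lne; apply: measurable_fun_if => //.
- apply: measurable_fun_ler => //.
  apply: measurableT_comp => //; exact: measurable_funB.
- apply: measurable_funTS; apply/measurable_EFinP.
  apply: measurableT_comp; first exact: measurable_ln.
  apply: measurableT_comp => //; exact: measurable_funB.
Qed.

Lemma lower_semicontinuous_logker : lower_semicontinuous (logker : R * R -> \bar R).
Proof.
move=> [x y] a; have [<-{y} _|xy] := eqVneq x y.
  (* Points of this neighbourhood of a diagonal point are at distance less than [expR (- a)] from
     each other, and [U] is nonnegative. *)
  exists [set w | `|w.1 - x| < expR (- a) / 2 /\ `|w.2 - x| < expR (- a) / 2]%R.
    have e0 : (0 < expR (- a) / 2)%R by rewrite divr_gt0// expR_gt0.
    exists (ball x (expR (- a) / 2), ball x (expR (- a) / 2)) => /=.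
      by split; exact: nbhsx_ballx.
    by move=> [u v] /= [xu xv]; rewrite distrC (distrC v).
  move=> [u v] /= [ux vx].
  have [<-|uv] := eqVneq u v; first by rewrite logker_diag ltry.
  rewrite logker_neq// lte_fin.
  have : (ln `|u - v| < - a)%R.
    rewrite -[ltRHS](expRK (- a)%R) ltr_ln ?posrE ?expR_gt0 ?normr_gt0 ?subr_eq0//.
    have := ler_distD x u v; rewrite (distrC x v); lra.
  have := confining_ge0 u; have := confining_ge0 v; lra.
rewrite logker_neq// lte_fin => ag.
pose g (w : R * R) := ((U w.1 + U w.2) / 2 - ln `|w.1 - w.2|)%R.
have cg : g @ (x, y) --> g (x, y).
  apply: cvgB.
    apply: cvgMl; apply: cvgD.
      by apply: (continuous_comp (g := U)); [exact: cvg_fst|exact: (confining_continuous confU)].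
    by apply: (continuous_comp (g := U)); [exact: cvg_snd|exact: (confining_continuous confU)].
  have c1 : (fun w : R * R => `|w.1 - w.2|%R) @ (x, y) --> `|x - y|%R.
    by apply: cvg_norm; apply: cvgB; [exact: cvg_fst|exact: cvg_snd].
  have xy0 : (0 < `|x - y|)%R by rewrite normr_gt0 subr_eq0.
  exact: (cvg_comp _ _ c1 (continuous_ln xy0)).
exists [set w | (a < g w)%R].
  by apply: (cg [set t | (a < t)%R]); exact: lt_nbhsr.
move=> [u v] /= auv.
have [<-|uv] := eqVneq u v; first by rewrite logker_diag ltry.
by rewrite logker_neq// lte_fin.
Qed.

End logker.

Section lip_env.
Local Open Scope ereal_scope.
Context {R : realType}.
Variable G : R * R -> \bar R.
Hypothesis G0 : forall z, 0 <= G z.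
Implicit Types (z w : R * R) (k : nat).

Definition l1dist z w : R := (`|z.1 - w.1| + `|z.2 - w.2|)%R.

(* The truncated Pasch-Hausdorff envelope: the largest [k]-Lipschitz minorant
   of [G] for [l1dist], cut at height [k]. *)
Definition lip_env k z : R :=
  fine (mine k%:R%:E (ereal_inf (range (fun w => G w + (k%:R * l1dist z w)%:E)))).

Let l1dist_ge0 z w : (0 <= l1dist z w)%R.
Proof. by rewrite addr_ge0. Qed.

Let inf_ge0 k z : 0 <= ereal_inf (range (fun w => G w + (k%:R * l1dist z w)%:E)).
Proof.
apply: le_ereal_inf_tmp => _ [w _ <-]; apply: adde_ge0 => //.
by rewrite lee_fin mulr_ge0.
Qed.

Lemma lip_envE k z : (lip_env k z)%:E =
  mine k%:R%:E (ereal_inf (range (fun w => G w + (k%:R * l1dist z w)%:E))).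
Proof.
rewrite /lip_env fineK// ge0_fin_numE; last by rewrite le_min lee_fin ler0n/=.
by rewrite gt_min ltry.
Qed.

Lemma lip_env_ge0 k z : (0 <= lip_env k z)%R.
Proof. by rewrite -lee_fin lip_envE le_min lee_fin ler0n/=. Qed.

Lemma lip_env_le_cst k z : (lip_env k z <= k%:R)%R.
Proof. by rewrite -lee_fin lip_envE ge_min lexx. Qed.

Lemma lip_env_le k z : (lip_env k z)%:E <= G z.
Proof.
rewrite lip_envE ge_min; apply/orP; right.
apply: ereal_inf_lbound; exists z => //.
by rewrite /l1dist !subrr !normr0 addr0 mulr0 adde0.
Qed.

Lemma lip_env_homo k m z : (k <= m)%N -> (lip_env k z <= lip_env m z)%R.
Proof.
move=> km; rewrite -lee_fin !lip_envE le_min !ge_min lee_fin ler_nat km/=.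
apply/orP; right; apply: le_ereal_inf_tmp => _ [w _ <-].
apply: (@le_trans _ _ (G w + (k%:R * l1dist z w)%:E)).
  by apply: ereal_inf_lbound; exists w.
by rewrite leeD2l// lee_fin ler_wpM2r// ler_nat.
Qed.

Lemma lip_env_lipschitz k z w :
  (lip_env k z <= lip_env k w + k%:R * l1dist z w)%R.
Proof.
rewrite -lee_fin EFinD [X in _ <= X + _]lip_envE.
have c0 : (0 <= k%:R * l1dist z w)%R by rewrite mulr_ge0.
case: (leP (k%:R%:E) _) => _.
  by rewrite -EFinD lee_fin (le_trans (lip_env_le_cst k z))// lerDl.
rewrite -leeBlDr//; apply: le_ereal_inf_tmp => _ [v _ <-].
rewrite leeBlDr// -addeA -EFinD.
apply: (@le_trans _ _ (G v + (k%:R * l1dist z v)%:E)).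
  rewrite lip_envE ge_min; apply/orP; right.
  by apply: ereal_inf_lbound; exists v.
rewrite leeD2l// lee_fin -mulrDr ler_wpM2l//.
have := ler_distD w.1 z.1 v.1; have := ler_distD w.2 z.2 v.2; rewrite /l1dist; lra.
Qed.

Lemma lip_env_lim z (a : R) : lower_semicontinuous G -> a%:E < G z ->
  exists k0, forall k, (k0 <= k)%N -> (a <= lip_env k z)%R.
Proof.
move=> lG /lG[A]; rewrite -nbhs_ballE => -[e /= e0 eA] aG.
(* Points [w] within [e] of [z] have [G w > a]; farther points pay [k e >= |a|]; and the cut at
   height [k] is above [a]. *)
exists (Num.truncn (`|a| + `|a| / e)).+1 => k k0.
have ka : (`|a| + `|a| / e <= k%:R)%R.
  by rewrite (le_trans (ltW (truncnS_gt _)))// ler_nat.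
have ae : (0 <= `|a| / e)%R by rewrite divr_ge0// ltW.
rewrite -lee_fin lip_envE le_min lee_fin; apply/andP; split.
  by have := ler_norm a; lra.
apply: le_ereal_inf_tmp => _ [w _ <-].
have d0 := l1dist_ge0 z w.
have [zw|zw] := ltP (l1dist z w) e.
  rewrite -[leLHS]adde0; apply: leeD; last by rewrite lee_fin mulr_ge0.
  apply/ltW/aG/eA; split; rewrite /ball/=.
    by apply: le_lt_trans zw; rewrite lerDl.
  by apply: le_lt_trans zw; rewrite lerDr.
rewrite -[leLHS]add0e; apply: leeD => //.
rewrite lee_fin (le_trans (ler_norm a))//.
apply: (@le_trans _ _ (`|a| / e * e)%R); first by rewrite divfK// gt_eqF.
by apply: ler_pM => //; [exact: ltW|have := normr_ge0 a; lra].
Qed.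

Lemma limn_lip_env z : lower_semicontinuous G ->
  limn (fun k => (lip_env k z)%:E) = G z.
Proof.
move=> lG; apply/cvg_lim => //.
have hd : nondecreasing_seq (fun k => (lip_env k z)%:E).
  by move=> k m km; rewrite lee_fin lip_env_homo.
have := ereal_nondecreasing_cvgn hd.
rewrite (_ : ereal_sup _ = G z)//.
apply/eqP; rewrite eq_le; apply/andP; split.
  by apply: ge_ereal_sup => _ [k _ <-]; exact: lip_env_le.
apply: lee_real_lower => b /(lip_env_lim lG)[k hk].
apply: (@le_trans _ _ (lip_env k z)%:E); first by rewrite lee_fin hk.
by apply: ereal_sup_ubound; exists k.
Qed.

(** The Lipschitz bound writes a strict sublevel set as a countable union over rational points:
    those [z] for which the value at the rational point plus [k] times the distance is below the
    level. *)
Lemma measurable_lip_env k :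
  measurable_fun setT (lip_env k : measurableTypeR R * measurableTypeR R -> R).
Proof.
apply: (measurability _ (@RGenInftyO.measurableE R)) => //= _ [_ [x ->] <-].
rewrite setTI (_ : _ @^-1` _ = \bigcup_(q : rat) \bigcup_(r : rat)
    [set z | lip_env k (ratr q, ratr r) + k%:R * l1dist z (ratr q, ratr r) < x]%R).
  apply: bigcupT_measurable_rat => q; apply: bigcupT_measurable_rat => r.
  rewrite -[X in measurable X]setTI; apply: measurable_fun_ltr => //.
  apply: measurable_funD => //; apply: measurable_funM => //.
  apply: measurable_funD; apply: measurableT_comp => //; exact: measurable_funB.
apply/seteqP; split => [z /=|z [q _ [r _]] /=]; rewrite in_itv/=; last first.
  by apply: le_lt_trans; exact: lip_env_lipschitz.
(* A rational point at distance at most [2 e] is paid for twice, in the value there and in the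
   distance added: [4 k e] stays below the gap. *)
move=> zx; pose e := ((x - lip_env k z) / (4 * (k%:R + 1)))%R.
have e0 : (0 < e)%R by rewrite divr_gt0 ?subr_gt0// mulr_gt0.
have [q qz] := @rat_in_itvoo _ z.1 (z.1 + e)%R ltac:(lra).
have [r rz] := @rat_in_itvoo _ z.2 (z.2 + e)%R ltac:(lra).
exists q => //; exists r => //=.
move: qz rz; rewrite !in_itv/= => /andP[q1 q2] /andP[r1 r2].
have d2e : (l1dist z (ratr q, ratr r) <= 2 * e)%R.
  by rewrite /l1dist/= !ltr0_norm; lra.
have := lip_env_lipschitz k (ratr q, ratr r) z.
have -> : l1dist (ratr q, ratr r) z = l1dist z (ratr q, ratr r).
  by rewrite /l1dist/= distrC (distrC (ratr r)).
have : (k%:R * l1dist z (ratr q, ratr r) <= k%:R * (2 * e))%R by rewrite ler_wpM2l.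
have ee : (e * (4 * (k%:R + 1)) = x - lip_env k z)%R by rewrite /e divfK// gt_eqF// mulr_gt0.
have k0 : (0 <= k%:R :> R)%R by [].
have : (0 < x - lip_env k z)%R by rewrite subr_gt0.
nra.
Qed.

End lip_env.

Lemma integral_prob_cst d (T : measurableType d) (R : realType)
  (P : probability T R) (r : \bar R) : (\int[P]_x r = r)%E.
Proof.
rewrite integral_cst// [X in (_ * X)%E](_ : _ = 1%E) ?mule1//.
exact: probability_setT.
Qed.

Section iterated_integral.
Local Open Scope ereal_scope.
Context {R : realType}.
Local Notation mR := (measurableTypeR R).
Implicit Types (nu : probability mR R) (F G : mR * mR -> \bar R).

(** Iterated rather than taken against the product measure, so that each variable can be coupled, or
    conditioned to a cell, separately. *)
Definition dint nu F : \bar R := \int[nu]_x \int[nu]_y F (x, y).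

Lemma dintE nu F : measurable_fun setT F -> (forall z, 0 <= F z) ->
  dint nu F = \int[nu \x nu]_z F z.
Proof. by move=> mF F0; rewrite fubini_tonelli1. Qed.

Lemma dint_ge0 nu F : (forall z, 0 <= F z) -> 0 <= dint nu F.
Proof. by move=> F0; apply: integral_ge0 => x _; exact: integral_ge0. Qed.

Lemma le_dint nu F G : (forall z, 0 <= F z) -> (forall z, F z <= G z) ->
  dint nu F <= dint nu G.
Proof.
move=> F0 FG; apply: ge0_le_integralT => x; first exact: integral_ge0.
exact: ge0_le_integralT.
Qed.

Lemma measurable_shift2 (c : R) :
  measurable_fun setT (fun z : mR * mR => ((c - z.1)%R : mR, (c - z.2)%R : mR)).
Proof.
by apply: measurable_fun_pair; apply: measurable_funB.
Qed.

Lemma measurable_flip (c : R) : measurable_fun setT (fun x : mR => (c - x)%R : mR).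
Proof. exact: measurable_funB. Qed.

(** The measure [tau c nu], packaged as a probability so that results on [energy] apply to it. *)
Definition flip (c : R) nu : probability mR R := prob_image nu (measurable_flip c).

Lemma dint_flip c nu F : measurable_fun setT F -> (forall z, 0 <= F z) ->
  dint (flip c nu) F = dint nu (fun z => F ((c - z.1)%R, (c - z.2)%R)).
Proof.
move=> mF F0; rewrite /dint /flip ge0_integral_prob_image; last 2 first.
- exact: measurable_fun_fubini_tonelli_F.
- by move=> y; exact: integral_ge0.
apply: eq_integral => x _; rewrite ge0_integral_prob_image//.
exact: measurableT_comp.
Qed.

Lemma ge0_integral_fst (pi : probability (mR * mR)%type R) nu (g : mR -> \bar R) :
  (forall A, measurable A -> pi (A `*` setT) = nu A) ->
  measurable_fun setT g -> (forall x, 0 <= g x) ->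
  \int[nu]_x g x = \int[pi]_z g z.1.
Proof.
move=> pi1 mg g0.
rewrite -(ge0_integral_prob_image pi (measurable_fst : measurable_fun setT fst) mg g0).
apply: eq_measure_integral => A mA _; transitivity (pi (A `*` setT)); first by rewrite pi1.
by congr (pi _); apply/seteqP; split => [[x y] []|[x y]] //= ?; split.
Qed.

Lemma ge0_integral_snd (pi : probability (mR * mR)%type R) nu (g : mR -> \bar R) :
  (forall A, measurable A -> pi (setT `*` A) = nu A) ->
  measurable_fun setT g -> (forall x, 0 <= g x) ->
  \int[nu]_x g x = \int[pi]_z g z.2.
Proof.
move=> pi1 mg g0.
rewrite -(ge0_integral_prob_image pi (measurable_snd : measurable_fun setT snd) mg g0).
apply: eq_measure_integral => A mA _; transitivity (pi (setT `*` A)); first by rewrite pi1.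
by congr (pi _); apply/seteqP; split => [[x y] []|[x y]] //= ?; split.
Qed.

(** Two independent copies [z] and [w] of the coupling carry the square of [nu] to the square of
    [nu']; each contributes [L] times the mean displacement, whence the factor [2 * L]. *)
Lemma dint_coupling (pi : probability (mR * mR)%type R) nu nu' F G (D : R) :
  couplings nu nu' pi ->
  measurable_fun setT F -> (forall z, 0 <= F z) ->
  measurable_fun setT G -> (forall z, 0 <= G z) ->
  forall L : R, (0 <= L)%R -> (0 <= D)%R ->
  (forall z w : mR * mR, F (z.1, w.1) <= G (z.2, w.2) +
     (D + L * `|(z.1 : R) - z.2| + L * `|(w.1 : R) - w.2|)%:E) ->
  dint nu F <= dint nu' G + (D%:E + (2 * L)%:E * \int[pi]_z `|(z.1 : R) - z.2|%:E).
Proof.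
move=> [pi1 pi2] mF F0 mG G0 L L0 D0 FG.
have md : measurable_fun setT (fun z : mR * mR => `|(z.1 : R) - z.2|%:E).
  by apply/measurable_EFinP; apply: measurableT_comp => //; exact: measurable_funB.
have i0 : 0 <= \int[pi]_z `|(z.1 : R) - z.2|%:E.
  by apply: integral_ge0 => z _; rewrite lee_fin.
rewrite /dint (ge0_integral_fst pi1); last 2 first.
- exact: measurable_fun_fubini_tonelli_F.
- by move=> x; exact: integral_ge0.
rewrite [X in _ <= X + _](ge0_integral_snd pi2); last 2 first.
- exact: measurable_fun_fubini_tonelli_F.
- by move=> x; exact: integral_ge0.
have mGf : measurable_fun setT (fun z : mR * mR => \int[nu']_y G (z.2, y)).
  apply: (@measurableT_comp _ _ _ _ _ _ (fun x : mR => \int[nu']_y G (x, y)) _ snd) => //.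
  exact: measurable_fun_fubini_tonelli_F.
have E (a b : R) : (0 <= a)%R -> (0 <= b)%R -> \int[pi]_z (a%:E + b%:E * `|(z.1 : R) - z.2|%:E) =
    a%:E + b%:E * \int[pi]_z `|(z.1 : R) - z.2|%:E.
  move=> a0 b0; rewrite ge0_integralD//; last 2 first.
  - by move=> z _; rewrite -EFinM lee_fin mulr_ge0.
  - exact: emeasurable_funM.
  rewrite integral_prob_cst ge0_integralZl_EFin//.
apply: (@le_trans _ _ (\int[pi]_z (\int[nu']_y G (z.2, y) +
   ((D%:E + L%:E * `|(z.1 : R) - z.2|%:E) + L%:E * \int[pi]_z `|(z.1 : R) - z.2|%:E)))).
  apply: ge0_le_integralT => z; first exact: integral_ge0.
  rewrite (ge0_integral_fst pi1)//; last exact: measurableT_comp.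
  rewrite (ge0_integral_snd pi2)//; last exact: measurableT_comp.
  have Lz : (0 <= D + L * `|(z.1 : R) - z.2|)%R by rewrite addr_ge0// mulr_ge0.
  rewrite -EFinM -EFinD -E// -ge0_integralD//; last 3 first.
  - by apply: measurableT_comp => //; apply: measurable_fun_pair.
  - by move=> w _; rewrite -EFinM -EFinD lee_fin addr_ge0// mulr_ge0.
  - by apply: emeasurable_funD => //; apply: emeasurable_funM.
  apply: ge0_le_integralT => w; first exact: F0.
  by rewrite -EFinM -EFinD; exact: FG.
have I0 : 0 <= L%:E * \int[pi]_z `|(z.1 : R) - z.2|%:E by rewrite mule_ge0// lee_fin.
rewrite ge0_integralD//; last 3 first.
- by move=> z _; exact: integral_ge0.
- by move=> z _; rewrite -EFinM -EFinD adde_ge0// lee_fin addr_ge0// mulr_ge0.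
- apply: emeasurable_funD => //; apply: emeasurable_funD => //.
  exact: emeasurable_funM.
apply: leeD2l; rewrite ge0_integralD//; last 2 first.
- by move=> z _; rewrite -EFinM -EFinD lee_fin addr_ge0// mulr_ge0.
- by apply: emeasurable_funD => //; exact: emeasurable_funM.
rewrite E// -addeA leeD2l//.
rewrite integral_prob_cst -ge0_muleDl ?lee_fin// -EFinD.
by rewrite (_ : (2 * L = L + L)%R)//; ring.
Qed.

(** The mean displacement is bounded without Hoelder's inequality: [t <= d + d^-(p-1) t^p] for all
    [t >= 0], and the integral of [t^p] is below [d^p]. *)
Lemma wasserstein_lt_coupling p nu nu' (d : R) : (0 < p)%N -> (0 < d)%R ->
  wasserstein p nu nu' < d%:E ->
  exists2 pi, couplings nu nu' pi & \int[pi]_z `|(z.1 : R) - z.2|%:E <= (2 * d)%:E.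
Proof.
move=> p0 d0; rewrite /wasserstein; set S := [set _ | _ in _] => Sd.
have : ereal_inf S < (d ^+ p)%:E.
  rewrite ltNge; apply/negP => dS; move: Sd; apply/negP; rewrite -leNgt.
  apply: (@le_trans _ _ ((d ^+ p)%:E `^ p%:R^-1)).
    rewrite poweR_EFin lee_fin -(powR_mulrn _ (ltW d0)) -powRrM mulfV ?pnatr_eq0 -?lt0n//.
    by rewrite (powRr1 (ltW d0)).
  apply: gt0_ler_poweR => //; rewrite ?invr_ge0// in_itv/= leey ?andbT.
    by rewrite lee_fin exprn_ge0// ltW.
  by apply: le_trans dS; rewrite lee_fin exprn_ge0// ltW.
move=> /ereal_inf_lt[_ [pi cpi <-] pid]; exists pi => //.
pose t (z : mR * mR) : R := `|(z.1 : R) - z.2|%R.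
have t0 z : (0 <= t z)%R by rewrite /t.
have dm0 : (0 <= d ^- p.-1)%R by rewrite invr_ge0 exprn_ge0// ltW.
have mt : measurable_fun setT t.
  by apply: measurableT_comp => //; exact: measurable_funB.
have mtp : measurable_fun setT (fun z => (t z ^+ p)%:E).
  by apply/measurable_EFinP; exact: measurable_funX.
apply: (@le_trans _ _ (\int[pi]_z (d%:E + (d ^- p.-1)%:E * (t z ^+ p)%:E))).
  apply: ge0_le_integralT => z; first by rewrite lee_fin.
  rewrite -EFinM -EFinD lee_fin -/(t z).
  have dp : (0 <= d ^- p.-1 * t z ^+ p)%R.
    by rewrite mulr_ge0 ?exprn_ge0.
  have [td|td] := lerP (t z) d; first by rewrite (le_trans td)// lerDl.
  apply: (@le_trans _ _ (d ^- p.-1 * t z ^+ p)%R); last by rewrite lerDr ltW.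
  rewrite mulrC ler_pdivlMr ?exprn_gt0//.
  rewrite -[in leRHS](prednK p0) exprS ler_wpM2l//.
  by rewrite lerXn2r ?nnegrE// ltW.
rewrite ge0_integralD//; last 3 first.
- by move=> z _; rewrite lee_fin ltW.
- by move=> z _; rewrite -EFinM lee_fin mulr_ge0 ?exprn_ge0.
- exact: emeasurable_funM.
rewrite integral_prob_cst ge0_integralZl_EFin//; last first.
  by move=> z _; rewrite lee_fin exprn_ge0.
rewrite (_ : (2 * d)%:E = d%:E + d%:E); last by rewrite -EFinD; congr _%:E; ring.
apply: leeD2l.
apply: (@le_trans _ _ ((d ^- p.-1)%:E * (d ^+ p)%:E)).
  by apply: lee_wpmul2l; [rewrite lee_fin invr_ge0 exprn_ge0// ltW|exact: ltW].
rewrite -EFinM lee_fin -[in leLHS](prednK p0) exprS mulrC mulfK//.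
by rewrite expf_neq0// gt_eqF.
Qed.

End iterated_integral.

Section env_energy.
Local Open Scope ereal_scope.
Context {R : realType}.
Variables (p : nat) (U : R -> R).
Hypothesis confU : confining p U.
Local Notation mR := (measurableTypeR R).
Implicit Types (nu : probability mR R) (k : nat) (c : R).

Definition energy nu : \bar R := dint nu (logker U).

(** The reflection is kept in the integrand instead of the measure, so that [c] and [nu] can be
    varied independently. *)
Definition env_energy k c nu : \bar R :=
  dint nu (fun z => (lip_env (logker U) k ((c - z.1)%R, (c - z.2)%R))%:E).

Let ker0 := logker_ge0 confU.

Lemma measurable_shift_env k c : measurable_fun setT
  (fun z : mR * mR => (lip_env (logker U) k ((c - z.1)%R, (c - z.2)%R))%:E).
Proof.
apply/measurable_EFinP.
apply: (measurableT_comp (measurable_lip_env ker0 k) (measurable_shift2 c)).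
Qed.

Lemma measurable_shift_logker c : measurable_fun setT
  (fun z : mR * mR => logker U ((c - z.1)%R, (c - z.2)%R)).
Proof.
apply: (measurableT_comp (measurable_logker confU) (measurable_shift2 c)).
Qed.

Lemma energy_ge0 nu : 0 <= energy nu. Proof. exact: dint_ge0. Qed.

Lemma energy_flip c nu :
  energy (flip c nu) = dint nu (fun z => logker U ((c - z.1)%R, (c - z.2)%R)).
Proof. by rewrite /energy dint_flip//; exact: measurable_logker confU. Qed.

Lemma env_energy_homo k m c nu : (k <= m)%N -> env_energy k c nu <= env_energy m c nu.
Proof.
move=> km; apply: le_dint => z; first by rewrite lee_fin lip_env_ge0.
by rewrite lee_fin lip_env_homo.
Qed.

Lemma env_energy_le k c nu : env_energy k c nu <= energy (flip c nu).
Proof.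
rewrite energy_flip; apply: le_dint => z; first by rewrite lee_fin lip_env_ge0.
exact: lip_env_le.
Qed.

Lemma env_energy_lim c nu (a : R) : a%:E < energy (flip c nu) ->
  exists k, a%:E < env_energy k c nu.
Proof.
rewrite energy_flip dintE//; last exact: measurable_shift_logker.
have := @cvg_monotone_convergence _ _ _ (nu \x nu) setT measurableT
  (fun k z => (lip_env (logker U) k ((c - z.1)%R, (c - z.2)%R))%:E).
move=> /(_ (fun k => measurable_shift_env k c)).
move=> /(_ (fun k z _ => ltac:(by rewrite lee_fin; exact: lip_env_ge0))).
move=> /(_ (fun z _ => ltac:(by move=> k m km; rewrite lee_fin; exact: lip_env_homo))).
under eq_integral => z _.
  rewrite limn_lip_env//; last exact: (lower_semicontinuous_logker confU).
  over.
move=> cv alt; apply/not_existsP => nk; move: alt; apply/negP; rewrite -leNgt.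
rewrite -(cvg_lim _ cv)//; apply: lime_le; first by apply/cvg_ex; eexists; exact: cv.
apply: nearW => k; rewrite -dintE; last 2 first.
- exact: measurable_shift_env.
- by move=> z; rewrite lee_fin lip_env_ge0.
by rewrite leNgt; apply/negP/nk.
Qed.

Lemma env_energy_coupling k c c' nu nu' pi : couplings nu nu' pi ->
  env_energy k c nu <= env_energy k c' nu' +
   ((2 * k%:R * `|c - c'|)%:E + (2 * k%:R)%:E * \int[pi]_z `|(z.1 : R) - z.2|%:E).
Proof.
move=> cpi; apply: (dint_coupling cpi).
- exact: measurable_shift_env.
- by move=> z; rewrite lee_fin lip_env_ge0.
- exact: measurable_shift_env.
- by move=> z; rewrite lee_fin lip_env_ge0.
- by [].
- by rewrite !mulr_ge0.
move=> z w /=; rewrite -EFinD lee_fin.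
apply: (le_trans (lip_env_lipschitz ker0 k _ ((c' - z.2)%R, (c' - w.2)%R))).
rewrite lerD2l [leRHS](_ : _ = k%:R * (2 * `|c - c'| + `|z.1 - z.2| + `|w.1 - w.2|))%R; last by ring.
rewrite ler_wpM2l//.
rewrite /l1dist/=.
have h (a b : R) : (`|c - a - (c' - b)| <= `|c - c'| + `|a - b|)%R.
  by rewrite (_ : c - a - (c' - b) = (c - c') - (a - b))%R ?ler_normB//; ring.
have := h z.1 z.2; have := h w.1 w.2; lra.
Qed.

End env_energy.

(** * Semicontinuity of the rate function *)

Section rate_topology.
Local Open Scope ereal_scope.
Context {R : realType}.
Variables (p : nat) (U : R -> R) (E : set (measurableTypeR R)).
Hypothesis confU : confining p U.
Hypothesis p_gt0 : (0 < p)%N.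
Local Notation mR := (measurableTypeR R).
Local Notation X := (R * M1p E p)%type.

Let gap_above (a : R) (x : \bar R) : a%:E < x ->
  exists2 e : R, (0 < e)%R & (a + e)%:E <= x.
Proof.
move: x => [r| |] //; last by exists 1%R => //; exact: leey.
rewrite lte_fin => ar; exists (r - a)%R; first by rewrite subr_gt0.
by rewrite lee_fin addrC subrK.
Qed.

Lemma open_env_energy k c (a : R) :
  open [set nu : M1p E p | a%:E < env_energy U k c nu].
Proof.
move=> nu /= /gap_above[e e0 ae].
(* A coupling of mean displacement at most [2 d] changes the truncated energy by at most
   [2 k * 2 d], which is less than [e]. *)
pose d : R := (e / (4 * (k%:R + 1)))%R.
have k1 : (0 < k%:R + 1 :> R)%R by [].
have d0 : (0 < d)%R by rewrite divr_gt0// mulr_gt0.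
exists d => // nu' /(wasserstein_lt_coupling p_gt0 d0)[pi cpi pid] /=.
have := env_energy_coupling confU k c c cpi.
rewrite subrr normr0 mulr0 add0e => h.
have : (a + e)%:E <= env_energy U k c nu' + ((2 * k%:R)%:E * (2 * d)%:E).
  apply: (le_trans ae); apply: (le_trans h); apply: leeD2l.
  by apply: lee_wpmul2l => //; rewrite lee_fin mulr_ge0.
rewrite -EFinM -leeBlDr// -EFinB; apply: lt_le_trans.
rewrite lte_fin -addrA ltrDl subr_gt0.
have -> : e = (d * (4 * (k%:R + 1)))%R by rewrite /d divfK// gt_eqF// mulr_gt0.
nra.
Qed.

(** Lets [env_energy_coupling] be applied with [c] moving and the measure fixed. *)
Lemma diagonal_coupling (nu : probability mR R) :
  exists2 pi, couplings nu nu pi & \int[pi]_z `|(z.1 : R) - z.2|%:E = 0.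
Proof.
have md : measurable_fun setT (fun x : mR => (x, x)) by exact: measurable_fun_pair.
exists (prob_image nu md).
  by split => A mA; rewrite /prob_image/= /pushforward; congr (nu _);
    apply/seteqP; split => x //= [].
rewrite ge0_integral_prob_image//.
  by under eq_integral do rewrite /= subrr normr0; rewrite integral0.
by apply/measurable_EFinP; apply: measurableT_comp => //; exact: measurable_funB.
Qed.

Lemma lower_semicontinuous_env_energy k :
  lower_semicontinuous (fun x : X => env_energy U k x.1 x.2).
Proof.
move=> [c nu] a /= /gap_above[e e0 ae].
have k1 : (0 < k%:R + 1 :> R)%R by [].
pose d : R := (e / (4 * (k%:R + 1)))%R.
have d0 : (0 < d)%R by rewrite divr_gt0// mulr_gt0.
(* Half of the margin [e] pays for moving the measure with [c] fixed, the other half for moving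
   [c]. *)
exists (ball c d `*` [set nu' : M1p E p | (a + e / 2)%:E < env_energy U k c nu']).
  exists (ball c d, [set nu' : M1p E p | (a + e / 2)%:E < env_energy U k c nu']) => //.
  split; first exact: nbhsx_ballx.
  apply: open_nbhs_nbhs; split; first exact: open_env_energy.
  by apply: lt_le_trans ae; rewrite lte_fin; lra.
move=> [c' nu'] [/= cc' anu'].
have [pi cpi pi0] := diagonal_coupling nu'.
have := env_energy_coupling confU k c c' cpi.
rewrite pi0 mule0 adde0 => /(lt_le_trans anu').
move=> h; apply: (@le_lt_trans _ _ (a + e / 2 - 2 * k%:R * `|c - c'|)%:E).
  rewrite lee_fin.
  have -> : e = (d * (4 * (k%:R + 1)))%R by rewrite /d divfK// gt_eqF// mulr_gt0.
  have : (k%:R * `|c - c'| <= k%:R * d)%R by rewrite ler_wpM2l//; exact: ltW.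
  lra.
by rewrite EFinB lteBlDr.
Qed.

Lemma lower_semicontinuous_energy_flip :
  lower_semicontinuous (fun x : X => energy U (flip x.1 x.2)).
Proof.
move=> x a /= /(env_energy_lim confU)[k /lower_semicontinuous_env_energy[V xV aV]].
exists V => // y /aV ya; apply: (lt_le_trans ya).
exact: (env_energy_le confU).
Qed.

(** Each point has a neighbourhood and a truncation level that work, and larger levels still work
    since the truncated energy increases with [k]; this is the covering form of compactness. *)
Lemma compact_env_energy (K : set X) (a : R) : compact K ->
  (forall x, K x -> a%:E < energy U (flip x.1 x.2)) ->
  exists k, forall x, K x -> a%:E < env_energy U k x.1 x.2.
Proof.
move=> /compact_near_coveringP cK Ka.
have := cK nat \oo (fun k (x : X) => a%:E < env_energy U k x.1 x.2) _.
case.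
  move=> x /Ka /(env_energy_lim confU)[k /lower_semicontinuous_env_energy[V xV aV]].
  exists (V, [set m | (k <= m)%N]); first by split => //; exists k.
  move=> [y m] /= [Vy km]; apply: (lt_le_trans (aV y Vy)).
  exact: (env_energy_homo confU).
move=> k _ hk; exists k => x Kx; exact: (hk k (leqnn k) x Kx).
Qed.

End rate_topology.

Lemma dint_fst {R : realType} (nu : probability (measurableTypeR R) R) (f : R -> \bar R) :
  dint nu (fun z => f z.1) = (\int[nu]_x f x)%E.
Proof. by apply: eq_integral => x _; exact: (integral_prob_cst nu (f x)). Qed.

Lemma dint_snd {R : realType} (nu : probability (measurableTypeR R) R) (f : R -> \bar R) :
  dint nu (fun z => f z.2) = (\int[nu]_x f x)%E.
Proof. exact: (integral_prob_cst nu (\int[nu]_x f x)%E). Qed.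

Lemma integral_confining_le {R : realType} p (U : R -> R)
    (nu : probability (measurableTypeR R) R) : confining p U ->
  (\int[nu]_x (U x)%:E <= 4%:E * energy U nu)%E.
Proof.
move=> confU; rewrite -lee_pdivrMl//; apply: (@le_trans _ _ (dint nu (fun z => (U z.1 / 4)%:E))).
  rewrite (dint_fst nu (fun x => (U x / 4)%:E)).
  under [leRHS]eq_integral do rewrite mulrC EFinM.
  rewrite ge0_integralZl_EFin//.
  - by move=> x _; rewrite lee_fin (confining_ge0 confU).
  - by apply/measurable_EFinP; exact: measurable_confining confU.
apply: le_dint => -[x y].
  by rewrite lee_fin divr_ge0// (confining_ge0 confU).
apply: le_trans (logker_ge confU x y); rewrite lee_fin.
by rewrite ler_pdivrMr// divfK// lerDl (confining_ge0 confU).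
Qed.

Section rate_energy.
Local Open Scope ereal_scope.
Context {R : realType}.
Variables (p : nat) (V : {poly R}) (C : R).
Let U x := (V.[x] + C)%R.
Hypothesis confU : confining p U.
Local Notation mR := (measurableTypeR R).
Implicit Type nu : probability mR R.

Lemma measurable_horner : measurable_fun [set: mR] (fun x : mR => V.[x] : R).
Proof. by apply: continuous_measurable_fun; exact: continuous_horner. Qed.

Lemma V_integrableP nu : V_integrable V nu <-> \int[nu]_x (U x)%:E < +oo.
Proof.
have mU := measurable_confining confU.
have mV := measurable_horner.
split => h.
- apply: (@le_lt_trans _ _ (\int[nu]_x (`|V.[x]|%:E + `|C|%:E))).
    apply: ge0_le_integralT => x; first by rewrite lee_fin (confining_ge0 confU).
    by rewrite -EFinD lee_fin (le_trans (ler_norm _))// ler_normD.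
  rewrite ge0_integralD//; last first.
    by apply/measurable_EFinP; exact: measurableT_comp.
  by rewrite integral_prob_cst lte_add_pinfty// ltry.
- apply: (@le_lt_trans _ _ (\int[nu]_x ((U x)%:E + `|C|%:E))).
    apply: ge0_le_integralT => x; first by rewrite lee_fin.
    rewrite -EFinD lee_fin (_ : V.[x] = U x - C)%R; last by rewrite /U addrK.
    by rewrite (le_trans (ler_normB _ _))// (ger0_norm (confining_ge0 confU x)).
  rewrite ge0_integralD//; last 2 first.
  - by move=> x _; rewrite lee_fin (confining_ge0 confU).
  - exact/measurable_EFinP.
  by rewrite integral_prob_cst lte_add_pinfty// ltry.
Qed.

Lemma energy_lty_V_integrable nu : energy U nu < +oo -> V_integrable V nu.
Proof.
move=> h; apply/V_integrableP; apply: (le_lt_trans (integral_confining_le nu confU)).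
by rewrite lte_mul_pinfty.
Qed.

(** The logarithm is [A] minus the kernel, where [A] is integrable because [U] is. For finite energy
    one subtracts integrals; for infinite energy both sides are shown to be +oo. *)
Lemma log_energyE nu : V_integrable V nu ->
  - log_energy nu + \int[nu]_x (V.[x])%:E = energy U nu - C%:E.
Proof.
move=> /[dup] Vnu /V_integrableP Unu.
pose A (z : mR * mR) := ((U z.1 + U z.2) / 2)%:E : \bar R.
pose L (z : mR * mR) := lne `|(z.1 : R) - z.2|%:E.
have mU := measurable_confining confU.
have A0 z : 0 <= A z by rewrite lee_fin divr_ge0// addr_ge0// (confining_ge0 confU).
have mA : measurable_fun setT A.
  apply/measurable_EFinP; apply: measurable_funM => //.
  by apply: measurable_funD; apply: measurableT_comp.
have mK := measurable_logker confU.
have K0 := logker_ge0 confU.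
have AK z : L z = A z - logker U z.
  by rewrite /logker -/(A z) -/(L z) oppeB//= ?addeA ?subee// ?add0e// fin_num_adde_defl.
have intA : \int[nu \x nu]_z A z = \int[nu]_x (U x)%:E.
  rewrite -dintE// /A.
  have E z : ((U z.1 + U z.2) / 2)%:E = (2^-1)%:E * (U z.1)%:E + (2^-1)%:E * (U z.2)%:E.
    by rewrite -!EFinM -EFinD; congr _%:E; field.
  rewrite dintE//; under eq_integral do rewrite E.
  have mU1 : measurable_fun setT (fun z : mR * mR => (U z.1)%:E).
    by apply/measurable_EFinP; exact: measurableT_comp.
  have mU2 : measurable_fun setT (fun z : mR * mR => (U z.2)%:E).
    by apply/measurable_EFinP; exact: measurableT_comp.
  have U0 x : 0 <= (U x)%:E by rewrite lee_fin (confining_ge0 confU).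
  have h0 x : 0 <= (2^-1)%:E * (U x)%:E by rewrite mule_ge0.
  rewrite ge0_integralD//; last 2 first.
  - exact: emeasurable_funM.
  - exact: emeasurable_funM.
  rewrite !ge0_integralZl_EFin// -!dintE//.
  rewrite (dint_fst nu (fun x => (U x)%:E)) (dint_snd nu (fun x => (U x)%:E)).
  rewrite -ge0_muleDl// -EFinD (_ : 2^-1 + 2^-1 = 1)%R ?mul1e//; by field.
have LK : log_energy nu = \int[nu]_x (U x)%:E - energy U nu.
  have iA : (nu \x nu).-integrable setT A.
    apply/integrableP; split => //.
    by under eq_integral do rewrite gee0_abs//; rewrite intA.
  rewrite /energy dintE// -intA.
  have [fin|inf] := ltP (\int[nu \x nu]_z logker U z) +oo.
    rewrite -integralB//; last first.
      by apply/integrableP; split => //; under eq_integral do rewrite gee0_abs//.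
    by apply: eq_integral => z _; exact: AK.
  move: inf; rewrite leye_eq => /eqP inf.
  (* The positive part of the logarithm is dominated by [A], so only the negative part can have an
     infinite integral, and it does since the kernel is at most [A] plus that part. *)
  have LA z : L^\+ z <= A z.
    by rewrite funeposE ge_max A0 andbT AK -[leRHS]adde0 leeD2l// oppe_le0.
  have mL : measurable_fun setT L by rewrite (funext AK); exact: emeasurable_funB.
  have Lp : \int[nu \x nu]_z L^\+ z < +oo.
    apply: (@le_lt_trans _ _ (\int[nu \x nu]_z A z)); last by rewrite intA.
    by apply: ge0_le_integralT => z //; exact: funepos_ge0.
  have Ln : \int[nu \x nu]_z L^\- z = +oo.
    apply/eqP; rewrite -leye_eq -inf.
    have : \int[nu \x nu]_z logker U z <= \int[nu \x nu]_z A z + \int[nu \x nu]_z L^\- z.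
      rewrite -ge0_integralD//; last exact: measurable_funeneg.
      apply: ge0_le_integralT => // z.
      by rewrite /logker -/(A z) -/(L z) leeD2l// funenegE le_max lexx.
    rewrite inf; have : 0 <= \int[nu \x nu]_z L^\- z.
      by apply: integral_ge0 => z _; exact: funeneg_ge0.
    case: (\int[nu \x nu]_z L^\- z) => [r _| |] //.
    by move: Unu; rewrite -intA; case: (\int[nu \x nu]_z A z).
  rewrite /log_energy integralE Ln inf.
  move: Lp Unu; rewrite -intA; have : 0 <= \int[nu \x nu]_z L^\+ z.
    by apply: integral_ge0 => z _; exact: funepos_ge0.
  rewrite -/L; case: (\int[nu \x nu]_z L^\+ z) => // r _ _.
  by case: (\int[nu \x nu]_z A z).
have iU : \int[nu]_x (U x)%:E \is a fin_num.
  by rewrite ge0_fin_numE// integral_ge0// => x _; rewrite lee_fin (confining_ge0 confU).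
have iV : \int[nu]_x (V.[x])%:E = \int[nu]_x (U x)%:E - C%:E.
  have E x : (V.[x])%:E = (U x)%:E - C%:E by rewrite -EFinB addrK.
  under eq_integral do rewrite E.
  rewrite integralB//; last 2 first.
  - apply/integrableP; split; first exact/measurable_EFinP.
    by under eq_integral do rewrite gee0_abs ?lee_fin ?(confining_ge0 confU)//.
  - exact: finite_measure_integrable_cst.
  by rewrite integral_prob_cst.
rewrite LK iV oppeB; last by rewrite fin_num_adde_defr.
move: iU; case: (\int[nu]_x (U x)%:E) => // u _.
have := energy_ge0 confU nu; case: (energy U nu) => // r _.
transitivity ((- u + r + (u - C))%R%:E) => //; congr _%:E; ring.
Qed.

Lemma tau_energy_lty c nu : I_V V (tau c nu) =
  if `[< V_integrable V (flip c nu) >] then energy U (flip c nu) - C%:E - c_V V else +oo.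
Proof.
rewrite /I_V; case: ifPn => // /asboolP h.
by congr (_ - _); exact: (@log_energyE (flip c nu)).
Qed.

Lemma c_V_le nu : c_V V <= energy U nu - C%:E.
Proof.
have [h|] := ltP (energy U nu) +oo; last first.
  by rewrite leye_eq => /eqP ->; rewrite leey.
apply: ereal_inf_lbound; exists nu; first exact: energy_lty_V_integrable.
by rewrite log_energyE//; exact: energy_lty_V_integrable.
Qed.

Lemma c_V_ge : - C%:E <= c_V V.
Proof.
apply: le_ereal_inf_tmp => _ [nu /= h <-]; rewrite log_energyE//.
by rewrite -[leLHS]add0e leeD2r//; exact: energy_ge0 confU nu.
Qed.

Lemma c_V_fin_num nu : energy U nu < +oo -> c_V V \is a fin_num.
Proof.
move=> h; rewrite fin_numE; apply/andP; split.
  by rewrite gt_eqF// (lt_le_trans _ c_V_ge)// ltNyr.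
rewrite lt_eqF// (le_lt_trans (c_V_le nu))//.
by move: h; have := energy_ge0 confU nu; case: (energy U nu) => // r _ _; exact: ltry.
Qed.

Lemma c_V_adherent (e : R) : (0 < e)%R -> c_V V \is a fin_num ->
  exists nu : probability mR R, energy U nu < c_V V + C%:E + e%:E.
Proof.
move=> e0 cfin; have [_ [nu /= h <-]] := lb_ereal_inf_adherent e0 cfin.
rewrite log_energyE// => h2; exists nu.
by rewrite addeAC -lteBlDr.
Qed.

(** The case distinction in [I_V] disappears: finite energy forces [V] to be integrable, and
    infinite energy gives +oo in both branches. *)
Lemma rate_V_energy E c (nu : M1p E p) : c_V V \is a fin_num ->
  rate_V V (c, nu) = energy U (flip c nu) - (c_V V + C%:E).
Proof.
move=> cfin; rewrite /rate_V/= tau_energy_lty.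
have [h|] := ltP (energy U (flip c nu)) +oo.
  rewrite asboolT; last exact: energy_lty_V_integrable.
  by rewrite -addeA; congr (_ + _); rewrite oppeD ?fin_num_adde_defl// addeC.
by rewrite leye_eq => /eqP ->; case: ifPn => _; move: cfin; case: (c_V V).
Qed.

End rate_energy.

(** * Lower bound for the energy of a configuration *)

Section uniform_energy.
Local Open Scope ereal_scope.
Context {R : realType}.
Local Notation mR := (measurableTypeR R).

(* Counting the dyadic scales above [t] dominates [- ln t] and is integrable. *)
Definition dyadic_count (t : R) : \bar R :=
  \sum_(0 <= k <oo) (\1_[set s : R | (s <= 2 ^- k)%R] t)%:E.

Lemma dyadic_count_ge0 t : 0 <= dyadic_count t.
Proof. by apply: nneseries_ge0 => k _ _; rewrite lee_fin. Qed.

(** For [t < 1] every natural [k <= - ln t] satisfies [t <= e^-k <= 2^-k], and there are more than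
    [- ln t] such [k], counting 0. *)
Lemma dyadic_count_ge t : (0 < t)%R -> (- ln t)%:E <= dyadic_count t.
Proof.
move=> t0; have [t1|t1] := leP 1%R t.
  by apply: le_trans (dyadic_count_ge0 t); rewrite lee_fin oppr_le0 ln_ge0.
have lt0 : (0 <= - ln t)%R by rewrite oppr_ge0 ln_le0// ltW.
set n := Num.truncn (- ln t).
have /(_ n.+1) := @nneseries_lim_ge R
  (fun k => (\1_[set s : R | (s <= 2 ^- k)%R] t)%:E) xpredT 0.
move=> /(_ (fun k _ _ => ltac:(by rewrite lee_fin))); apply: le_trans.
rewrite (eq_big_nat _ _ (F2 := fun=> 1)) => [|k /andP[_ kn]]; last first.
  rewrite indicE mem_set//= -(lnK t0).
  have kt : (k%:R <= - ln t)%R.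
    apply: (@le_trans _ _ n%:R%R); first by rewrite ler_nat -ltnS.
    by rewrite truncn_le.
  rewrite -[leLHS]invrK lef_pV2 ?posrE ?invr_gt0 ?expR_gt0 ?exprn_gt0//.
  rewrite -expRN (@le_trans _ _ (expR k%:R))// ?ler_expR//.
  rewrite -[k%:R%R]mulr1 expRM_natl lerXn2r ?nnegrE ?expR_ge0//.
  by have := expR_ge1Dx (1 : R).
rewrite big_mkord sumEFin sumr_const card_ord lee_fin.
by rewrite ltW// truncnS_gt.
Qed.

Lemma measurable_dyadic_count : measurable_fun [set: mR] (dyadic_count : mR -> \bar R).
Proof.
apply: ge0_emeasurable_sum => //= k.
move=> _; apply/measurable_EFinP; apply: measurable_indic.
rewrite (_ : [set _ | _] = `]-oo, (2 ^- k)%R]%classic)//.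
Qed.

Lemma le_integral_uniform (a b : R) (ab : (a < b)%R) (f g : mR -> \bar R) :
  measurable_fun setT f -> measurable_fun setT g ->
  (forall x, 0 <= f x) -> (forall x, 0 <= g x) ->
  (forall x, (a <= x <= b)%R -> f x <= g x) ->
  \int[uniform_prob ab]_x f x <= \int[uniform_prob ab]_x g x.
Proof.
move=> mf mg f0 g0 fg; rewrite !integral_uniform//.
apply: lee_wpmul2l; first by rewrite lee_fin invr_ge0 subr_ge0 ltW.
apply: ge0_le_integral => //=; try exact: measurable_funTS.
Qed.

(** The scale [k] is counted on an interval of length [2 eta 2^-k], of probability at most
    [2 * 2^-k]; these sum to 4, whatever [x]. *)
Lemma integral_uniform_dyadic (a eta x : R) (ab : (a < a + eta)%R) : (0 < eta)%R ->
  \int[uniform_prob ab]_y dyadic_count (`|x - y| / eta)%R <= 4%:E.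
Proof.
move=> eta0.
have mk k : measurable_fun [set: mR]
    (fun y : mR => (\1_[set s : R | (s <= 2 ^- k)%R] (`|x - y| / eta)%R)%:E : \bar R).
  have m1 : measurable_fun [set: mR]
      (fun s : mR => (\1_[set s : R | (s <= 2 ^- k)%R] s)%:E : \bar R).
    apply/measurable_EFinP; apply: measurable_indic.
    by rewrite (_ : [set _ | _] = `]-oo, (2 ^- k)%R]%classic).
  have m2 : measurable_fun [set: mR] (fun y : mR => (`|(x : R) - y| / eta)%R : mR).
    apply: measurable_funM => //; apply: measurableT_comp => //.
    exact: measurable_funB.
  exact: (measurableT_comp m1 m2).
rewrite /dyadic_count integral_nneseries//.
have := @cvg_geometric_eseries_half R 4%R 0.
rewrite expr0 divr1 => /cvg_lim <-//.
apply: lee_nneseries => k _.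
  by move=> _; apply: integral_ge0 => y _; rewrite lee_fin.
rewrite integral_uniform//.
have r0 : (0 <= eta * 2 ^- k)%R by rewrite mulr_ge0 ?invr_ge0 ?exprn_ge0 ?ltW.
apply: (@le_trans _ _ ((a + eta - a)^-1%:E * (2 * (eta * 2 ^- k))%:E)).
  apply: lee_wpmul2l; first by rewrite lee_fin invr_ge0 subr_ge0 ltW.
  apply: (@le_trans _ _ (\int[@lebesgue_measure R]_y
      (\1_(`[(x - eta * 2 ^- k)%R, (x + eta * 2 ^- k)%R]%classic) y)%:E)).
    rewrite integral_mkcond; apply: ge0_le_integralT => y.
      by rewrite /patch; case: ifPn.
    rewrite /patch; case: ifPn => _; rewrite lee_fin !indicE; last by rewrite ler0n.
    have [|] := boolP ((`|x - y| / eta)%R \in _); last by rewrite ler0n.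
    rewrite inE/= ler_pdivrMr// mulrC ler_distl => /andP[h1 h2].
    by rewrite mem_set//= in_itv/= lerBlDr h2 -lerBlDr h1.
  rewrite integral_indic//= setIT lebesgue_measure_itv/=.
  case: ifPn => _; last by rewrite lee_fin mulr_ge0.
  by rewrite -EFinD lee_fin; lra.
rewrite -EFinM lee_fin [(a + eta)%R]addrC addrK natrX addn1 exprS invfM.
rewrite (_ : eta^-1 * (2 * (eta * 2 ^- k)) = 4 * (2^-1 * 2 ^- k))%R//.
by field; rewrite expf_neq0//= gt_eqF.
Qed.

End uniform_energy.

Section mixture.
Local Open Scope ereal_scope.
Context d (T : measurableType d) (R : realType).
Variables (n : nat) (m : nat -> probability T R).

Definition mixture : set T -> \bar R := (mscale (n.+1%:R^-1)%:nng (msum m n.+1))%R.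

HB.instance Definition _ := Measure.on mixture.

Let mixtureT : mixture setT = 1.
Proof.
rewrite /mixture /mscale/= /msum (eq_bigr (fun=> 1)) => [|i _]; last exact: probability_setT.
by rewrite sumEFin sumr_const card_ord -EFinM mulVf.
Qed.

HB.instance Definition _ := Measure_isProbability.Build _ _ _ mixture mixtureT.

Lemma ge0_integral_mixture (f : T -> \bar R) : measurable_fun setT f ->
  (forall x, 0 <= f x) ->
  \int[mixture]_x f x = (n.+1%:R^-1)%R%:E * \sum_(i < n.+1) \int[m i]_x f x.
Proof. by move=> mf f0; rewrite ge0_integral_mscale// ge0_integral_measure_sum. Qed.

End mixture.

Lemma dint_mixture {R : realType} n (m : nat -> probability (measurableTypeR R) R) F :
  measurable_fun setT F -> (forall z, (0 <= F z)%E) ->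
  (dint (mixture n m) F = (n.+1%:R^-1 ^+ 2)%R%:E *
    \sum_(i < n.+1) \sum_(j < n.+1) \int[m i]_x \int[m j]_y F (x, y))%E.
Proof.
move=> mF F0; rewrite /dint ge0_integral_mixture; last 2 first.
- exact: measurable_fun_fubini_tonelli_F.
- by move=> x; exact: integral_ge0.
rewrite expr2 EFinM -muleA; congr (_ * _)%E.
rewrite ge0_sume_distrr; last first.
  by move=> i _; apply: sume_ge0 => j _; apply: integral_ge0 => x _; exact: integral_ge0.
apply: eq_bigr => i _.
have mFi j : measurable_fun setT (fun x => (\int[m j]_y F (x, y))%E).
  exact: measurable_fun_fubini_tonelli_F.
rewrite -ge0_integral_sum//; last by move=> j x _; exact: integral_ge0.
rewrite -ge0_integralZl_EFin//; last 2 first.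
- by move=> x _; apply: sume_ge0 => j _; exact: integral_ge0.
- exact: emeasurable_sum.
apply: eq_integral => x _; rewrite ge0_integral_mixture//.
exact: measurableT_comp.
Qed.

Section smeared_energy.
Local Open Scope ereal_scope.
Context {R : realType}.
Variables (p : nat) (U : R -> R).
Hypothesis confU : confining p U.
Local Notation mR := (measurableTypeR R).

Lemma dyadic_count0 : dyadic_count (0 : R) = +oo.
Proof.
apply/eqyP => A A0; set n := Num.truncn A.
have /(_ n.+1) := @nneseries_lim_ge R
  (fun k => (\1_[set s : R | (s <= 2 ^- k)%R] 0%R)%:E) xpredT 0.
move=> /(_ (fun k _ _ => ltac:(by rewrite lee_fin))); apply: le_trans.
rewrite (eq_big_nat _ _ (F2 := fun=> 1)) => [|k _]; last first.
  by rewrite indicE mem_set//= invr_ge0 exprn_ge0.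
rewrite big_mkord sumEFin sumr_const card_ord lee_fin.
by rewrite ltW// truncnS_gt.
Qed.

Let mK := measurable_logker confU.
Let K0 := logker_ge0 confU.

Lemma dint_uniform_disjoint (a b eta A B delta : R)
    (ha : (a < a + eta)%R) (hb : (b < b + eta)%R) : (0 < delta)%R ->
  (forall y, (a <= y <= a + eta)%R -> (U y <= A)%R) ->
  (forall z, (b <= z <= b + eta)%R -> (U z <= B)%R) ->
  (forall y z, (a <= y <= a + eta)%R -> (b <= z <= b + eta)%R -> (delta <= `|y - z|)%R) ->
  \int[uniform_prob ha]_y \int[uniform_prob hb]_z logker U (y, z) <=
  ((A + B) / 2 - ln delta)%:E.
Proof.
move=> d0 UA UB dist; set c := (_ - _)%R.
have le y z : (a <= y <= a + eta)%R -> (b <= z <= b + eta)%R -> logker U (y, z) <= c%:E.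
  move=> hy hz; have dyz := dist _ _ hy hz.
  have yz : y != z by rewrite -subr_eq0 -normr_gt0 (lt_le_trans d0).
  rewrite logker_neq// lee_fin lerB//; last by rewrite ler_ln// posrE ?(lt_le_trans d0).
  by rewrite ler_pM2r ?invr_gt0// lerD// (UA, UB).
have c0 : 0 <= c%:E by apply: le_trans (le a b _ _) => //; apply/andP; split => //; exact: ltW.
apply: (@le_trans _ _ (\int[uniform_prob ha]__ c%:E)); last by rewrite integral_prob_cst.
apply: le_integral_uniform => //.
- exact: measurable_fun_fubini_tonelli_F.
- by move=> y; exact: integral_ge0.
move=> y hy; apply: (@le_trans _ _ (\int[uniform_prob hb]__ c%:E)); last by rewrite integral_prob_cst.
apply: le_integral_uniform => //.
  exact: measurableT_comp.
by move=> z hz; exact: le.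
Qed.

(** Rescaling by [eta] splits [- ln |y - z|] into [- ln eta] and a term dominated by [dyadic_count],
    which has mean at most 4. On the diagonal both the kernel and [dyadic_count] are +oo. *)
Lemma dint_uniform_self (a eta A : R) (ha : (a < a + eta)%R) : (0 < eta)%R ->
  (forall y, (a <= y <= a + eta)%R -> (U y <= A)%R) ->
  \int[uniform_prob ha]_y \int[uniform_prob ha]_z logker U (y, z) <=
  (A + (`|ln eta| + 4))%:E.
Proof.
move=> eta0 UA.
have aa : (a <= a <= a + eta)%R by rewrite lexx ltW.
have A0 : (0 <= A)%R by apply: le_trans (UA a aa); exact: confining_ge0 confU _.
have md y : measurable_fun [set: mR] (fun z : mR => dyadic_count (`|y - z| / eta)%R).
  have m2 : measurable_fun [set: mR] (fun z : mR => (`|(y : R) - z| / eta)%R : mR).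
    apply: measurable_funM => //; apply: measurableT_comp => //.
    exact: measurable_funB.
  exact: (measurableT_comp measurable_dyadic_count m2).
rewrite addrA EFinD.
apply: (@le_trans _ _ (\int[uniform_prob ha]__ ((A + `|ln eta|)%:E + 4%:E))); last by rewrite integral_prob_cst.
have al0 : 0 <= (A + `|ln eta|)%:E by rewrite lee_fin addr_ge0.
apply: le_integral_uniform => //.
- exact: measurable_fun_fubini_tonelli_F.
- by move=> y; exact: integral_ge0.
- by move=> y; rewrite adde_ge0.
move=> y hy.
apply: (@le_trans _ _ (\int[uniform_prob ha]_z ((A + `|ln eta|)%:E + dyadic_count (`|y - z| / eta)%R))).
  apply: le_integral_uniform => //.
  - exact: measurableT_comp.
  - exact: emeasurable_funD.
  - by move=> z; rewrite adde_ge0// dyadic_count_ge0.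
  move=> z hz; have [->|yz] := eqVneq y z.
    by rewrite subrr normr0 mul0r dyadic_count0 addey// leey.
  have d0 : (0 < `|y - z| / eta)%R by rewrite divr_gt0// normr_gt0 subr_eq0.
  rewrite logker_neq//; apply: (@le_trans _ _ ((A + `|ln eta|)%:E + (- ln (`|y - z| / eta))%:E)).
    rewrite -EFinD lee_fin ln_div ?posrE ?normr_gt0 ?subr_eq0//.
    have := UA y hy; have := UA z hz; have := ler_norm (- ln eta); rewrite normrN; lra.
  by rewrite leeD2l// dyadic_count_ge.
rewrite ge0_integralD//; last by move=> z _; exact: dyadic_count_ge0.
rewrite integral_prob_cst leeD2l//.
exact: integral_uniform_dyadic.
Qed.

(** Particle [i] is spread over the cell of length [eta] that starts at [x i + i eta]. The offsets
    make points of different cells at least as far apart as the particles, so no interaction grows;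
    [e0] is then tested against the average of the uniform laws, and the self-interactions cost
    [|ln eta| + 4] each. *)
Lemma energy_smeared n (x ub : nat -> R) (eta e0 : R) : (0 < eta)%R ->
  (forall nu : probability mR R, e0%:E <= energy U nu) ->
  (forall i j, (i < j)%N -> (j < n.+1)%N -> (x i < x j)%R) ->
  (forall i y, (i < n.+1)%N -> (x i + i%:R * eta <= y <= x i + i.+1%:R * eta)%R -> (U y <= ub i)%R) ->
  (n.+1%:R ^+ 2 * e0 <= n.+1%:R * (\sum_(i < n.+1) ub i)
    - (\sum_(i < n.+1) \sum_(j < n.+1) ln `|x i - x j|)
    + n.+1%:R * (`|ln eta| + 4))%R.
Proof.
move=> eta0 he xinc Uub.
pose a i := (x i + i%:R * eta)%R.
have ha i : (a i < a i + eta)%R by rewrite ltrDl.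
have aE i : (a i + eta = x i + i.+1%:R * eta)%R by rewrite /a -addrA -[in RHS]natr1 mulrDl mul1r.
pose m i : probability mR R := uniform_prob (ha i).
pose c i j : R := ((ub i + ub j) / 2 - ln `|x i - x j| +
  (if i == j then `|ln eta| + 4 else 0))%R.
have sep i j y z : (i < j)%N -> (j < n.+1)%N ->
    (a i <= y <= a i + eta)%R -> (a j <= z <= a j + eta)%R ->
    (`|x i - x j| <= `|y - z|)%R.
  move=> ij jn /andP[_ yi] /andP[zj _]; have xij := xinc i j ij jn.
  have ije : (i.+1%:R * eta <= j%:R * eta)%R by rewrite ler_pM2r// ler_nat.
  rewrite aE in yi; rewrite /a in zj.
  by rewrite ltr0_norm ?subr_lt0// ltr0_norm; lra.
have cE i j : (i < n.+1)%N -> (j < n.+1)%N ->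
    \int[m i]_y \int[m j]_z logker U (y, z) <= (c i j)%:E.
  move=> iN jN.
  have Ui y : (a i <= y <= a i + eta)%R -> (U y <= ub i)%R.
    by rewrite aE; exact: Uub.
  have Uj z : (a j <= z <= a j + eta)%R -> (U z <= ub j)%R.
    by rewrite aE; exact: Uub.
  rewrite /c; have [ij|ij] := eqVneq i j.
    subst j; rewrite subrr normr0 ln0// subr0.
    rewrite (_ : (ub i + ub i) / 2 = ub i)%R; last by field.
    exact: dint_uniform_self.
  rewrite addr0; apply: dint_uniform_disjoint => //.
    rewrite normr_gt0 subr_eq0; have [h|h|/eqP] := ltngtP i j; last by rewrite (negbTE ij).
      by rewrite lt_eqF// xinc.
    by rewrite gt_eqF// xinc.
  move=> y z hy hz; have [h|h|/eqP] := ltngtP i j; last by rewrite (negbTE ij).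
    exact: (sep i j).
  by rewrite distrC (distrC y); exact: (sep j i).
have S : (\sum_(i < n.+1) \sum_(j < n.+1) \int[m i]_y \int[m j]_z logker U (y, z) <=
    (\sum_(i < n.+1) \sum_(j < n.+1) c i j)%R%:E)%E.
  rewrite -sumEFin; apply: lee_sum => i _; rewrite -sumEFin; apply: lee_sum => j _.
  exact: cE.
have := he (mixture n m); rewrite /energy dint_mixture//.
have n2 : (0 <= (n.+1%:R^-1 ^+ 2 : R))%R by rewrite exprn_ge0// invr_ge0.
move=> /le_trans /(_ (lee_wpmul2l _ S)); rewrite lee_fin => /(_ n2).
rewrite -EFinM lee_fin exprVn mulrC ler_pdivlMr ?exprn_gt0// mulrC.
move=> /le_trans; apply.
rewrite /c; under eq_bigr do rewrite big_split/= sumrB -mulr_suml big_split/= sumr_const card_ord.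
rewrite big_split/= sumrB -mulr_suml big_split/=.
have -> : (\sum_(i < n.+1) \sum_(j < n.+1) (if i == j :> nat then `|ln eta| + 4 else 0) =
    n.+1%:R * (`|ln eta| + 4))%R.
  rewrite (eq_bigr (fun=> `|ln eta| + 4)%R) => [|i _].
    by rewrite sumr_const card_ord mulr_natl.
  rewrite (bigD1 i)//= eqxx big1 ?addr0// => j.
  by rewrite eq_sym -val_eqE/= => /negbTE ->.
set s := (\sum_(i < n.+1) ub i)%R.
have e1 : (\sum_(i < n.+1) ub i *+ n.+1 = n.+1%:R * s)%R by rewrite sumrMnl mulr_natl.
have e2 : (\sum_(i < n.+1) \sum_(j < n.+1) ub j = n.+1%:R * s)%R.
  by rewrite sumr_const card_ord mulr_natl.
by rewrite e1 e2; lra.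
Qed.

End smeared_energy.

Lemma nlogn_le_square {R : realType} (K e : R) : 0 <= K -> 0 < e ->
  exists n0, forall n, (n0 <= n)%N -> K * n%:R * (1 + ln n%:R) <= e * n%:R ^+ 2.
Proof.
move=> K0 e0; pose d := e / (2 * (K + 1)).
have d0 : 0 < d by rewrite divr_gt0//; lra.
have Kd : K * d <= e / 2.
  by rewrite /d mulrA ler_pdivrMr; nra.
exists (Num.truncn (K * (1 + `|ln d|) * 2 / e)).+1 => n n0.
have n1 : (0 < n)%N by exact: leq_trans n0.
have nK : K * (1 + `|ln d|) * 2 / e <= n%:R.
  by rewrite (le_trans (ltW (truncnS_gt _)))// ler_nat.
have ln_n : ln (n%:R : R) <= d * n%:R + `|ln d|.
  have : ln (d * n%:R) <= d * n%:R by rewrite ltW// ln_sublinear// mulr_gt0// ltr0n.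
  rewrite lnM ?posrE ?ltr0n//; have := ler_norm (- ln d); rewrite normrN; lra.
move: nK; rewrite ler_pdivrMr// => nK.
have nn : 0 <= (n%:R : R) by [].
have : K * n%:R * (1 + ln n%:R) <= K * n%:R * (1 + (d * n%:R + `|ln d|)).
  by rewrite ler_wpM2l ?mulr_ge0//; lra.
move=> /le_trans; apply.
have : K * d * n%:R ^+ 2 <= e / 2 * n%:R ^+ 2 by rewrite ler_wpM2r// sqr_ge0.
have : K * (1 + `|ln d|) * 2 * n%:R <= n%:R * e * n%:R by rewrite ler_wpM2r.
rewrite expr2; lra.
Qed.

Section hamiltonian_lower_bound.
Context {R : realType}.
Variables (p : nat) (U : R -> R).
Hypothesis confU : confining p U.
Local Notation mR := (measurableTypeR R).

(** A measure of finite energy, whose existence makes [c_V] finite. *)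
Lemma energy_uniform_lty : (energy U (uniform_prob (@ltr01 R)) < +oo)%E.
Proof.
have ab : (0 < 0 + 1 :> R) by rewrite add0r.
have [C C0 sh] := confining_shift confU.
have UA (y : R) : 0 <= y <= 0 + 1 -> U y <= U 0 + C * (U 0 + 1).
  rewrite add0r => hy; have := sh 0 y hy; rewrite add0r => /le_trans; apply.
  have U0 := confining_ge0 confU 0; case/andP: hy => y0 y1.
  rewrite lerD2l ler_wpM2r//; first lra.
  by rewrite ler_piMr.
have := @dint_uniform_self _ _ _ confU _ _ _ ab ltr01 UA.
rewrite /energy /dint.
have -> : uniform_prob ab = uniform_prob (@ltr01 R).
  by rewrite /uniform_prob add0r.
move=> /le_lt_trans; apply; exact: ltry.
Qed.

(** Each logarithm is at most a quarter of the potential of its pair, so half of the confinement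
    remains: a bound of the sum of [U] by the energy. *)
Lemma hamiltonian_ge_sum s : uniq s ->
  (size s)%:R / 2 * (\sum_(x <- s) U x) <= hamiltonian U s.
Proof.
move=> us; rewrite /hamiltonian.
have H : log_pairs s <= \sum_(x <- s) \sum_(y <- s) ((U x + U y) / 4).
  apply: ler_sum => x _; apply: ler_sum => y _.
  have := confining_ge0 confU x; have := confining_ge0 confU y => Uy Ux.
  have [<-|xy] := eqVneq x y; first by rewrite subrr normr0 ln0//; lra.
  by have := logker_ge confU x y; rewrite logker_neq// lee_fin; lra.
have E : \sum_(x <- s) \sum_(y <- s) ((U x + U y) / 4) = (size s)%:R / 2 * \sum_(x <- s) U x.
  under eq_bigr do rewrite -mulr_suml big_split/= big_const_seq count_predT iter_addr_0.
  rewrite -mulr_suml big_split/= big_const_seq count_predT iter_addr_0.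
  rewrite sumrMnl; set S := \sum_(x <- s) U x.
  by rewrite -[S *+ _]mulr_natl; field.
by rewrite E in H; lra.
Qed.

(** Smearing alone leaves an error [C] times the sum of [U], which is unbounded over configurations.
    It is absorbed by a convex combination with [hamiltonian_ge_sum], which also produces the sum of
    [U] of the conclusion. *)
Lemma hamiltonian_lower_bound (e0 e : R) : 0 < e ->
  (forall nu : probability mR R, (e0%:E <= energy U nu)%E) ->
  exists n0, forall s, uniq s -> (n0 <= size s)%N ->
  (size s)%:R ^+ 2 * (e0 - e) + \sum_(x <- s) U x <= hamiltonian U s.
Proof.
move=> e_gt0 he; have [C C0 sh] := confining_shift confU.
pose K := 2 * (C + 1) * `|e0| + C + 6.
have K0 : 0 <= K by rewrite /K; have := normr_ge0 e0; nra.
have [n0 hn0] := nlogn_le_square K0 e_gt0.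
exists (maxn n0 (Num.truncn (2 * (C + 1))).+1) => t ut.
rewrite geq_max => /andP[n0t Ct].
pose s := sort <=%R t.
have st : perm_eq t s by rewrite perm_sym perm_sort.
have us : uniq s by rewrite -(perm_uniq st).
rewrite (hamiltonian_perm U st) (perm_size st) (perm_big _ st)/=.
rewrite (perm_size st) in n0t Ct.
have Cn : 2 * (C + 1) <= (size s)%:R.
  by rewrite (le_trans (ltW (truncnS_gt _)))// ler_nat.
case sE : (size s) => [|n]; first by rewrite sE in Ct.
rewrite sE in n0t Ct Cn.
pose x i := nth 0 s i.
have xinc i j : (i < j)%N -> (j < n.+1)%N -> x i < x j.
  move=> ij jn; have ss : sorted <%R s by rewrite lt_sorted_uniq_le us sort_le_sorted.
  rewrite (lt_sorted_ltn_nth 0 ss) ?inE ?sE//; exact: ltn_trans jn.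
pose N : R := n.+1%:R.
have N0 : 0 < N by [].
(* The last cell then ends within [1 / N] of its particle, so [U] grows by a factor of order
   [C / N], while [|ln eta|] is only [2 ln N]. *)
pose eta := N ^- 2.
have eta0 : 0 < eta by rewrite invr_gt0 exprn_gt0.
pose ub i := U (x i) + C / N * (U (x i) + 1).
have hub i y : (i < n.+1)%N -> x i + i%:R * eta <= y <= x i + i.+1%:R * eta -> U y <= ub i.
  move=> iN /andP[y1 y2].
  have h0 : 0 <= y - x i by have : 0 <= i%:R * eta; [rewrite mulr_ge0// ltW|lra].
  have hN : y - x i <= N^-1.
    have : i.+1%:R * eta <= N * eta by rewrite ler_pM2r// ler_nat.
    have -> : N * eta = N^-1 by rewrite /eta expr2 invfM mulrA mulfV ?mul1r ?gt_eqF.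
    by move=> h; rewrite lerBlDl (le_trans y2)// lerD2l.
  have h1 : y - x i <= 1 by rewrite (le_trans hN)// invf_le1// ler1n.
  have := sh (x i) (y - x i); rewrite h0 h1 => /(_ isT).
  rewrite addrC subrK => /le_trans; apply; rewrite lerD2l ler_wpM2r//.
    by have := confining_ge0 confU (x i); lra.
  by rewrite ler_wpM2l.
have := energy_smeared confU eta0 he xinc hub.
have sumx (f : R -> R) : \sum_(z <- s) f z = \sum_(i < n.+1) f (x i).
  by rewrite (big_nth 0) big_mkord sE.
rewrite -/N.
have lnE : log_pairs s = \sum_(i < n.+1) \sum_(j < n.+1) ln `|x i - x j|.
  by rewrite /log_pairs sumx; apply: eq_bigr => i _; rewrite sumx.
rewrite -lnE.
pose S := \sum_(z <- s) U z.
have S0 : 0 <= S by apply: sumr_ge0 => z _; exact: confining_ge0 confU z.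
have -> : \sum_(i < n.+1) ub i = S + C / N * (S + N).
  rewrite /ub big_split/= -mulr_sumr big_split/= -(sumx U) sumr_const card_ord.
  by rewrite -/S.
have ham : hamiltonian U s = N * S - log_pairs s by rewrite /hamiltonian sE.
have hge := hamiltonian_ge_sum us; rewrite sE -/N -/S in hge.
have lneta : `|ln eta| = 2 * ln N.
  rewrite /eta lnV ?posrE ?exprn_gt0// lnXn// normrN -[ln N *+ 2]mulr_natl.
  by rewrite ger0_norm// mulr_ge0// ln_ge0// ler1n.
rewrite lneta -/N => hsm.
have hn := hn0 n.+1 n0t; rewrite -/N in hn.
rewrite -/S; set H := hamiltonian U s in ham hge *.
have {}hsm : N ^+ 2 * e0 <= H + (C * S + C * N + N * (2 * ln N + 4)).
  apply: (le_trans hsm); rewrite ham.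
  have -> : N * (S + C / N * (S + N)) = N * S + C * (S + N) by field; rewrite gt_eqF.
  by lra.
(* With this weight [hamiltonian_ge_sum] contributes [(C + 1) S]: [C S] for the smearing error and
   [S] for the conclusion. The price is [th N^2 e0], of order [N]. *)
pose th := 2 * (C + 1) / N.
have th0 : 0 <= th by rewrite divr_ge0//; lra.
have th1 : th <= 1 by rewrite ler_pdivrMr// mul1r.
have thN : th * N = 2 * (C + 1) by rewrite /th divfK// gt_eqF.
have lnN : 0 <= ln N by rewrite ln_ge0// ler1n.
have a1 : th * (N / 2 * S) <= th * H by rewrite ler_wpM2l.
have a2 : (1 - th) * (N ^+ 2 * e0 - (C * S + C * N + N * (2 * ln N + 4))) <= (1 - th) * H.
  by rewrite ler_wpM2l//; lra.
have a3 : th * (N / 2 * S) = (C + 1) * S by rewrite mulrA mulrA thN; field.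
have a4 : th * (N ^+ 2 * e0) <= 2 * (C + 1) * N * `|e0|.
  rewrite expr2 !mulrA thN; apply: ler_wpM2l (ler_norm e0).
  by rewrite mulr_ge0//; lra.
have a5 : 0 <= th * (C * S + C * N + N * (2 * ln N + 4)).
  rewrite mulr_ge0// !addr_ge0 ?mulr_ge0 ?addr_ge0 ?mulr_ge0//; exact: ltW.
have a6 : 2 * (C + 1) * N * `|e0| + C * N + N * (2 * ln N + 4) <= K * N * (1 + ln N).
  have : 0 <= (2 * (C + 1) * `|e0| + C + 4) * (N * ln N).
    by rewrite mulr_ge0 ?mulr_ge0 ?addr_ge0 ?mulr_ge0//; lra.
  have : 0 <= N * ln N by rewrite mulr_ge0// ltW.
  rewrite /K; lra.
lra.
Qed.

End hamiltonian_lower_bound.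

(** * Discretization of a measure of finite energy *)

Section greedy_choice.
Local Open Scope ereal_scope.
Context d (T : measurableType d) (R : realType).

(** Otherwise [f] minus its mean is strictly positive on [S] with integral at most 0, which makes
    [S] negligible. *)
Lemma exists_le_integral (P : probability T R) (S : set T) (f : T -> \bar R) :
  measurable S -> P S = 1 -> measurable_fun setT f -> (forall x, 0 <= f x) ->
  exists2 x, S x & f x <= \int[P]_y f y.
Proof.
move=> mS PS mf f0; apply: contrapT => nex.
have If x : S x -> \int[P]_y f y < f x.
  by move=> Sx; rewrite ltNge; apply/negP => fx; apply: nex; exists x.
have [x0 Sx0] : S !=set0.
  by apply/set0P/eqP => S0; move: PS; rewrite S0 measure0 => /eqP; rewrite eq_sym onee_eq0.
have I0 : 0 <= \int[P]_y f y by exact: integral_ge0.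
have Ifin : \int[P]_y f y \is a fin_num.
  by rewrite ge0_fin_numE// (lt_le_trans (If x0 Sx0)) ?leey.
set I := \int[P]_y f y in If I0 Ifin.
have mfS : measurable_fun S f by exact: measurable_funTS.
have mg : measurable_fun S (fun x => f x - I) by exact: emeasurable_funB.
have g0 x : S x -> 0 <= f x - I by move=> /If /ltW xI; rewrite sube_ge0 ?Ifin.
have : \int[P]_(x in S) (f x - I) + I <= I.
  have -> : \int[P]_(x in S) (f x - I) + I = \int[P]_(x in S) f x.
    have e1 : \int[P]_(x in S) cst I x = I by rewrite integral_cst// [X in _ * X](_ : _ = 1) ?mule1.
    rewrite -[X in _ + X]e1 -ge0_integralD//.
    by apply: eq_integral => x _ /=; rewrite subeK.
  by rewrite /I; apply: ge0_subset_integral.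
rewrite -leeBrDr// subee// => int0.
have : \int[P]_(x in S) `|f x - I| = 0.
  apply/eqP; rewrite eq_le; apply/andP; split; last exact: integral_ge0.
  apply: le_trans int0; rewrite le_eqVlt; apply/orP; left; apply/eqP.
  by apply: eq_integral => x /[!inE] /g0 /gee0_abs.
move=> /(ae_eq_integral_abs P mS mg).1 [N [mN N0 subN]].
have : P S <= P N.
  apply: le_measure; rewrite ?inE//; apply: subset_trans subN => x Sx /= /(_ Sx)/eqP.
  move=> /eqP fI; have := If x Sx; rewrite -sube_gt0 ?fI ?ltxx//.
by rewrite N0 [X in X <= _](_ : _ = 1)// lee_fin ler10.
Qed.

(** The method of conditional expectations. The last point is fixed first, at a place where its cost
    plus its mean interaction with the points still random is at most average; its interactions then
    join the one-point costs, which is why [h] is general in the induction. *)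
Lemma choice_pairs (m : nat -> probability T R) (S : nat -> set T) (g : T * T -> \bar R) :
  (forall i, measurable (S i)) -> measurable_fun setT g -> (forall z, 0 <= g z) ->
  forall n, (forall i, (i < n)%N -> m i (S i) = 1) -> forall h : nat -> T -> \bar R,
  (forall i, measurable_fun setT (h i)) -> (forall i x, 0 <= h i x) ->
  exists2 x : nat -> T, (forall i, (i < n)%N -> S i (x i)) &
   \sum_(i < n) h i (x i) + \sum_(j < n) \sum_(i < j) g (x i, x j) <=
   \sum_(i < n) \int[m i]_x h i x +
   \sum_(j < n) \sum_(i < j) \int[m j]_y \int[m i]_x g (x, y).
Proof.
move=> mS mg g0; elim=> [|n IH] mS1 h mh h0.
  exists (fun=> point) => //.
  by rewrite !big_ord0.
pose phi y := h n y + \sum_(i < n) \int[m i]_x g (x, y).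
have mG i : measurable_fun setT (fun y => \int[m i]_x g (x, y)).
  exact: measurable_fun_fubini_tonelli_G.
have G0 i y : 0 <= \int[m i]_x g (x, y) by exact: integral_ge0.
have [||y Sy hy] := @exists_le_integral (m n) (S n) phi (mS n) (mS1 n (ltnSn n)).
  by apply: emeasurable_funD => //; exact: emeasurable_sum.
  by move=> y; rewrite adde_ge0// sume_ge0.
have mgy : measurable_fun setT (fun x => g (x, y)) by exact: measurableT_comp.
have [||x Sx hx] := IH (fun i iN => mS1 i (ltnW iN)) (fun i x => h i x + g (x, y)).
- by move=> i; exact: emeasurable_funD.
- by move=> i z; rewrite adde_ge0.
exists (fun i => if i == n then y else x i).
  move=> i; rewrite ltnS leq_eqVlt => /orP[/eqP ->|iN]; first by rewrite eqxx.
  by rewrite ltn_eqF//; exact: Sx.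
rewrite !big_ord_recr/= eqxx.
have E1 : \sum_(i < n) h i (if i == n :> nat then y else x i) = \sum_(i < n) h i (x i).
  by apply: eq_bigr => i _; rewrite ltn_eqF.
have E2 : \sum_(j < n) \sum_(i < j) g (if i == n :> nat then y else x i, if j == n :> nat then y else x j) =
    \sum_(j < n) \sum_(i < j) g (x i, x j).
  apply: eq_bigr => j _; apply: eq_bigr => i _.
  by rewrite !ltn_eqF// (ltn_trans (ltn_ord i)).
have E3 : \sum_(i < n) g (if i == n :> nat then y else x i, y) = \sum_(i < n) g (x i, y).
  by apply: eq_bigr => i _; rewrite ltn_eqF.
have E4 : \sum_(i < n) \int[m i]_x (h i x + g (x, y)) =
    \sum_(i < n) \int[m i]_x h i x + \sum_(i < n) \int[m i]_x g (x, y).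
  by rewrite -big_split/=; apply: eq_bigr => i _; rewrite ge0_integralD.
have E5 : \int[m n]_y phi y = \int[m n]_y h n y +
    \sum_(i < n) \int[m n]_y \int[m i]_x g (x, y).
  rewrite /phi ge0_integralD//; last 2 first.
  - by move=> z _; exact: sume_ge0.
  - exact: emeasurable_sum.
  by rewrite ge0_integral_sum.
rewrite E1 E2 E3; move: hx; rewrite E4 big_split/= => hx; rewrite E5 in hy.
apply: (@le_trans _ _ (h n y + (\sum_(i < n) \int[m i]_x h i x +
    \sum_(i < n) \int[m i]_x g (x, y) +
    \sum_(j < n) \sum_(i < j) \int[m j]_z \int[m i]_x g (x, z)))).
  apply: le_trans (leeD2l (h n y) hx).
  have ac (u v w z : \bar R) : u + v + (w + z) = v + (u + z + w).
    by rewrite (addeC u v) -!addeA; congr (v + (u + _)); rewrite addeC.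
  by rewrite le_eqVlt; apply/orP; left; apply/eqP; exact: ac.
have ac (u v w z : \bar R) : z + (u + v + w) = u + w + (z + v).
  by rewrite addeC -!addeA; congr (u + _); rewrite [LHS]addeC -addeA.
rewrite [leLHS](_ : _ = (\sum_(i < n) \int[m i]_x h i x +
  \sum_(j < n) \sum_(i < j) \int[m j]_z \int[m i]_x g (x, z)) + phi y); last exact: ac.
apply: (le_trans (leeD2l _ hy)).
have ac2 (u v w z : \bar R) : u + w + (v + z) = u + v + (w + z).
  by rewrite -!addeA; congr (u + _); rewrite addeCA.
by rewrite le_eqVlt; apply/orP; left; apply/eqP; exact: ac2.
Qed.

End greedy_choice.

Section quantile.
Local Open Scope ereal_scope.
Context {R : realType}.
Local Notation mR := (measurableTypeR R).
Variable nu : probability mR R.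

(** An atom of mass [r] at [a] would give mass [r^2] to the point (a, a), where the kernel is
    +oo. *)
Lemma energy_lty_no_atom p (U : R -> R) (a : R) : confining p U ->
  energy U nu < +oo -> nu [set a] = 0.
Proof.
move=> confU fin; have nufin : nu [set a] \is a fin_num by exact: fin_num_measure.
have mK := measurable_logker confU; have K0 := logker_ge0 confU.
have ma : measurable ([set a] : set mR) by exact: measurable_set1.
apply/eqP; rewrite eq_le measure_ge0 andbT leNgt; apply/negP => pos.
suff : energy U nu = +oo by move=> E; rewrite E ltxx in fin.
apply/eqyP => A A0.
pose r := fine (nu [set a]); have nuE : nu [set a] = r%:E by rewrite /r fineK.
have r0 : (0 < r)%R by rewrite -lte_fin -nuE.
pose B := (A / (r * r))%R.
have B0 : (0 <= B)%R by rewrite divr_ge0 ?mulr_ge0 ?ltW.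
rewrite /energy dintE//.
apply: (@le_trans _ _ (\int[nu \x nu]_z (B%:E * (\1_([set a] `*` [set a]) z)%:E))).
  rewrite ge0_integralZl_EFin//.
  - rewrite integral_indic//; last exact: measurableX.
    rewrite [X in _ * X](_ : _ = (r * r)%:E).
      by rewrite -EFinM lee_fin /B divfK// gt_eqF// mulr_gt0.
    by rewrite setIT EFinM -nuE; exact: product_measure1E.
  - apply/measurable_EFinP; apply: measurable_indic; exact: measurableX.
apply: ge0_le_integralT => -[x y]; first by rewrite -EFinM lee_fin mulr_ge0.
rewrite indicE; have [|_] := boolP ((x, y) \in _); last by rewrite mule0.
by rewrite inE => -[/= -> ->]; rewrite logker_diag leey.
Qed.

Let mono_union (G : nat -> set mR) (u : \bar R) : (forall k, measurable (G k)) ->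
  nondecreasing_seq G -> (forall k, nu (G k) <= u) -> nu (\bigcup_k G k) <= u.
Proof.
move=> mG ndG hu.
have cv := @nondecreasing_cvg_mu _ _ _ nu G mG (bigcup_measurable (fun k _ => mG k)) ndG.
rewrite -(cvg_lim _ cv)//; apply: lime_le; first by apply/cvg_ex; eexists; exact: cv.
by apply: nearW => k; exact: hu.
Qed.

Let mono_inter (G : nat -> set mR) (u : \bar R) : (forall k, measurable (G k)) ->
  nonincreasing_seq G -> (forall k, u <= nu (G k)) -> u <= nu (\bigcap_k G k).
Proof.
move=> mG ndG hu.
have cv := @nonincreasing_cvg_mu _ _ _ nu G (le_lt_trans (probability_le1 nu (mG 0%N)) (ltry 1)) mG (bigcapT_measurable mG) ndG.
rewrite -(cvg_lim _ cv)//; apply: lime_ge; first by apply/cvg_ex; eexists; exact: cv.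
by apply: nearW => k; exact: hu.
Qed.

Hypothesis no_atom : forall a : R, nu [set a] = 0.

Let F (x : R) := nu `]-oo, x]%classic.

Let F_homo x y : (x <= y)%R -> F x <= F y.
Proof.
move=> xy; apply: le_measure; rewrite ?inE; [exact: measurable_itv..|].
by move=> z /=; rewrite !in_itv/= => /le_trans; apply.
Qed.

(** At the least [t] with [F t >= u], approximation from the right gives one inequality and from the
    left the other; they meet because [t] is not an atom. *)
Lemma quantile (u : R) : (0 < u)%R -> (u < 1)%R ->
  exists t : R, nu `]-oo, t]%classic = u%:E.
Proof.
move=> u0 u1.
pose A := [set x : R | u%:E <= F x].
have A0 : A !=set0.
  apply: contrapT => nA.
  have : nu (\bigcup_k `]-oo, (k%:R : R)]%classic) <= u%:E.
    apply: mono_union => [k|m n mn|k]; first exact: measurable_itv.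
      apply/subsetPset => z /=; rewrite !in_itv/= => /le_trans; apply.
      by rewrite ler_nat.
    rewrite leNgt; apply/negP => h; apply: nA; exists k%:R; exact: ltW.
  rewrite (_ : \bigcup_k _ = setT); last first.
    apply/seteqP; split => // x _; exists (Num.truncn x).+1 => //=.
    by rewrite in_itv/= ltW// truncnS_gt.
  by rewrite [X in X <= _](_ : _ = 1) ?lee_fin ?leNgt ?u1//; exact: probability_setT.
have [b hb] : exists b : R, F b < u%:E.
  apply: contrapT => nb.
  have : u%:E <= nu (\bigcap_k `]-oo, (- k%:R : R)%R]%classic).
    apply: mono_inter => [k|m n mn|k]; first exact: measurable_itv.
      apply/subsetPset => z /=; rewrite !in_itv/= => /le_trans; apply.
      by rewrite lerN2 ler_nat.
    by rewrite leNgt; apply/negP => h; apply: nb; exists (- k%:R)%R.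
  rewrite (_ : \bigcap_k _ = set0) ?measure0 ?lee_fin ?leNgt ?u0//.
  rewrite -subset0 => x /(_ (Num.truncn (- x)).+1 I) /=.
  by rewrite in_itv/= lerNr leNgt truncnS_gt.
have lbA : has_lbound A.
  exists b => x /= ux; rewrite leNgt; apply/negP => /ltW/F_homo xb.
  by move: (le_lt_trans (le_trans ux xb) hb); rewrite ltxx.
pose t := inf A; exists t.
have Ft : u%:E <= F t.
  rewrite /F (_ : `]-oo, t]%classic = \bigcap_k `]-oo, (t + k.+1%:R^-1)%R]%classic).
    apply: mono_inter => [k|m n mn|k]; first exact: measurable_itv.
      apply/subsetPset => z /=; rewrite !in_itv/= => /le_trans; apply.
      by rewrite lerD2l lef_pV2 ?posrE// ler_nat.
    have [y Ay yt] : exists2 y, A y & (y < t + k.+1%:R^-1)%R.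
      by apply: inf_adherent => //; rewrite invr_gt0.
    exact: le_trans Ay (F_homo (ltW yt)).
  apply/seteqP; split => [x /= xt k _|x xt] /=.
    by move: xt; rewrite !in_itv/= => /le_trans; apply; rewrite lerDl.
  rewrite in_itv/= leNgt; apply/negP => tx.
  have := xt (Num.truncn (x - t)^-1) I; rewrite /= in_itv/= -lerBlDl; apply/negP.
  rewrite -ltNge -[ltRHS]invrK ltf_pV2 ?posrE ?invr_gt0 ?subr_gt0//.
  exact: truncnS_gt.
have tle : nu `]-oo, t[%classic <= u%:E.
  rewrite (_ : `]-oo, t[%classic = \bigcup_k `]-oo, (t - k.+1%:R^-1)%R]%classic).
    apply: mono_union => [k|m n mn|k]; first exact: measurable_itv.
      apply/subsetPset => z /=; rewrite !in_itv/= => /le_trans; apply.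
      by rewrite lerD2l lerN2 lef_pV2 ?posrE// ler_nat.
    rewrite leNgt; apply/negP => /ltW h.
    have := ge_inf lbA h; apply/negP; rewrite -ltNge -/t.
    by rewrite ltrBlDr ltrDl.
  apply/seteqP; split => [x /=|x [k _] /=]; rewrite !in_itv/=; last first.
    by move=> /le_lt_trans; apply; rewrite ltrBlDr ltrDl.
  move=> xt; exists (Num.truncn (t - x)^-1) => //=; rewrite in_itv/=.
  rewrite lerBrDr -lerBrDl -[leRHS]invrK lef_pV2 ?posrE ?invr_gt0 ?subr_gt0//.
  by rewrite ltW// truncnS_gt.
apply/eqP; rewrite eq_le Ft andbT.
rewrite (_ : `]-oo, t]%classic = `]-oo, t[%classic `|` [set t]); last first.
  apply/seteqP; split => [x|x []] /=; rewrite !in_itv/=.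
  - by rewrite le_eqVlt => /orP[/eqP ->|]; [right|left].
  - exact: ltW.
  - by move=> ->.
apply: (@le_trans _ _ (nu `]-oo, t[%classic + nu [set t])).
  by apply: measureU2; [exact: measurable_itv|exact: measurable_set1].
by rewrite no_atom adde0.
Qed.

End quantile.

Definition clamp {R : realType} (A x : R) : R := Num.max (- A) (Num.min x A).

Lemma clamp_homo {R : realType} (A x y : R) : x <= y -> clamp A x <= clamp A y.
Proof.
move=> xy; rewrite /clamp ge_max !le_max lexx/= [X in _ || X]le_min !ge_min lexx xy.
by rewrite orbT /= orbT.
Qed.

Lemma clamp_ge {R : realType} (A x : R) : - A <= clamp A x.
Proof. by rewrite /clamp le_max lexx. Qed.

Lemma clamp_le {R : realType} (A x : R) : 0 <= A -> clamp A x <= A.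
Proof. by move=> A0; rewrite /clamp ge_max ge_min lexx orbT andbT; lra. Qed.

Lemma clamp_id {R : realType} (A x : R) : `|x| <= A -> clamp A x = x.
Proof.
rewrite ler_norml => /andP[xA Ax]; rewrite /clamp.
by rewrite (min_idPl Ax); apply/max_idPr.
Qed.

Lemma dist_clamp {R : realType} (A x : R) : 0 <= A -> `|x - clamp A x| <= `|x|.
Proof.
move=> A0; have [xA|xA] := leP x (- A).
  have -> : clamp A x = - A.
    by rewrite /clamp; apply/max_idPl; rewrite ge_min xA.
  by rewrite opprK !ler0_norm; lra.
have [Ax|Ax] := leP x A.
  by rewrite clamp_id ?subrr ?normr0// ler_norml ltW.
have -> : clamp A x = A.
  by rewrite /clamp (min_idPr (ltW Ax)); apply/max_idPr; lra.
by rewrite !ger0_norm; lra.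
Qed.

Section quantile_partition.
Local Open Scope ereal_scope.
Context {R : realType}.
Local Notation mR := (measurableTypeR R).
Variable nu : probability mR R.
Hypothesis no_atom : forall a : R, nu [set a] = 0.

(** The last clause bounds the oscillation of [clamp A] on each cell, also on the two unbounded
    ones, by increments of [k] that sum to [2 A]. *)
Lemma quantile_partition n : exists S : nat -> set mR,
  [/\ forall i, measurable (S i),
      forall i, (i < n.+1)%N -> nu (S i) = (n.+1%:R^-1)%R%:E,
      forall i j x y, (i < j)%N -> S i x -> S j y -> (x < y)%R,
      forall x, exists2 i, (i < n.+1)%N & S i x &
      forall A : R, (0 <= A)%R -> exists k : nat -> R,
        [/\ (k 0%N = - A)%R, k n.+1 = A & forall i x, (i < n.+1)%N -> S i x ->
          (k i <= clamp A x <= k i.+1)%R]].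
Proof.
have /choice[t ht] : forall i, exists t : R, (0 < i < n.+1)%N ->
    nu `]-oo, t]%classic = (i%:R / n.+1%:R)%R%:E.
  move=> i; have [/andP[i0 iN]|] := boolP (0 < i < n.+1)%N; last by exists 0%R.
  have [||t tE] := quantile no_atom (u := (i%:R / n.+1%:R)%R).
  - by rewrite divr_gt0// ltr0n.
  - by rewrite ltr_pdivrMr// mul1r ltr_nat.
  - by exists t.
(* The cells are the differences of consecutive [G i]. Quantiles exist at interior levels only; the
   empty set and the whole line stand for levels 0 and 1. *)
pose G i : set mR := if i == 0%N then set0 else
  if (i < n.+1)%N then `]-oo, t i]%classic else setT.
have mG i : measurable (G i).
  by rewrite /G; case: ifP => // _; case: ifP => // _; exact: measurable_itv.
have nuG i : (i <= n.+1)%N -> nu (G i) = (i%:R / n.+1%:R)%R%:E.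
  rewrite /G; have [->|i0] := eqVneq i 0%N; first by rewrite measure0 mul0r.
  rewrite leq_eqVlt => /orP[/eqP ->|iN]; last by rewrite iN ht// lt0n i0.
  by rewrite ltnn divff//; exact: probability_setT.
have t_lt i j : (0 < i)%N -> (i < j)%N -> (j < n.+1)%N -> (t i < t j)%R.
  move=> i0 ij jN; rewrite ltNge; apply/negP => tji.
  have : nu `]-oo, t j]%classic <= nu `]-oo, t i]%classic.
    apply: le_measure; rewrite ?inE; [exact: measurable_itv..|].
    by move=> z /=; rewrite !in_itv/= => /le_trans; apply.
  rewrite !ht ?i0 ?(leq_ltn_trans _ ij)// ?(ltn_trans ij)//.
  by rewrite lee_fin ler_pM2r// ler_nat leqNgt ij.
have G_lower i x y : (y <= x)%R -> G i x -> G i y.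
  move=> yx; rewrite /G; case: ifP => // _; case: ifP => // _ /=.
  by rewrite !in_itv/=; exact: le_trans.
have G_homo i j : (i <= j)%N -> G i `<=` G j.
  rewrite leq_eqVlt => /orP[/eqP -> //|ij] x; rewrite /G.
  have [_|i0] := eqVneq i 0%N; [by []|]; have [j0|j0] := eqVneq j 0%N; first by rewrite j0 in ij.
  case: (ltnP j n.+1) => // jN; rewrite (ltn_trans ij jN) /= !in_itv/= => /le_trans; apply.
  by rewrite ltW// t_lt// lt0n.
exists (fun i => G i.+1 `\` G i); split.
- by move=> i; exact: measurableD.
- move=> i iN; rewrite measureD//; last by rewrite (le_lt_trans (probability_le1 _ _))// ltry.
  rewrite (_ : G i.+1 `&` G i = G i); last by apply/setIidPr/G_homo.
  transitivity (nu (G i.+1) - nu (G i)) => //.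
  rewrite !nuG// ?(ltnW iN)// -EFinB -mulrBl -natrB// subSnn.
  by rewrite mul1r.
- move=> i j x y ij [Gx _] [_ nGy]; rewrite ltNge; apply/negP => yx.
  by apply: nGy; apply: G_lower yx _; exact: G_homo Gx.
- move=> x.
  have ex : exists i, `[< G i x >] by exists n.+1; apply/asboolP; rewrite /G /= ltnn.
  have := ex_minnP ex => -[i /asboolP Gi mini].
  have i0 : (0 < i)%N by rewrite lt0n; apply/eqP => i0; move: Gi; rewrite i0 /G eqxx.
  have iN : (i <= n.+1)%N by apply: mini; apply/asboolP; rewrite /G /= ltnn.
  exists i.-1; first by rewrite prednK.
  rewrite prednK//; split => // /asboolP/mini.
  by rewrite leqNgt prednK// leqnn.
- move=> A A0; pose k i : R := if i == 0%N then (- A)%R else if (i < n.+1)%N then clamp A (t i) else A.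
  exists k; split; [by []|by rewrite /k /= ltnn|].
  move=> i x iN [Gi1 nGi]; rewrite /k; apply/andP; split.
  + case: ifP => [_|i0]; first exact: clamp_ge.
    rewrite iN clamp_homo// ltW// ltNge; apply/negP => xt; apply: nGi.
    by rewrite /G i0 iN /= in_itv.
  + move: Gi1; rewrite /G /=; case: ifP => _; last by move=> _; exact: clamp_le.
    by rewrite /= in_itv/= => /clamp_homo.
Qed.

End quantile_partition.

Section conditioning.
Local Open Scope ereal_scope.
Context d (T : measurableType d) (R : realType).
Variables (nu : probability T R) (S : set T) (mS : measurable S).

Lemma ge0_integral_mrestr (f : T -> \bar R) : measurable_fun setT f ->
  (forall x, 0 <= f x) ->
  \int[mrestr nu mS]_x f x = \int[nu]_(x in S) f x.
Proof.
move=> mf f0; rewrite -(setUv S) ge0_integral_setU//=; last 3 first.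
- exact: measurableC.
- exact: measurable_funTS.
- by apply/disj_setPS; rewrite setICr.
rewrite [X in _ + X](_ : _ = 0) ?adde0; last first.
  rewrite (@eq_measure_integral _ _ _ _ mzero) ?integral_measure_zero// => A mA AS.
  by rewrite /= /mrestr (_ : A `&` S = set0) ?measure0//; apply/disjoints_subset.
by apply: eq_measure_integral => A mA AS; rewrite /= /mrestr (setIidl AS).
Qed.

Variable (r : R).
Hypotheses (r_gt0 : (0 < r)%R) (nuS : nu S = (r^-1)%:E).

(** The second argument of [mnormalize] is its value for a mass 0 or +oo, which [nuS] excludes. *)
Definition conditional : probability T R := mnormalize (mrestr nu mS) nu.

Lemma conditionalE A : conditional A = r%:E * nu (A `&` S).
Proof.
rewrite /conditional /= /mnormalize /= /mrestr setTI.
have ri : (0 < r^-1)%R by rewrite invr_gt0.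
rewrite [X in (X == 0) || _](_ : _ = (r^-1)%:E)// [X in _ || (X == +oo)](_ : _ = (r^-1)%:E)//.
rewrite gt_eqF ?lte_fin//= muleC; congr (_ * _).
by have -> : fine (nu S) = (r^-1)%R; [rewrite nuS|rewrite invrK].
Qed.

Lemma ge0_integral_conditional (f : T -> \bar R) : measurable_fun setT f ->
  (forall x, 0 <= f x) ->
  \int[conditional]_x f x = r%:E * \int[nu]_(x in S) f x.
Proof.
move=> mf f0; have r0 : (0 <= r)%R by exact: ltW.
rewrite -ge0_integral_mrestr// -(@ge0_integral_mscale _ _ _ (mrestr nu mS) setT measurableT (NngNum r0) f)//.
apply: eq_measure_integral => A mA _.
by rewrite [LHS]conditionalE.
Qed.

Lemma conditional_full (E : set T) : measurable E -> nu E = 1 ->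
  conditional (S `&` E) = 1.
Proof.
move=> mE nuE; rewrite conditionalE.
have -> : nu (S `&` E `&` S) = nu S.
  rewrite setIAC setIid; apply/eqP; rewrite eq_le; apply/andP; split.
    by apply: le_measure; rewrite ?inE//; exact: measurableI.
  have nuCE : nu (~` E) = 0 by rewrite probability_setC// nuE subee.
  rewrite -[leRHS]adde0 -nuCE; apply: (@le_trans _ _ (nu ((S `&` E) `|` ~` E))).
    apply: le_measure; rewrite ?inE//.
      by apply: measurableU; [exact: measurableI|exact: measurableC].
    by move=> x Sx; have [Ex|] := pselect (E x); [left|right].
  by apply: measureU2; [exact: measurableI|exact: measurableC].
by rewrite nuS -EFinM divff// gt_eqF.
Qed.

Lemma le_integral_conditional (f g : T -> \bar R) : measurable_fun setT f ->
  measurable_fun setT g -> (forall x, 0 <= f x) -> (forall x, 0 <= g x) ->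
  (forall x, S x -> f x <= g x) ->
  \int[conditional]_x f x <= \int[conditional]_x g x.
Proof.
move=> mf mg f0 g0 fg; rewrite !ge0_integral_conditional// lee_wpmul2l//.
  by rewrite lee_fin ltW.
by apply: ge0_le_integral => //; exact: measurable_funTS.
Qed.

End conditioning.

Section partition_integral.
Local Open Scope ereal_scope.
Context d (T : measurableType d) (R : realType).
Variables (nu : probability T R) (n : nat) (S : nat -> set T).
Hypothesis mS : forall i, measurable (S i).
Hypothesis disjS : forall i j x, S i x -> S j x -> i = j.
Hypothesis covS : forall x, exists2 i, (i < n)%N & S i x.

Lemma ge0_integral_partition (f : T -> \bar R) : measurable_fun setT f ->
  (forall x, 0 <= f x) ->
  \int[nu]_x f x = \sum_(i < n) \int[nu]_(x in S i) f x.
Proof.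
move=> mf f0.
have D : \big[setU/set0]_(i <- iota 0 n) S i = setT.
  apply/seteqP; split => // x _; have [i iN Si] := covS x.
  rewrite -bigcup_seq; exists i => //=; by rewrite mem_iota.
rewrite -D ge0_integral_bigsetU//=.
- by rewrite -[in LHS](subn0 n) -/(index_iota 0 n) big_mkord.
- exact: iota_uniq.
- by move=> i j _ _ [x [Si Sj]]; exact: (disjS Si Sj).
- exact: measurable_funTS.
Qed.

End partition_integral.

Definition tail_cost {R : realType} (p : nat) (A x : R) : R := `|x - clamp A x| ^+ p.

Lemma tail_cost_ge0 {R : realType} p (A x : R) : 0 <= tail_cost p A x.
Proof. by rewrite /tail_cost exprn_ge0. Qed.

(** The distance is at most three times the largest of three terms, two tail displacements and one
    clamped distance, and the power of the largest is at most the sum of the powers. *)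
Lemma dist_pow_le {R : realType} p (A x y : R) : `|y - x| ^+ p <=
  3 ^+ p * (tail_cost p A x + tail_cost p A y + `|clamp A y - clamp A x| ^+ p).
Proof.
rewrite /tail_cost; pose a := `|x - clamp A x|; pose b := `|y - clamp A y|.
pose c := `|clamp A y - clamp A x|; rewrite -/a -/b -/c.
have h : `|y - x| <= a + b + c.
  have -> : y - x = (y - clamp A y) + (clamp A y - clamp A x) - (x - clamp A x) by ring.
  rewrite (le_trans (ler_normB _ _))// -/a.
  have := ler_normD (y - clamp A y) (clamp A y - clamp A x); rewrite -/b -/c; lra.
have [a0 b0 c0] : [/\ 0 <= a, 0 <= b & 0 <= c] by rewrite /a /b /c.
have key (M : R) : 0 <= M -> a <= M -> b <= M -> c <= M ->
    `|y - x| ^+ p <= 3 ^+ p * M ^+ p.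
  move=> M0 aM bM cM; rewrite -exprMn lerXn2r ?nnegrE//; last by lra.
  by rewrite mulr_ge0.
have pw (t : R) : 0 <= t -> 0 <= t ^+ p by exact: exprn_ge0.
have := pw _ a0; have := pw _ b0; have := pw _ c0 => pc pb pa.
have [ab|ab] := leP a b; [have [bc|bc] := leP b c|have [ac|ac] := leP a c].
- apply: (le_trans (key c c0 _ _ _)) => //; first exact: le_trans bc.
  by rewrite ler_wpM2l ?exprn_ge0//; lra.
- apply: (le_trans (key b b0 _ _ _)) => //; first exact: ltW.
  by rewrite ler_wpM2l ?exprn_ge0//; lra.
- apply: (le_trans (key c c0 _ _ _)) => //; first exact/ltW/(lt_le_trans ab).
  by rewrite ler_wpM2l ?exprn_ge0//; lra.
- apply: (le_trans (key a a0 _ _ _)) => //; [exact: ltW|exact: ltW|].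
  by rewrite ler_wpM2l ?exprn_ge0//; lra.
Qed.

Section transport_cost.
Local Open Scope ereal_scope.
Context {R : realType}.
Local Notation mR := (measurableTypeR R).
Variables (nu : probability mR R) (p : nat).
Hypothesis p_gt0 : (0 < p)%N.

Local Notation tail_cost := (tail_cost p).

Lemma measurable_clamp (A : R) : measurable_fun [set: mR] (clamp A : mR -> R).
Proof.
rewrite /clamp; apply: measurable_maxr => //.
exact: measurable_minr.
Qed.

Lemma measurable_tail_cost A : measurable_fun [set: mR] (tail_cost A : mR -> R).
Proof.
apply: measurable_funX; apply: measurableT_comp => //.
by apply: measurable_funB => //; exact: measurable_clamp.
Qed.

Lemma measurable_norm_pow : measurable_fun [set: mR] (fun x : mR => (`|x : R| ^+ p)%:E).
Proof.
apply/measurable_EFinP; apply: measurable_funX.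
exact: (@measurableT_comp _ _ _ _ _ _ (@Num.norm R R)).
Qed.

(** Dominated convergence: the cost at [x] vanishes once the level exceeds [|x|], and clamping moves
    [x] by at most [|x|]. *)
Lemma tail_cost_small (e : R) : \int[nu]_x (`|x : R| ^+ p)%:E < +oo -> (0 < e)%R ->
  exists2 A : R, (0 <= A)%R & \int[nu]_x (tail_cost A x)%:E <= e%:E.
Proof.
move=> hp e0.
have ig : nu.-integrable setT (fun x : mR => (`|x : R| ^+ p)%:E).
  apply/integrableP; split; first exact: measurable_norm_pow.
  by under eq_integral do rewrite gee0_abs ?lee_fin ?exprn_ge0//.
have [||||_ _] := @dominated_convergence _ _ _ nu setT measurableT
  (fun k x => (tail_cost k%:R x)%:E) (cst 0) (fun x : mR => (`|x : R| ^+ p)%:E) _ _ _ ig.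
- by move=> k; apply/measurable_EFinP; exact: measurable_tail_cost.
- exact: measurable_cst.
- apply/aeW => x _; apply: cvg_near_cst; exists (Num.truncn `|x|).+1 => // k /= xk.
  rewrite /tail_cost clamp_id ?subrr ?normr0 ?expr0n ?gtn_eqF//.
  by rewrite (le_trans (ltW (truncnS_gt _)))// ler_nat.
- apply/aeW => x k _; rewrite gee0_abs ?lee_fin ?tail_cost_ge0//.
  by rewrite lerXn2r ?nnegrE// dist_clamp.
rewrite integral_cst// mul0e => cv.
apply: contrapT => nA.
have : e%:E <= 0.
  rewrite -(cvg_lim _ cv)//; apply: lime_ge; first by apply/cvg_ex; eexists; exact: cv.
  apply: nearW => k; rewrite leNgt; apply/negP => /ltW h; apply: nA.
  by exists k%:R.
by rewrite lee_fin leNgt e0.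
Qed.

Variables (n : nat) (S : nat -> set mR).
Hypothesis mS : forall i, measurable (S i).
Hypothesis nuS : forall i, (i < n.+1)%N -> nu (S i) = (n.+1%:R^-1)%R%:E.
Hypothesis ordS : forall i j x y, (i < j)%N -> S i x -> S j y -> (x < y)%R.
Hypothesis covS : forall x, exists2 i, (i < n.+1)%N & S i x.
Hypothesis clampS : forall A : R, (0 <= A)%R -> exists k : nat -> R,
  [/\ (k 0%N = - A)%R, k n.+1 = A & forall i x, (i < n.+1)%N -> S i x ->
          (k i <= clamp A x <= k i.+1)%R].

Local Notation m := (fun i => conditional nu (mS i)).

Lemma disjS i j x : S i x -> S j x -> i = j.
Proof.
move=> Si Sj; have [ij|ij|//] := ltngtP i j.
  by have := ordS ij Si Sj; rewrite ltxx.
by have := ordS ij Sj Si; rewrite ltxx.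
Qed.

Let N0 : (0 < n.+1%:R :> R)%R. Proof. by []. Qed.

Lemma ge0_integral_conditionals (f : mR -> \bar R) : measurable_fun setT f ->
  (forall x, 0 <= f x) ->
  \int[nu]_x f x = (n.+1%:R^-1)%R%:E * \sum_(i < n.+1) \int[m i]_x f x.
Proof.
move=> mf f0; rewrite (ge0_integral_partition nu mS disjS covS)//.
rewrite ge0_sume_distrr; last by move=> i _; exact: integral_ge0.
apply: eq_bigr => i _; rewrite (ge0_integral_conditional (mS i) N0 (nuS (ltn_ord i)))//.
by rewrite muleA -EFinM mulVf ?mul1e// gt_eqF.
Qed.

Lemma measurable_dist_pow : measurable_fun setT
  (fun z : mR * mR => (`|(z.2 : R) - z.1| ^+ p)%:E).
Proof.
apply/measurable_EFinP; apply: measurable_funX; apply: measurableT_comp => //.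
exact: measurable_funB.
Qed.

(** For two independent points of one cell the clamped part is at most [(2 A)^(p-1)] times an
    increment of [k]. The increments telescope to [2 A], and averaging over the cells leaves
    [(2 A)^p / (n + 1)]. *)
Lemma within_cost_le (A : R) : (0 <= A)%R ->
  (n.+1%:R^-1)%R%:E * \sum_(i < n.+1) \int[m i]_x \int[m i]_y (`|(y : R) - x| ^+ p)%:E <=
  (3 ^+ p)%:E * (2%:E * \int[nu]_x (tail_cost A x)%:E + ((2 * A) ^+ p / n.+1%:R)%:E).
Proof.
move=> A0; have [k [k0 kn hk]] := clampS A0.
have mt : measurable_fun [set: mR] (fun x : mR => (tail_cost A x)%:E).
  by apply/measurable_EFinP; exact: measurable_tail_cost.
have t0 x : 0 <= (tail_cost A x)%:E by rewrite lee_fin tail_cost_ge0.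
have ck i x y : (i < n.+1)%N -> S i x -> S i y ->
    (`|clamp A y - clamp A x| ^+ p <= (2 * A) ^+ p.-1 * (k i.+1 - k i))%R.
  move=> iN Sx Sy; have /andP[x1 x2] := hk i x iN Sx; have /andP[y1 y2] := hk i y iN Sy.
  rewrite -[in leLHS](prednK p_gt0) exprSr ler_pM ?exprn_ge0//.
    rewrite lerXn2r ?nnegrE ?mulr_ge0// ler_norml.
    have := clamp_ge A x; have := clamp_ge A y; have := clamp_le x A0; have := clamp_le y A0; lra.
  by rewrite ler_norml; lra.
have cpos i : (i < n.+1)%N -> (0 <= (2 * A) ^+ p.-1 * (k i.+1 - k i))%R.
  move=> iN; have [x0 Sx0] : S i !=set0.
    apply/set0P/eqP => S0; have := nuS iN; rewrite S0 measure0 => /esym/eqP.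
    by rewrite eqe invr_eq0 pnatr_eq0.
  rewrite mulr_ge0 ?exprn_ge0 ?mulr_ge0// subr_ge0.
  by have /andP[h1 h2] := hk i x0 iN Sx0; exact: le_trans h2.
have ci i : (i < n.+1)%N ->
    \int[m i]_x \int[m i]_y (`|(y : R) - x| ^+ p)%:E <=
    (3 ^+ p)%:E * (2%:E * \int[m i]_x (tail_cost A x)%:E + ((2 * A) ^+ p.-1 * (k i.+1 - k i))%:E).
  move=> iN.
  set c := (_ * (k i.+1 - k i))%R; set I := \int[m i]_x (tail_cost A x)%:E.
  have I0 : 0 <= I by exact: integral_ge0.
  have p30 : (0 <= (3 : R) ^+ p)%R by rewrite exprn_ge0.
  have c0 := cpos i iN; rewrite -/c in c0.
  have intc (a : \bar R) : 0 <= a -> \int[m i]_y ((3 ^+ p)%:E * ((tail_cost A y)%:E + a)) =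
      (3 ^+ p)%:E * (I + a).
    move=> a0; rewrite ge0_integralZl_EFin//; last 2 first.
    - by move=> y _; rewrite adde_ge0.
    - exact: emeasurable_funD.
    by rewrite ge0_integralD// integral_prob_cst.
  rewrite (_ : 2%:E * I + c%:E = I + (I + c%:E)); last first.
    by rewrite addeA (_ : 2%:E = 1 + 1)// ge0_muleDl ?mul1e.
  have Ic0 : 0 <= I + c%:E by rewrite adde_ge0.
  rewrite -intc//; apply: (le_integral_conditional (mS i) N0 (nuS iN)) => //.
  - apply: (measurable_fun_fubini_tonelli_F _ measurable_dist_pow) => z.
    by rewrite lee_fin exprn_ge0.
  - by apply: emeasurable_funM => //; exact: emeasurable_funD.
  - by move=> x; apply: integral_ge0 => y _; rewrite lee_fin exprn_ge0.
  - by move=> x; rewrite mule_ge0 ?lee_fin// adde_ge0.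
  move=> x Sx; rewrite (_ : (tail_cost A x)%:E + (I + c%:E) = I + ((tail_cost A x)%:E + c%:E)); last exact: addeCA.
  have tc0 : 0 <= (tail_cost A x)%:E + c%:E by rewrite adde_ge0.
  rewrite -intc//; apply: (le_integral_conditional (mS i) N0 (nuS iN)) => //.
  - exact: (measurableT_comp measurable_dist_pow (pair1_measurable x)).
  - by apply: emeasurable_funM => //; exact: emeasurable_funD.
  - by move=> y; apply: mule_ge0; [rewrite lee_fin|exact: adde_ge0].
  move=> y Sy; rewrite -!EFinD -EFinM lee_fin.
  apply: (le_trans (dist_pow_le p A x y)); rewrite ler_wpM2l//.
  by have := ck i x y iN Sx Sy; rewrite -/c; lra.
have Ni : 0 <= (n.+1%:R^-1)%R%:E :> \bar R by rewrite lee_fin invr_ge0.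
apply: (le_trans (lee_wpmul2l Ni (lee_sum _ (fun (i : 'I_n.+1) _ => ci i (ltn_ord i))))).
have I0 i : 0 <= 2%:E * \int[m i]_x (tail_cost A x)%:E.
  by rewrite mule_ge0 ?lee_fin//; exact: integral_ge0.
rewrite -ge0_sume_distrr; last first.
  by move=> i _; rewrite adde_ge0// lee_fin cpos.
rewrite big_split/= sumEFin -ge0_sume_distrr; last by move=> i _; exact: integral_ge0.
rewrite muleCA lee_wpmul2l ?lee_fin ?exprn_ge0//.
rewrite ge0_muleDr; last 2 first.
- by rewrite mule_ge0 ?lee_fin//; apply: sume_ge0 => i _; exact: integral_ge0.
- by rewrite lee_fin sumr_ge0// => i _; exact: cpos.
rewrite muleCA -ge0_integral_conditionals// leeD2l// -EFinM lee_fin.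
rewrite -mulr_sumr -(big_mkord xpredT (fun i => k i.+1 - k i)%R) telescope_sumr//.
rewrite k0 kn opprK -mulr2n -[(A *+ 2)%R]mulr_natl -exprSr prednK//.
by rewrite mulrC.
Qed.

End transport_cost.

Lemma sum_pairs_le {R : realType} (K : nat -> nat -> \bar R) n :
  (forall i j, (0 <= K i j)%E) -> (forall i j, K i j = K j i) ->
  (2%:E * \sum_(j < n) \sum_(i < j) K i j <= \sum_(i < n) \sum_(j < n) K i j)%E.
Proof.
move=> K0 Ks; elim: n => [|n IH]; first by rewrite !big_ord0 mule0.
rewrite [X in (_ <= X)%E]big_ord_recr/=.
under [X in (_ <= X + _)%E]eq_bigr do rewrite big_ord_recr/=.
rewrite big_split/= big_ord_recr/= [X in (_ <= _ + X)%E]big_ord_recr/=.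
have S0 : (0 <= \sum_(i < n) K i n)%E by exact: sume_ge0.
rewrite ge0_muleDr//; last by apply: sume_ge0 => j _; exact: sume_ge0.
have -> : (\sum_(i < n) K n i = \sum_(i < n) K i n)%E by apply: eq_bigr => i _.
rewrite -[leRHS]addeA; apply: leeD => //.
rewrite (_ : 2%:E = 1 + 1)%E// ge0_muleDl// mul1e leeD2l// leeDl//.
Qed.

Lemma sum_pairs_sym {R : realType} (f : nat -> nat -> R) n :
  (forall i, f i i = 0) -> (forall i j, f i j = f j i) ->
  \sum_(i < n) \sum_(j < n) f i j = 2 * \sum_(j < n) \sum_(i < j) f i j.
Proof.
move=> f0 fs; elim: n => [|n IH]; first by rewrite !big_ord0 mulr0.
rewrite big_ord_recr/=; under eq_bigr do rewrite big_ord_recr/=.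
rewrite big_split/= IH [in RHS]big_ord_recr/= [X in _ + X = _]big_ord_recr/= f0 addr0.
have -> : \sum_(i < n) f n i = \sum_(i < n) f i n by apply: eq_bigr.
by ring.
Qed.

Lemma sum_offdiag {R : realType} (U : R -> R) (x : nat -> R) n :
  \sum_(i < n.+1) \sum_(j < n.+1)
    (if i == j :> nat then 0 else (U (x i) + U (x j)) / 2 - ln `|x i - x j|) =
  n%:R * (\sum_(i < n.+1) U (x i)) - \sum_(i < n.+1) \sum_(j < n.+1) ln `|x i - x j|.
Proof.
have fE i j : (if i == j :> nat then 0 else (U (x i) + U (x j)) / 2 - ln `|x i - x j|) =
    (U (x i) + U (x j)) / 2 - ln `|x i - x j| - (if i == j then U (x i) else 0).
  have [->|_] := eqVneq i j; last by rewrite subr0.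
  by rewrite subrr normr0 ln0//; field.
under eq_bigr do under eq_bigr do rewrite fE.
under eq_bigr do rewrite sumrB sumrB -mulr_suml big_split/= sumr_const card_ord.
rewrite sumrB sumrB -mulr_suml big_split/=.
have -> : \sum_(i < n.+1) \sum_(j < n.+1) (if i == j :> nat then U (x i) else 0) =
    \sum_(i < n.+1) U (x i).
  apply: eq_bigr => i _; rewrite (bigD1 i)//= eqxx big1 ?addr0// => j.
  by rewrite eq_sym -val_eqE/= => /negbTE ->.
set s := \sum_(i < n.+1) U (x i).
have e1 : \sum_(i < n.+1) U (x i) *+ n.+1 = n.+1%:R * s by rewrite sumrMnl mulr_natl.
have e2 : \sum_(i < n.+1) \sum_(j < n.+1) U (x j) = n.+1%:R * s.
  by rewrite sumr_const card_ord mulr_natl.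
by rewrite e1 e2 -natr1; lra.
Qed.

Section configuration.
Local Open Scope ereal_scope.
Context {R : realType}.
Local Notation mR := (measurableTypeR R).
Variables (nu : probability mR R) (p : nat) (U : R -> R).
Hypothesis p_gt0 : (0 < p)%N.
Hypothesis confU : confining p U.
Hypothesis energy_fin : energy U nu < +oo.

Let mK := measurable_logker confU.
Let K0 := logker_ge0 confU.

Lemma energy_lty_moment : \int[nu]_x (`|x : R| ^+ p)%:E < +oo.
Proof.
have [k k0 kU] := confining_lower confU.
have iU : \int[nu]_x (U x)%:E < +oo.
  by apply: (le_lt_trans (integral_confining_le nu confU)); rewrite lte_mul_pinfty.
apply: (@le_lt_trans _ _ (\int[nu]_x ((k^-1)%:E * (U x)%:E))).
  apply: ge0_le_integralT => x; first by rewrite lee_fin exprn_ge0.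
  by rewrite -EFinM lee_fin -ler_pdivrMl ?invr_gt0// invrK.
rewrite ge0_integralZl_EFin//.
- by rewrite lte_mul_pinfty ?lee_fin ?invr_ge0 ?ltW.
- by move=> x _; rewrite lee_fin (confining_ge0 confU).
- by apply/measurable_EFinP; exact: measurable_confining confU.
- by rewrite invr_ge0 ltW.
Qed.

(* A choice of one point per cell is found by bounding the average over
   independent points, [x i] following [nu] conditioned on [S i]; the quantity
   averaged adds to the energy a large multiple of the transport cost, so that
   both come out small for the same choice. *)
Lemma energy_configuration (E : set mR) (e : R) : measurable E -> nu E = 1 ->
  (0 < e)%R -> exists n0, forall n, (n0 <= n)%N ->
  exists (x : nat -> R) (S : nat -> set mR),
  [/\ forall i, measurable (S i),
      forall i, (i < n.+1)%N -> nu (S i) = (n.+1%:R^-1)%R%:E,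
      forall i j y z, (i < j)%N -> S i y -> S j z -> (y < z)%R,
      forall y, exists2 i, (i < n.+1)%N & S i y &
  [/\ forall i, (i < n.+1)%N -> S i (x i) /\ E (x i),
      ((n%:R * \sum_(i < n.+1) U (x i)) - \sum_(i < n.+1) \sum_(j < n.+1) ln `|x i - x j| <=
         n.+1%:R ^+ 2 * (fine (energy U nu) + e))%R &
      \sum_(i < n.+1) \int[nu]_(y in S i) (`|(y : R) - x i| ^+ p)%:E <= e%:E]].
Proof.
move=> mE nuE e0.
set J := fine (energy U nu).
have JE : energy U nu = J%:E by rewrite /J fineK// ge0_fin_numE// (energy_ge0 confU).
have J0 : (0 <= J)%R by rewrite -lee_fin -JE (energy_ge0 confU).
(* [L] weighs the transport cost. It is so large that this cost is at most [e] even if it uses the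
   whole bound on the average, and [b] is so small that [L b] adds at most [e] to the energy. *)
have [L L0 Le] : exists2 L : R, (0 < L)%R & (L * e = J + 1)%R.
  exists ((J + 1) / e)%R; first by rewrite divr_gt0// ltr_wpDl.
  by rewrite divfK// gt_eqF.
have [b [b0 be Lb]] : exists b : R, [/\ 0 < b, b <= e / 2 & L * b <= e / 2]%R.
  exists (Num.min (e / 2)%R (e / (2 * L))%R); split.
  - by rewrite lt_min !divr_gt0// mulr_gt0.
  - by rewrite ge_min lexx.
  - have : (Num.min (e / 2) (e / (2 * L)) <= e / (2 * L))%R by rewrite ge_min lexx orbT.
    by move: (Num.min _ _) => b; rewrite ler_pdivlMr ?mulr_gt0//; lra.
have p30 : (0 < (3 : R) ^+ p)%R by rewrite exprn_gt0.
have [|A A0 tA] := @tail_cost_small _ nu p p_gt0 (b / 4 / 3 ^+ p)%R energy_lty_moment.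
  by rewrite !divr_gt0.
(* From this rank on the clamped part of the transport cost is at most [b / 2]; the choice of [A]
   bounds the tail part by [b / 2]. *)
exists (Num.truncn (2 * 3 ^+ p * (2 * A) ^+ p / b)%R).+1 => n nn0.
have nA : (2 * 3 ^+ p * (2 * A) ^+ p <= n.+1%:R * b)%R.
  rewrite -ler_pdivrMr// (le_trans (ltW (truncnS_gt _)))// ler_nat.
  exact: leq_trans nn0 _.
have [S [mS nuS ordS covS clS]] := quantile_partition (fun a => energy_lty_no_atom a confU energy_fin) n.
pose m i := conditional nu (mS i).
have N0 : (0 < n.+1%:R :> R)%R by [].
have N20 : (0 < n.+1%:R ^+ 2 :> R)%R by rewrite exprn_gt0.
have disj i j y : S i y -> S j y -> i = j by exact: disjS.
have mS1 i : (i < n.+1)%N -> m i (S i `&` E) = 1.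
  by move=> iN; apply: (conditional_full (mS i) N0 (nuS i iN)).
have intm i f : (i < n.+1)%N -> measurable_fun setT f -> (forall y, 0 <= f y) ->
    \int[m i]_y f y = n.+1%:R%:E * \int[nu]_(y in S i) f y.
  by move=> iN; exact: (ge0_integral_conditional (mS i) N0 (nuS i iN)).
pose D (x y : mR) : \bar R := (`|(y : R) - x| ^+ p)%:E.
have D0 x y : 0 <= D x y by rewrite lee_fin exprn_ge0.
have mD := @measurable_dist_pow R p.
(* Conditioning brings a second factor [n + 1], so these penalties add up to [L (n + 1)^2] times the
   transport cost, the order of the energy of the pairs. *)
pose h i x := (L * n.+1%:R)%:E * \int[m i]_y D x y.
have LN0 : (0 <= L * n.+1%:R)%R by rewrite mulr_ge0// ltW.
have mI i : measurable_fun [set: mR] (fun x : mR => \int[m i]_y D x y).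
  rewrite /D; apply: (measurable_fun_fubini_tonelli_F _ mD) => z.
  by rewrite lee_fin exprn_ge0.
have I0 i x : 0 <= \int[m i]_y D x y by exact: integral_ge0.
have [||x Sx hx] := @choice_pairs _ _ _ m (fun i => S i `&` E) (logker U)
    (fun i => measurableI _ _ (mS i) mE) mK K0 n.+1 mS1 h.
- by move=> i; exact: emeasurable_funM.
- by move=> i x; rewrite mule_ge0.
have xinc i j : (i < j)%N -> (j < n.+1)%N -> (x i < x j)%R.
  move=> ij jN; have [Si _] := Sx i (ltn_trans ij jN); have [Sj _] := Sx j jN.
  exact: ordS ij Si Sj.
pose f (i j : nat) : R := if i == j then 0%R else ((U (x i) + U (x j)) / 2 - ln `|x i - x j|)%R.
pose P : R := (\sum_(j < n.+1) \sum_(i < j) f i j)%R.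
pose B : \bar R := \sum_(i < n.+1) \int[nu]_(y in S i) D (x i) y.
have L1 : \sum_(i < n.+1) h i (x i) = (L * n.+1%:R ^+ 2)%:E * B.
  rewrite ge0_sume_distrr; last by move=> i _; exact: integral_ge0.
  apply: eq_bigr => i _; rewrite /h intm//; last exact: (measurableT_comp mD (pair1_measurable (x i))).
  by rewrite muleA -EFinM -mulrA expr2.
have L2 : \sum_(j < n.+1) \sum_(i < j) logker U (x i, x j) = P%:E.
  rewrite /P -sumEFin; apply: eq_bigr => j _; rewrite -sumEFin; apply: eq_bigr => i _.
  by rewrite /f ltn_eqF// logker_neq// lt_eqF// xinc.
have R1 : \sum_(i < n.+1) \int[m i]_x h i x <= (L * n.+1%:R ^+ 2 * b)%:E.
  have wc := within_cost_le p_gt0 mS nuS ordS covS clS A0.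
  rewrite (eq_bigr (fun i : 'I_n.+1 => (L * n.+1%:R)%:E * \int[m i]_x \int[m i]_y D x y)); last first.
    by move=> i _; rewrite /h ge0_integralZl_EFin.
  rewrite -ge0_sume_distrr; last by move=> i _; exact: integral_ge0.
  rewrite -[X in _ * X]mul1e -(_ : n.+1%:R%:E * (n.+1%:R^-1)%R%:E = 1 :> \bar R); last first.
    by rewrite -EFinM divff// gt_eqF.
  rewrite -muleA muleA -EFinM.
  have -> : (L * n.+1%:R ^+ 2 * b)%:E = (L * n.+1%:R * n.+1%:R)%:E * b%:E.
    by rewrite -EFinM expr2 !mulrA.
  apply: lee_wpmul2l; first by rewrite lee_fin mulr_ge0.
  apply: (le_trans wc).
  apply: (@le_trans _ _ ((3 ^+ p)%:E * (2%:E * (b / 4 / 3 ^+ p)%:E + ((2 * A) ^+ p / n.+1%:R)%:E))).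
    apply: lee_wpmul2l; first by rewrite lee_fin ltW.
    by apply: leeD2r; apply: lee_wpmul2l.
  rewrite [leLHS](_ : _ = (3 ^+ p * (2 * (b / 4 / 3 ^+ p) + (2 * A) ^+ p / n.+1%:R))%:E)//.
  rewrite lee_fin mulrDr.
  have -> : (3 ^+ p * (2 * (b / 4 / 3 ^+ p)) = b / 2)%R by field; rewrite gt_eqF.
  have : (3 ^+ p * ((2 * A) ^+ p / n.+1%:R) <= b / 2)%R.
    rewrite mulrA ler_pdivrMr//; move: nA; rewrite -mulrA.
    by move: (_ * _ ^+ p)%R => t; lra.
  by rewrite [X in _ -> (_ <= X)%R](splitr b) lerD2l.
(* Pairs [i < j] make at most half of the double sum: the self-interactions of the cells are
   nonnegative and dropped. *)
have R2 : \sum_(j < n.+1) \sum_(i < j) \int[m j]_y \int[m i]_x logker U (x, y) <=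
    (n.+1%:R ^+ 2 * J / 2)%:E.
  pose K i j : \bar R := \int[m i]_y \int[m j]_z logker U (y, z).
  have Kge i j : 0 <= K i j by apply: integral_ge0 => y _; exact: integral_ge0.
  have KE i j : \int[m j]_y \int[m i]_x logker U (x, y) = K i j.
    by rewrite /K; apply/esym; apply: fubini_tonelli.
  have Ksym i j : K i j = K j i.
    rewrite -KE /K; apply: eq_integral => y _; apply: eq_integral => z _.
    exact: logker_sym.
  under eq_bigr do under eq_bigr do rewrite KE.
  have := sum_pairs_le n.+1 Kge Ksym.
  have -> : \sum_(i < n.+1) \sum_(j < n.+1) K i j = (n.+1%:R ^+ 2 * J)%:E.
    have intnu g : measurable_fun setT g -> (forall y, 0 <= g y) ->
        \int[nu]_y g y = (n.+1%:R^-1)%R%:E * \sum_(i < n.+1) \int[m i]_y g y.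
      exact: (ge0_integral_conditionals mS nuS ordS covS).
    have : energy U nu = (n.+1%:R^-1)%R%:E * ((n.+1%:R^-1)%R%:E *
        \sum_(i < n.+1) \sum_(j < n.+1) K i j).
      rewrite /energy /dint intnu; last 2 first.
      - exact: measurable_fun_fubini_tonelli_F.
      - by move=> y; exact: integral_ge0.
      congr (_ * _); rewrite ge0_sume_distrr; last first.
        by move=> i _; exact: sume_ge0.
      apply: eq_bigr => i _.
      have mKy y : measurable_fun setT (fun z => logker U (y, z)).
        exact: (measurableT_comp mK (pair1_measurable y)).
      under eq_integral => y _ do rewrite (intnu _ (mKy y))//.
      rewrite ge0_integralZl_EFin//.
      - congr (_ * _); rewrite ge0_integral_sum//.
        + by move=> j; exact: measurable_fun_fubini_tonelli_F.
        + by move=> j y _; exact: integral_ge0.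
      - by move=> y _; apply: sume_ge0 => j _; exact: integral_ge0.
      - apply: emeasurable_sum => j; exact: measurable_fun_fubini_tonelli_F.
    rewrite JE; set T := (X in _ * (_ * X)); rewrite muleA -EFinM => TJ.
    have : (n.+1%:R ^+ 2)%:E * J%:E = T.
      by rewrite TJ muleA -EFinM -invfM -expr2 divff ?mul1e// gt_eqF.
    by move=> TE; rewrite EFinM; exact: (esym TE).
  by rewrite -lee_pdivlMl// -EFinM mulrC.
have B0 : 0 <= B by apply: sume_ge0 => i _; exact: integral_ge0.
have P0 : (0 <= P)%R.
  rewrite -lee_fin -L2; apply: sume_ge0 => j _; apply: sume_ge0 => i _; exact: K0.
have tot : (L * n.+1%:R ^+ 2)%:E * B + P%:E <= (n.+1%:R ^+ 2 * (L * b + J / 2))%:E.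
  rewrite -L1 -L2; apply: (le_trans hx); apply: (le_trans (leeD R1 R2)).
  by rewrite -EFinD lee_fin; lra.
have LN2 : (0 < L * n.+1%:R ^+ 2)%R by rewrite mulr_gt0.
exists x, S; split => //; split => //.
- have P2 : (2 * P = n%:R * (\sum_(i < n.+1) U (x i)) -
      \sum_(i < n.+1) \sum_(j < n.+1) ln `|x i - x j|)%R.
    rewrite -sum_offdiag -sum_pairs_sym//.
    - by move=> i; rewrite /f eqxx.
    - move=> i j; rewrite /f eq_sym; case: ifP => // _.
      by rewrite (addrC (U (x i))) distrC.
  rewrite -P2.
  have : P%:E <= (n.+1%:R ^+ 2 * (L * b + J / 2))%:E.
    by apply: le_trans tot; rewrite leeDr// mule_ge0// lee_fin ltW.
  rewrite lee_fin => PL.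
  have : (n.+1%:R ^+ 2 * (L * b) <= n.+1%:R ^+ 2 * (e / 2))%R by rewrite ler_wpM2l// ltW.
  by lra.
- rewrite -/B.
  have : (L * n.+1%:R ^+ 2)%:E * B <= (n.+1%:R ^+ 2 * (L * b + J / 2))%:E.
    by apply: le_trans tot; rewrite leeDl// lee_fin.
  rewrite -lee_pdivlMl// => /le_trans; apply.
  rewrite -EFinM lee_fin mulrC ler_pdivrMr//.
  rewrite (_ : e * (L * n.+1%:R ^+ 2) = n.+1%:R ^+ 2 * (L * e))%R; last by ring.
  by rewrite ler_pM2l// Le; nra.
Qed.

End configuration.

(** * Boxes around a configuration *)

Section box.
Context {R : realType}.
Local Notation mR := (measurableTypeR R).
Variables (p : nat) (U : R -> R).
Hypothesis confU : confining p U.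

(** The offset [2 i eta] leaves a gap [eta] between boxes, so particles of different boxes are at
    least [eta] farther apart than the points, even if two points coincide. *)
Definition box_corner (x : nat -> R) (eta : R) (i : nat) : R := x i + 2 * i%:R * eta.

Lemma box_gap (x f : nat -> R) (eta : R) i j : 0 < eta -> (i < j)%N -> x i <= x j ->
  f i <= box_corner x eta i + eta -> box_corner x eta j <= f j ->
  eta + (x j - x i) <= f j - f i.
Proof.
move=> e0 ij xij; rewrite /box_corner => fi fj.
have : (i%:R + 1 <= j%:R :> R) by rewrite natr1 ler_nat.
by move=> ij1; nra.
Qed.

Lemma log_pairs_nth (s : seq R) :
  log_pairs s = \sum_(i < size s) \sum_(j < size s) ln `|s`_i - s`_j|.
Proof.
rewrite /log_pairs (big_nth 0) big_mkord; apply: eq_bigr => i _.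
by rewrite (big_nth 0) big_mkord.
Qed.

(** The bound [g] on the logarithms is left open: the logarithm of the original distance for
    separated points, [ln eta] for pairs that may coincide. *)
Lemma box_hamiltonian_le (C0 : R) N (x : nat -> R) (eta : R) (g : nat -> nat -> R)
    (l : N.-tuple mR) :
  0 <= C0 -> (forall x h, 0 <= h <= 1 -> U (x + h) <= U x + C0 * h * (U x + 1)) ->
  0 < eta -> 2 * N%:R * eta <= 1 ->
  (forall i j, (i < j)%N -> (j < N)%N -> x i <= x j) ->
  (forall i j d, (i < j)%N -> (j < N)%N -> eta <= d -> x j - x i <= d -> g i j <= ln d) ->
  (forall i : 'I_N, box_corner x eta i <= tnth l i <= box_corner x eta i + eta) ->
  hamiltonian U (l : seq R) <=
    N%:R * \sum_(i < N) (U (x i) + C0 * (2 * N%:R * eta) * (U (x i) + 1)) -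
    (\sum_(i < N) \sum_(j < N | (i < j)%N) g i j) *+ 2.
Proof.
move=> C00 sh e0 e1 xs hg hl; set f := nth 0 (l : seq R).
have hf i : (i < N)%N -> box_corner x eta i <= f i <= box_corner x eta i + eta.
  by move=> iN; have := hl (Ordinal iN); rewrite (tnth_nth 0).
rewrite /hamiltonian log_pairs_nth size_tuple log_pairs_sum lerB//.
  rewrite ler_wpM2l// (big_nth 0) size_tuple big_mkord; apply: ler_sum => i _.
  have /andP[f1 f2] := hf i (ltn_ord i).
  have iN : (i%:R + 1 <= N%:R :> R) by rewrite natr1 ler_nat.
  have i0 : 0 <= i%:R :> R by [].
  pose h : R := f i - x i.
  have -> : nth 0 (l : seq R) i = x i + h by rewrite /h/f addrC subrK.
  have [h0 hN] : 0 <= h /\ h <= 2 * N%:R * eta.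
    by move: f1 f2; rewrite /h /box_corner => f1 f2; split; nra.
  apply: (le_trans (sh _ _ _)); first by rewrite h0 (le_trans hN).
  rewrite lerD2l ler_wpM2r ?ler_wpM2l// addr_ge0//.
  exact: confining_ge0 confU _.
rewrite lerMn2r/=; apply: ler_sum => i _; apply: ler_sum => j ij.
have xij := xs _ _ ij (ltn_ord j).
have /andP[_ fi] := hf i (ltn_ord i); have /andP[fj _] := hf j (ltn_ord j).
have := box_gap e0 ij xij fi fj => gp.
have d0 : 0 <= f j - f i by lra.
by rewrite (ger0_norm d0); apply: hg => //; lra.
Qed.

Lemma box_increasing N (x : nat -> R) (eta : R) (l : N.-tuple mR) :
  0 < eta -> (forall i j, (i < j)%N -> (j < N)%N -> x i <= x j) ->
  (forall i : 'I_N, box_corner x eta i <= tnth l i <= box_corner x eta i + eta) ->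
  sorted <%R (l : seq R).
Proof.
move=> e0 xs hl; apply/(sortedP 0) => i; rewrite size_tuple => iN.
have /andP[_ fi] := hl (Ordinal (ltnW iN)); have /andP[fj _] := hl (Ordinal iN).
rewrite !(tnth_nth 0)/= in fi fj.
have := @box_gap x (nth 0 (l : seq R)) _ _ _ e0 (ltnSn i) (xs i i.+1 (ltnSn i) iN) fi fj.
by have := xs i i.+1 (ltnSn i) iN; lra.
Qed.

(** By [hamiltonian_ge_sum] the left side of the hypothesis is at least (n - 1) / 2 times the sum of
    [U], and [3 <= n] makes this factor at least (n + 1) / 4. *)
Lemma configuration_sum_le n (x : nat -> R) (B : R) : (3 <= n)%N ->
  (forall i j, (i < j)%N -> (j < n.+1)%N -> x i < x j) ->
  n%:R * \sum_(i < n.+1) U (x i) - \sum_(i < n.+1) \sum_(j < n.+1) ln `|x i - x j| <=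
    n.+1%:R ^+ 2 * B ->
  \sum_(i < n.+1) U (x i) <= 4 * n.+1%:R * B.
Proof.
move=> n3 xs hB; pose s := mkseq x n.+1.
have us : uniq s.
  apply/(uniqP 0) => i j; rewrite !inE size_mkseq => iN jN.
  rewrite !nth_mkseq// => xij; apply/eqP; case: ltngtP => // ij.
    by have := xs _ _ ij jN; rewrite xij ltxx.
  by have := xs _ _ ij iN; rewrite xij ltxx.
have := hamiltonian_ge_sum confU us.
have sumE (F : R -> R) : \sum_(y <- s) F y = \sum_(i < n.+1) F (x i).
  by rewrite /s big_map -[in RHS](big_mkord xpredT (fun i => F (x i)))/index_iota subn0.
rewrite /hamiltonian /log_pairs !sumE size_mkseq.
under [in X in _ <= _ - X -> _]eq_bigr do rewrite sumE.
move=> h1; have n3R : 3 <= n%:R :> R by rewrite (ler_nat _ 3).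
have S0 : 0 <= \sum_(i < n.+1) U (x i).
  by apply: sumr_ge0 => i _; exact: confining_ge0 confU _.
move: h1 hB; rewrite -natr1; set s1 := \sum_(i < n.+1) U _ in S0 *.
move: (\sum_(i < _) \sum_(j < _) _) (n%:R : R) n3R => s2 nR n3R h1 hB.
have : (nR + 1) * s1 <= (nR + 1) * (4 * (nR + 1) * B) by nra.
by rewrite ler_pM2l//; lra.
Qed.

(** With side [N ^ -3] no particle moves by more than [2 / N^2], which keeps the total increase of
    the potential bounded when the sum of [U] is of order [N]; the log-volume is [- 3 N ln N]. *)
Lemma box_scale (N : nat) : (2 <= N)%N ->
  let eta : R := N%:R ^- 3 in
  [/\ 0 < eta, 2 * N%:R * eta <= 1, 2 * N%:R * eta = 2 / N%:R ^+ 2 & ln eta = - (3 * ln N%:R)].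
Proof.
move=> N2 /=; have N2R : 2 <= N%:R :> R by rewrite (ler_nat _ 2).
have N0 : 0 < N%:R :> R by lra.
have e : 2 * N%:R * N%:R ^- 3 = 2 / N%:R ^+ 2 :> R by field; rewrite gt_eqF.
split=> //; first by rewrite invr_gt0 exprn_gt0.
  by rewrite e ler_pdivrMr ?exprn_gt0//; nra.
by rewrite lnV ?posrE ?exprn_gt0// lnXn// mulr_natl.
Qed.

Lemma box_cost_le (N s C0 D : R) : 2 <= N -> 0 <= C0 -> s <= N * D ->
  N * (C0 * (2 / N ^+ 2) * (s + N)) <= 2 * C0 * (D + 1).
Proof.
move=> N2 C00 sD; have N0 : 0 < N by lra.
have -> : N * (C0 * (2 / N ^+ 2) * (s + N)) = 2 * C0 * ((s + N) / N).
  by field; rewrite gt_eqF.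
by rewrite ler_wpM2l ?mulr_ge0// ler_pdivrMr// mulrDl mul1r lerD2r mulrC.
Qed.

Lemma box_energy_bulk (B : R) : exists2 K, 0 <= K & forall n (x : nat -> R)
    (l : n.+1.-tuple mR), (3 <= n)%N ->
  (forall i j, (i < j)%N -> (j < n.+1)%N -> x i < x j) ->
  n%:R * \sum_(i < n.+1) U (x i) - \sum_(i < n.+1) \sum_(j < n.+1) ln `|x i - x j| <=
    n.+1%:R ^+ 2 * B ->
  (forall i : 'I_n.+1, box_corner x (n.+1%:R ^- 3) i <= tnth l i <=
    box_corner x (n.+1%:R ^- 3) i + n.+1%:R ^- 3) ->
  hamiltonian U (l : seq R) <= n.+1%:R ^+ 2 * B + K * n.+1%:R * (1 + ln n.+1%:R).
Proof.
have [C0 C00 sh] := confining_shift confU.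
exists (4 * `|B| + 2 * C0 * (4 * `|B| + 1)) => [|n x l n3 xs hB hl].
  by rewrite addr_ge0 ?mulr_ge0// addr_ge0// mulr_ge0.
have n2 : (2 <= n.+1)%N by rewrite ltnS (leq_trans _ n3).
have [e0 e1 eE _] := box_scale n2.
have := @box_hamiltonian_le C0 n.+1 x _ (fun i j => ln `|x j - x i|) l C00 sh e0 e1
  (fun i j ij jN => ltW (xs i j ij jN)) _ hl.
move=> /(_ _) /le_trans; apply.
  move=> i j d ij jN _ xd; have := xs _ _ ij jN => xij.
  by rewrite gtr0_norm ?subr_gt0// ler_ln ?posrE ?subr_gt0//; lra.
rewrite -log_pairs_sum eE.
have SB := configuration_sum_le n3 xs hB.
have N2R : 2 <= n.+1%:R :> R by rewrite (ler_nat _ 2).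
have L0 : 0 <= ln (n.+1%:R : R) by rewrite ln_ge0//; lra.
rewrite big_split/= -mulr_sumr big_split/= sumr_const card_ord.
rewrite mulrDr.
have nB : B <= `|B| by exact: ler_norm.
have B0 : 0 <= `|B| by [].
have nE : n%:R = n.+1%:R - 1 :> R by rewrite -natr1 addrK.
move: hB SB N2R L0; rewrite {}nE -[(1 *+ _)%R]/(n.+1%:R).
move: (\sum_(i < _) U _) (\sum_(i < _) \sum_(j < _) _) (n.+1%:R : R) (ln (n.+1%:R : R)) (`|B|) nB B0.
move=> s1 s2 N L b nB b0 hB SB N2R L0.
have SD : s1 <= N * (4 * b) by nra.
have := box_cost_le N2R C00 SD; move: (N * (_ * (s1 + N))) => T hT.
have D0 : 0 <= 2 * C0 * (4 * b + 1) by rewrite !mulr_ge0//; lra.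
move: D0 hT; move: (2 * C0 * _) => D D0 hT.
have : (4 * b + D) * N * 1 <= (4 * b + D) * N * (1 + L).
  by rewrite ler_wpM2l ?mulr_ge0//; lra.
have : D * 1 <= D * N by rewrite ler_wpM2l//; lra.
by nra.
Qed.

(** The additional particle at [c] may be arbitrarily close to the others, so its distances are
    bounded below by [eta] only. Its ordered pairs cost [6 (n + 1) ln N], whence the 6 in the
    constant, and its confinement costs [N U c]. *)
Lemma box_energy_top (B c : R) : exists2 K, 0 <= K & forall n (x : nat -> R)
    (l : n.+2.-tuple mR), (3 <= n)%N ->
  (forall i j, (i < j)%N -> (j < n.+1)%N -> x i < x j) ->
  (forall i, (i < n.+1)%N -> x i <= c) -> x n.+1 = c ->
  n%:R * \sum_(i < n.+1) U (x i) - \sum_(i < n.+1) \sum_(j < n.+1) ln `|x i - x j| <=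
    n.+1%:R ^+ 2 * B ->
  (forall i : 'I_n.+2, box_corner x (n.+2%:R ^- 3) i <= tnth l i <=
    box_corner x (n.+2%:R ^- 3) i + n.+2%:R ^- 3) ->
  hamiltonian U (l : seq R) <= n.+1%:R ^+ 2 * B + K * n.+2%:R * (1 + ln n.+2%:R).
Proof.
have [C0 C00 sh] := confining_shift confU; have Uc0 := confining_ge0 confU c.
exists (8 * `|B| + U c + 2 * C0 * (4 * `|B| + U c + 1) + 6) => [|n x l n3 xs xc xn hB hl].
  by rewrite !addr_ge0 ?mulr_ge0 ?addr_ge0 ?mulr_ge0.
have n2 : (2 <= n.+2)%N by [].
have [e0 e1 eE lE] := box_scale n2.
have := @box_hamiltonian_le C0 n.+2 x (n.+2%:R ^- 3)
  (fun i j => if (j < n.+1)%N then ln `|x j - x i| else ln (n.+2%:R ^- 3)) l C00 sh e0 e1.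
move=> /(_ _ _ hl) /le_trans; apply.
- move=> i j ij; rewrite ltnS leq_eqVlt => /predU1P[jn|jn]; last exact/ltW/xs.
  by rewrite jn xn; apply: xc; rewrite -jn.
- move=> i j d ij jN ed xd; case: ifP => jn.
    have := xs _ _ ij jn => xij.
    by rewrite gtr0_norm ?subr_gt0// ler_ln ?posrE ?subr_gt0//; lra.
  by rewrite ler_ln ?posrE// (lt_le_trans e0).
have -> : \sum_(i < n.+2) \sum_(j < n.+2 | (i < j)%N)
    (if (j < n.+1)%N then ln `|x j - x i| else ln (n.+2%:R ^- 3)) =
    \sum_(i < n.+1) \sum_(j < n.+1 | (i < j)%N) ln `|x j - x i| +
    n.+1%:R * ln (n.+2%:R ^- 3) :> R.
  rewrite big_ord_recr/= [X in _ + X]big1 ?addr0; last first.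
    by move=> j; rewrite ltnNge -ltnS ltn_ord.
  have -> : n.+1%:R * ln (n.+2%:R ^- 3) = \sum_(i < n.+1) ln (n.+2%:R ^- 3) :> R.
    by rewrite sumr_const card_ord mulr_natl.
  rewrite -big_split/=.
  apply: eq_bigr => i _; rewrite big_mkcond big_ord_recr/= ltn_ord ltnn.
  congr (_ + _); rewrite [RHS]big_mkcond/=; apply: eq_bigr => j _.
  by rewrite ltn_ord.
rewrite mulrnDl -log_pairs_sum eE lE.
have SB := configuration_sum_le n3 xs hB.
have N2R : 2 <= n.+2%:R :> R by rewrite (ler_nat _ 2).
have L0 : 0 <= ln (n.+2%:R : R) by rewrite ln_ge0//; lra.
rewrite big_split/= -mulr_sumr big_split/= sumr_const card_ord.
have -> : \sum_(i < n.+2) U (x i) = \sum_(i < n.+1) U (x i) + U c.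
  by rewrite big_ord_recr/= xn.
rewrite mulrDr.
have nB : B <= `|B| by exact: ler_norm.
have B0 : 0 <= `|B| by [].
have nE : n%:R = n.+2%:R - 2 :> R by rewrite -2!natr1; lra.
have nE1 : n.+1%:R = n.+2%:R - 1 :> R by rewrite -[in RHS]natr1 addrK.
move: hB SB N2R L0; rewrite {}nE {}nE1 -[(1 *+ _)%R]/(n.+2%:R).
move: (\sum_(i < _) U _) (\sum_(i < _) \sum_(j < _) _) (n.+2%:R : R) (ln (n.+2%:R : R)) (`|B|) nB B0.
move=> s1 s2 N L b nB b0 hB SB N2R L0.
have SD : s1 + U c <= N * (4 * b + U c) by nra.
have := box_cost_le N2R C00 SD; move: (N * (_ * (s1 + _ + N))) => T hT.
have D0 : 0 <= 2 * C0 * (4 * b + U c + 1) by rewrite !mulr_ge0//; lra.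
move: (U c) Uc0 SD D0 hT => u u0 SD.
move: (2 * C0 * (4 * b + u + 1)) => D D0 hT.
have : (8 * b + u + D + 6) * N * L >= 6 * N * L.
  by rewrite ler_wpM2r// ler_wpM2r//; lra.
have : D * 1 <= D * N by rewrite ler_wpM2l//; lra.
rewrite mulr2n.
by nra.
Qed.

End box.

(** * The partition function *)

Section partition_function.
Context {R : realType}.
Local Notation mR := (measurableTypeR R).
Variables (p : nat) (V : {poly R}) (C beta : R).
Let U (x : R) : R := V.[x] + C.
Hypothesis p_ge2 : (2 <= p)%N.
Hypothesis beta_gt0 : 0 < beta.
Hypothesis confU : confining p U.
Local Notation weight n A := (@gibbs_weight R n V beta A).

Let p_gt0 : (0 < p)%N. Proof. exact: ltnW. Qed.

Lemma c_V_fin : c_V V \is a fin_num.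
Proof. exact: (c_V_fin_num confU (energy_uniform_lty confU)). Qed.

Definition energy_min : R := fine (c_V V) + C.

Lemma energy_ge_min nu : (energy_min%:E <= energy U nu)%E.
Proof.
by rewrite /energy_min EFinD fineK ?c_V_fin// -leeBrDr//; exact: (c_V_le confU).
Qed.

Lemma gibbs_weight_exp_le : exists2 D, 0 <= D & forall n (A : set (n.-tuple mR)) M,
  (forall l, A l -> uniq l ->
    M + \sum_(x <- (l : seq R)) U x <= hamiltonian U (l : seq R)) ->
  (weight n A <= (expR (beta / 2 * (n%:R ^+ 2 * C - M) + D * n%:R))%:E)%E.
Proof.
have b2 : 0 < beta / 2 by rewrite divr_gt0.
have ify := confining_integral_lty p_ge2 confU b2.
have i0 : (0 <= \int[@lebesgue_measure R]_x (expR (- (beta / 2 * U x)))%:E)%E.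
  by apply: integral_ge0 => x _; rewrite lee_fin expR_ge0.
have [D DE] : exists D, (\int[@lebesgue_measure R]_x (expR (- (beta / 2 * U x)))%:E = D%:E)%E.
  by exists (fine (\int[@lebesgue_measure R]_x (expR (- (beta / 2 * U x)))%:E)%E);
     rewrite fineK// ge0_fin_numE.
have D0 : 0 <= D by rewrite -lee_fin -DE.
exists D => // n A M hA.
apply: (le_trans (gibbs_weight_le beta_gt0 confU DE hA)).
rewrite lee_fin expRD ler_wpM2l ?expR_ge0// mulrC expRM_natl lerXn2r ?nnegrE ?expR_ge0//.
by apply: (le_trans _ (expR_ge1Dx _)); rewrite lerDr.
Qed.

Lemma gibbs_weight_exp_ge n (A : set (n.-tuple mR)) (a : nat -> R) M : (2 <= n)%N ->
  (forall l : n.-tuple mR, (forall i : 'I_n, a i <= tnth l i <= a i + n%:R ^- 3) ->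
    [/\ A l, uniq l & (hamiltonian U (l : seq R) <= M)%R]) ->
  ((expR (beta / 2 * (n%:R ^+ 2 * C - M) - 3 * n%:R * ln n%:R))%:E <= weight n A)%E.
Proof.
move=> n2 hA; have [e0 _ _ lE] := @box_scale R _ n2.
apply: (le_trans _ (gibbs_weight_ge beta_gt0 e0 hA)).
rewrite lee_fin expRD ler_wpM2l ?expR_ge0// -[X in _ <= X]lnK ?posrE ?exprn_gt0//.
by rewrite ler_expR lnXn// lE -[(_ *+ n)%R]mulr_natl; lra.
Qed.

Lemma partition_ge e : 0 < e -> exists n0, forall n, (n0 <= n)%N ->
  ((expR (beta / 2 * (n.+1%:R ^+ 2 * C - n.+1%:R ^+ 2 * (energy_min + e))))%:E <=
   weight n.+1 setT)%E.
Proof.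
move=> e0; have e4 : 0 < e / 4 by rewrite divr_gt0.
have [nu nuE] := c_V_adherent confU e4 c_V_fin.
have nufin : (energy U nu < +oo)%E.
  by apply: (lt_le_trans nuE); rewrite leey.
have [n0 H0] := energy_configuration p_gt0 confU nufin measurableT (probability_setT nu) e4.
set J := fine (energy U nu) in H0.
have JE : J <= energy_min + e / 4.
  rewrite -lee_fin /J fineK ?ge0_fin_numE ?(energy_ge0 confU)//.
  by rewrite /energy_min !EFinD fineK ?c_V_fin// ltW.
have [K K0 HK] := box_energy_bulk confU (J + e / 4).
(* The term [6 / beta] writes the log-volume [3 N ln N] of the boxes as [beta / 2] times an
   energy. *)
have K1 : 0 <= K + 6 / beta by rewrite addr_ge0// divr_ge0// ltW.
have [n1 H1] := nlogn_le_square K1 (divr_gt0 e0 (@ltr0n R 2)).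
exists (maxn 3 (maxn n0 n1)) => n; rewrite !geq_max => /and3P[n3 nn0 nn1].
have [x [S [_ _ ordS _ [Sx hB _]]]] := H0 n nn0.
have xs i j : (i < j)%N -> (j < n.+1)%N -> x i < x j.
  by move=> ij jn; apply: (ordS _ _ _ _ ij (Sx _ (ltn_trans ij jn)).1 (Sx _ jn).1).
have n2 : (2 <= n.+1)%N by rewrite ltnS (leq_trans _ n3).
have L0 : 0 <= ln (n.+1%:R : R) by rewrite ln_ge0// (ler_nat _ 1).
apply: le_trans (gibbs_weight_exp_ge (a := box_corner x (n.+1%:R ^- 3)) n2 _); last first.
  move=> l hl; split => //; last exact: HK hl.
  have : sorted <%R (l : seq R).
    apply: box_increasing hl => [|i j ij jn]; first by rewrite invr_gt0 exprn_gt0.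
    exact/ltW/xs.
  exact: lt_sorted_uniq.
rewrite lee_fin ler_expR.
have := H1 n.+1 (leqW nn1).
have N0 : 1 <= n.+1%:R :> R by rewrite (ler_nat _ 1).
move: (n.+1%:R : R) N0 L0 => N N1 L0 hN.
have : beta / 2 * ((K + 6 / beta) * N * (1 + ln N)) <= beta / 2 * (e / 2 * N ^+ 2).
  by rewrite ler_wpM2l// divr_ge0// ltW.
have -> : beta / 2 * ((K + 6 / beta) * N * (1 + ln N)) =
    beta / 2 * (K * N * (1 + ln N)) + 3 * N * (1 + ln N) by field; rewrite gt_eqF.
have : beta / 2 * (N ^+ 2 * (J + e / 4)) <= beta / 2 * (N ^+ 2 * (energy_min + e / 2)).
  have b0 : 0 <= beta / 2 by rewrite divr_ge0// ltW.
  by rewrite ler_wpM2l// ler_wpM2l ?sqr_ge0//; lra.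
have : 0 <= 3 * N by lra.
by lra.
Qed.

(** Lower bounds on probabilities divide by the partition function and need it bounded above;
    finiteness also makes the normalization effective. *)
Lemma partition_le e : 0 < e -> exists n0, forall n, (n0 <= n)%N ->
  (weight n setT <=
   (expR (beta / 2 * (n%:R ^+ 2 * C - n%:R ^+ 2 * (energy_min - e))))%:E)%E.
Proof.
move=> e0; have [D D0 HD] := gibbs_weight_exp_le.
have [n0 H0] := hamiltonian_lower_bound confU (divr_gt0 e0 (@ltr0n R 2)) energy_ge_min.
have D1 : 0 <= 2 * D / beta by rewrite divr_ge0 ?mulr_ge0// ltW.
have [n1 H1] := nlogn_le_square D1 (divr_gt0 e0 (@ltr0n R 2)).
exists (maxn 1 (maxn n0 n1)) => n; rewrite !geq_max => /and3P[n3 nn0 nn1].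
apply: (le_trans (HD n setT (n%:R ^+ 2 * (energy_min - e / 2)) _)).
  move=> l _ ul; have := H0 (l : seq R) ul.
  by rewrite size_tuple; exact.
rewrite lee_fin ler_expR.
have := H1 n nn1.
have N1 : 1 <= n%:R :> R by rewrite (ler_nat _ 1).
have L0 := ln_ge0 N1.
move: (n%:R : R) N1 L0 => N N1 L0 hN.
have : beta / 2 * (2 * D / beta * N * (1 + ln N)) <= beta / 2 * (e / 2 * N ^+ 2).
  by rewrite ler_wpM2l// divr_ge0// ltW.
have -> : beta / 2 * (2 * D / beta * N * (1 + ln N)) = D * N + D * N * ln N.
  by field; rewrite gt_eqF.
have : 0 <= D * N * ln N by rewrite !mulr_ge0//; lra.
by lra.
Qed.

Lemma gibbsE n (A : set (n.-tuple mR)) Z : weight n setT = Z%:E -> 0 < Z ->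
  gibbs n V beta A = (weight n A * (Z^-1)%:E)%E.
Proof.
move=> ZE Z0; rewrite /gibbs/= /mnormalize.
case: ifP => [|_]; last first.
  by congr (_ * (_^-1)%:E)%E; exact: (congr1 fine ZE).
move=> /orP[] /eqP; rewrite -/(weight n setT) => h; exfalso; move: (etrans (esym ZE) h).
  by case=> Z1; rewrite Z1 ltxx in Z0.
by [].
Qed.

Lemma partition_posreal n z zu :
  ((expR z)%:E <= weight n setT)%E -> (weight n setT <= (expR zu)%:E)%E ->
  exists Z, [/\ weight n setT = Z%:E, expR z <= Z & Z <= expR zu].
Proof.
case: (weight n setT) => [Z|//|//]; rewrite !lee_fin => hz hzu.
by exists Z.
Qed.

(** [zu] excludes an infinite partition function, for which [mnormalize] would return the Dirac
    mass. *)
Lemma gibbs_le n (A : set (n.-tuple mR)) w z zu : (weight n A <= (expR w)%:E)%E ->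
  ((expR z)%:E <= weight n setT)%E -> (weight n setT <= (expR zu)%:E)%E ->
  (gibbs n V beta A <= (expR (w - z))%:E)%E.
Proof.
move=> hA hz hzu; have [Z [ZE zZ _]] := partition_posreal hz hzu.
have Z0 : 0 < Z by exact: lt_le_trans (expR_gt0 z) zZ.
rewrite (gibbsE _ ZE Z0); apply: (@le_trans _ _ ((expR w)%:E * (Z^-1)%:E)%E).
  by apply: lee_wpmul2r => //; rewrite lee_fin invr_ge0 ltW.
by rewrite -EFinM lee_fin expRD expRN ler_wpM2l ?expR_ge0// lef_pV2 ?posrE ?expR_gt0.
Qed.

Lemma gibbs_ge n (A : set (n.-tuple mR)) w z zu : ((expR w)%:E <= weight n A)%E ->
  ((expR z)%:E <= weight n setT)%E -> (weight n setT <= (expR zu)%:E)%E ->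
  ((expR (w - zu))%:E <= gibbs n V beta A)%E.
Proof.
move=> hA hz hzu; have [Z [ZE zZ Zz]] := partition_posreal hz hzu.
have Z0 : 0 < Z by exact: lt_le_trans (expR_gt0 z) zZ.
rewrite (gibbsE _ ZE Z0); apply: (@le_trans _ _ ((expR w)%:E * (Z^-1)%:E)%E); last first.
  by apply: lee_wpmul2r => //; rewrite lee_fin invr_ge0 ltW.
by rewrite -EFinM lee_fin expRD expRN ler_wpM2l ?expR_ge0// lef_pV2 ?posrE ?expR_gt0.
Qed.

End partition_function.

(** * The upper bound on compact sets *)

Section gap_integral.
Context {R : realType}.
Local Notation mR := (measurableTypeR R).
Variables (n : nat) (l : n.+2.-tuple mR).
Lemma ge0_integral_gap (g : mR -> \bar R) :
  measurable_fun setT g -> (forall x, 0 <= g x)%E ->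
  (\int[gap_borel l]_x g x =
  (n.+1%:R^-1)%:E * \sum_(k < n.+1) g (largest l - order_stat l k)%R)%E.
Proof.
move=> mg g0; rewrite (@eq_measure_integral _ _ _ _ (gap_measure l)); last first.
  by move=> A mA _; rewrite /= /gap_borel /borel_part ifT ?mem_set.
rewrite ge0_integral_mscale//=; congr (_ * _)%E.
rewrite ge0_integral_measure_sum//; apply: eq_bigr => k _.
by rewrite integral_dirac// diracT mul1e.
Qed.

(** Reflecting the gaps at the largest particle recovers the empirical measure of the other
    particles. *)
Lemma dint_gap (F : R -> R -> R) (c : R) p :
  measurable_fun [set: mR * mR] (fun z : mR * mR => F (c - z.1) (c - z.2)) ->
  (forall x y, 0 <= F x y)%R -> c = largest l ->
  dint (gap_M1p l p) (fun z => (F (c - z.1) (c - z.2))%:E) =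
  (n.+1%:R^-1 ^+ 2 * \sum_(i < n.+1) \sum_(j < n.+1)
    F (order_stat l i) (order_stat l j))%:E.
Proof.
move=> mF F0 cE; rewrite /dint.
have mFE : measurable_fun [set: mR * mR]
    (fun z : mR * mR => (F (c - z.1) (c - z.2))%:E) by exact/measurable_EFinP.
have F0E (z : mR * mR) : (0 <= (F (c - z.1) (c - z.2))%:E)%E by rewrite lee_fin.
transitivity (\int[gap_borel l]_x (n.+1%:R^-1 *
    \sum_(j < n.+1) F (c - x) (order_stat l j))%:E)%E.
  apply: eq_integral => x _; rewrite (ge0_integral_gap (g := fun y => (F (c - x) (c - y))%:E))//.
    rewrite EFinM -sumEFin; congr (_ * _)%E; apply: eq_bigr => j _.
    by rewrite cE subKr.
    exact: (measurableT_comp mFE (pair1_measurable x)).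
  by move=> y; exact: (F0E (x, y)).
rewrite ge0_integral_gap.
- rewrite -[in LHS]cE expr2 -mulrA EFinM sumEFin; congr (_ * _%:E)%E.
  rewrite mulr_sumr; apply: eq_bigr => i _.
  by rewrite subKr.
- apply/measurable_EFinP; apply: measurable_funM => //.
  apply: measurable_sum => j.
  rewrite (_ : (fun _ => _) = (fun z : mR * mR => F (c - z.1) (c - z.2)) \o
      (fun x : mR => (x, c - order_stat l j : mR)%R)).
    by apply: measurableT_comp => //; exact: measurable_fun_pair.
  by apply/funext => x /=; rewrite subKr.
- by move=> x; rewrite lee_fin mulr_ge0// sumr_ge0.
Qed.

End gap_integral.

Section upper_bound.
Context {R : realType}.
Local Notation mR := (measurableTypeR R).
Variables (p : nat) (U : R -> R).
Hypothesis confU : confining p U.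

(** Three losses: pairs with the largest particle, dropped because the kernel is nonnegative; the
    diagonal, where the envelope is at most [k], for a total of [(n + 1) k]; and the passage from
    the kernel to its minorant. *)
Lemma env_energy_hamiltonian n (l : n.+2.-tuple mR) k (a : R) : uniq l ->
  (a%:E <= env_energy U k (largest l) (gap_M1p l p))%E ->
  n.+1%:R ^+ 2 * a - n.+1%:R * k%:R + \sum_(x <- (l : seq R)) U x <=
  hamiltonian U (l : seq R).
Proof.
move=> ul; rewrite /env_energy.
have ker0 := logker_ge0 confU.
rewrite (@dint_gap _ _ l (fun x y => lip_env (logker U) k (x, y)))//; last 2 first.
- exact: (measurableT_comp (measurable_lip_env ker0 k) (measurable_shift2 _)).
- by move=> x y; exact: (lip_env_ge0 ker0).
rewrite lee_fin => ha.
have psl : perm_eq (sort <=%R (l : seq R)) (l : seq R) by rewrite perm_sort.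
rewrite -(hamiltonian_perm U psl) -(perm_big _ psl)/=.
pose f := order_stat l.
have ss : size (sort <=%R (l : seq R)) = n.+2 by rewrite size_sort size_tuple.
have uf i j : (i < n.+2)%N -> (j < n.+2)%N -> i != j -> f i != f j.
  by move=> iN jN; rewrite /f /order_stat nth_uniq ?ss// sort_uniq.
pose o i j : R := if i == j :> nat then 0 else (U (f i) + U (f j)) / 2 - ln `|f i - f j|.
have o0 i j : (i < n.+2)%N -> (j < n.+2)%N -> 0 <= o i j.
  move=> iN jN; rewrite /o; case: ifPn => // ij.
  by have := ker0 (f i, f j); rewrite logker_neq ?uf// lee_fin.
have -> : hamiltonian U (sort <=%R (l : seq R)) =
    \sum_(i < n.+2) \sum_(j < n.+2) o i j + \sum_(x <- sort <=%R (l : seq R)) U x.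
  rewrite (sum_offdiag U f n.+1) /hamiltonian log_pairs_nth ss (big_nth 0) ss big_mkord.
  have -> : n.+2%:R = n.+1%:R + 1 :> R by rewrite natr1.
  by rewrite mulrDl mul1r addrAC.
rewrite lerD2r.
have oo : \sum_(i < n.+1) \sum_(j < n.+1) o i j <= \sum_(i < n.+2) \sum_(j < n.+2) o i j.
  rewrite [leRHS]big_ord_recr/= -[leLHS]addr0 lerD//.
    apply: ler_sum => i _; rewrite [leRHS]big_ord_recr/= lerDl o0//.
    by rewrite (ltn_trans (ltn_ord i)).
  by apply: sumr_ge0 => j _; exact: o0.
apply: le_trans oo.
have lo : \sum_(i < n.+1) \sum_(j < n.+1) lip_env (logker U) k (f i, f j) <=
    \sum_(i < n.+1) \sum_(j < n.+1) o i j + n.+1%:R * k%:R.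
  have -> : n.+1%:R * k%:R = \sum_(i < n.+1) \sum_(j < n.+1)
      (if i == j :> nat then k%:R else 0) :> R.
    rewrite mulr_natl -[in LHS](card_ord n.+1) -sumr_const; apply: eq_bigr => i _.
    rewrite (bigD1 i)//= eqxx big1 ?addr0// => j.
    by rewrite eq_sym -val_eqE/= => /negbTE ->.
  rewrite -big_split/=; apply: ler_sum => i _; rewrite -big_split/=; apply: ler_sum => j _.
  rewrite /o; case: ifPn => ij; first by rewrite add0r; exact: lip_env_le_cst.
  rewrite addr0 -lee_fin -logker_neq; last first.
    by rewrite uf// (ltn_trans (ltn_ord _)).
  exact: lip_env_le.
move: ha lo; rewrite -/f; move: (\sum_(i < _) \sum_(j < _) _) => T ha lo.
have : n.+1%:R ^+ 2 * a <= n.+1%:R ^+ 2 * (n.+1%:R^-1 ^+ 2 * T) by rewrite ler_wpM2l.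
rewrite mulrA -exprMn divff// expr1n mul1r.
by lra.
Qed.

End upper_bound.

Section ldp_upper.
Context {R : realType}.
Local Notation mR := (measurableTypeR R).
Variables (p : nat) (V : {poly R}) (C beta : R).
Let U (x : R) : R := V.[x] + C.
Hypothesis p_ge2 : (2 <= p)%N.
Hypothesis beta_gt0 : 0 < beta.
Hypothesis confU : confining p U.

Let p_gt0 : (0 < p)%N. Proof. exact: ltnW. Qed.

Lemma gibbs_compact_le (K : set (R * M1p (`[0, +oo[ : set mR) p)) (a e : R) :
  compact K -> (forall x, K x -> (a%:E < energy U (flip x.1 x.2))%E) -> 0 < e ->
  exists n0, forall n, (n0 <= n)%N ->
  (gibbs n.+2 V beta [set l | K (largest l, gap_M1p l p)] <=
   (expR (beta * n.+2%:R ^+ 2 / 2 * (energy_min V C - a + e)))%:E)%E.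
Proof.
move=> cK aK e0; have [k hk] := compact_env_energy confU p_gt0 cK aK.
have [D D0 HD] := gibbs_weight_exp_le p_ge2 beta_gt0 confU.
have e2 : 0 < e / 2 by rewrite divr_gt0.
have [n0 H0] := partition_ge p_ge2 beta_gt0 confU e2.
have [n1 H1] := partition_le p_ge2 beta_gt0 confU e2.
have b0 : 0 <= beta / 2 by rewrite divr_ge0// ltW.
(* The terms pay for replacing [(N - 1)^2 a] by [N^2 a], for the diagonal, and for the factor
   [expR (D * N)] of the one-dimensional integrals. *)
pose D' := 2 * `|a| + k%:R + 2 * D / beta.
have D1 : 0 <= D' by rewrite /D' !addr_ge0// ?mulr_ge0// invr_ge0 ltW.
have [n2 H2] := nlogn_le_square D1 e2.
exists (maxn n0 (maxn n1 n2)) => n; rewrite !geq_max => /and3P[nn0 nn1 nn2].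
have hw := HD n.+2 [set l | K (largest l, gap_M1p l p)]
  (n.+1%:R ^+ 2 * a - n.+1%:R * k%:R) _.
apply: (le_trans (gibbs_le (hw _) (H0 n.+1 (leqW nn0)) (H1 n.+2 (leqW (leqW nn1))))).
  by move=> l /= Kl ul; apply: (env_energy_hamiltonian confU ul); exact/ltW/(hk _ Kl).
rewrite lee_fin ler_expR.
have := H2 n.+2 (leqW (leqW nn2)).
have N1 : 1 <= n.+2%:R :> R by rewrite (ler_nat _ 1).
have L0 := ln_ge0 N1.
have nE : n.+1%:R = n.+2%:R - 1 :> R by rewrite -[in RHS]natr1 addrK.
rewrite {}nE; move: (n.+2%:R : R) N1 L0 => N N1 L0 hN.
have : beta / 2 * (D' * N * (1 + ln N)) <= beta / 2 * (e / 2 * N ^+ 2).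
  by rewrite ler_wpM2l.
have -> : beta / 2 * (D' * N * (1 + ln N)) =
    beta / 2 * ((2 * `|a| + k%:R) * N * (1 + ln N)) + D * N + D * N * ln N.
  by rewrite /D'; field; rewrite gt_eqF.
have : 0 <= D * N * ln N by rewrite !mulr_ge0//; lra.
have q0 : 0 <= k%:R :> R by [].
have : beta / 2 * (N ^+ 2 * a - ((N - 1) ^+ 2 * a - (N - 1) * k%:R)) <=
    beta / 2 * ((2 * `|a| + k%:R) * N * (1 + ln N)).
  rewrite ler_wpM2l//.
  have aa : a <= `|a| by exact: ler_norm.
  have an : - a <= `|a| by rewrite -normrN; exact: ler_norm.
  move: (k%:R : R) q0 (`|a|) aa an => q q0 b aa an.
  have : (2 * b + q) * N * 1 <= (2 * b + q) * N * (1 + ln N).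
    by rewrite ler_wpM2l ?mulr_ge0//; lra.
  have : (2 * N - 1) * a <= (2 * N - 1) * b by rewrite ler_wpM2l//; lra.
  by lra.
by lra.
Qed.

End ldp_upper.

(** * The lower bound on open sets *)

Section wasserstein_upper.
Local Open Scope ereal_scope.
Context {R : realType}.
Local Notation mR := (measurableTypeR R).

Lemma wasserstein_lt p (nu nu' : probability mR R) pi (b e : R) :
  (0 < p)%N -> (0 < e)%R -> couplings nu nu' pi ->
  \int[pi]_z (`|(z.1 : R) - z.2| ^+ p)%:E <= b%:E -> (b < e ^+ p)%R ->
  wasserstein p nu nu' < e%:E.
Proof.
move=> p0 e0 cpi ib be.
have b0 : (0 <= b)%R.
  rewrite -lee_fin; apply: le_trans ib; apply: integral_ge0 => z _.
  by rewrite lee_fin exprn_ge0.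
rewrite /wasserstein; set I := ereal_inf _.
have Ib : I <= b%:E by apply: le_trans ib; apply: ereal_inf_lbound; exists pi.
have I0 : 0 <= I.
  apply: le_ereal_inf_tmp => _ [q _ <-]; apply: integral_ge0 => z _.
  by rewrite lee_fin exprn_ge0.
have q0 : (0 < p%:R^-1 :> R)%R by rewrite invr_gt0 ltr0n.
apply: (@le_lt_trans _ _ (b%:E `^ p%:R^-1)).
  by apply: gt0_ler_poweR => //; rewrite ?ltW// in_itv/= leey andbT ?I0// lee_fin.
rewrite poweR_EFin lte_fin.
have -> : e = ((e ^+ p) `^ p%:R^-1)%R.
  rewrite -(powR_mulrn _ (ltW e0)) -powRrM mulfV ?pnatr_eq0 -?lt0n//.
  by rewrite (powRr1 (ltW e0)).
by apply: gt0_ltr_powR => //; rewrite nnegrE// exprn_ge0// ltW.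
Qed.

Section partition.
Variables (mu : probability mR R) (p n : nat) (S : nat -> set mR).
Hypothesis p_gt0 : (0 < p)%N.
Hypothesis mS : forall i, measurable (S i).
Hypothesis muS : forall i, (i < n.+1)%N -> mu (S i) = (n.+1%:R^-1)%R%:E.
Hypothesis disjS : forall i j x, S i x -> S j x -> i = j.
Hypothesis covS : forall x, exists2 i, (i < n.+1)%N & S i x.
Variable g : nat -> R.

Let T (z : mR) : mR := (\sum_(i < n.+1) g i * \1_(S i) z)%R.

Let TE i z : (i < n.+1)%N -> S i z -> T z = g i.
Proof.
move=> iN Siz; rewrite /T (bigD1 (Ordinal iN))//= big1 ?addr0.
  by rewrite indicE mem_set// mulr1.
move=> j /eqP ji; rewrite indicE memNset ?mulr0// => Sjz.
by apply: ji; apply: val_inj; exact: disjS Sjz Siz.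
Qed.

Let mT : measurable_fun [set: mR] T.
Proof.
by apply: measurable_sum => i; apply: measurable_funM.
Qed.

(** The coupling is the image of [mu] under [(f, T)], where the step function [T] sends the cell
    [S i] to the atom [g i]. Equal masses of the cells give [T] the law [nu']. *)
Lemma wasserstein_partition (f : mR -> mR) (nu nu' : probability mR R) (b e : R) :
  (0 < e)%R -> measurable_fun setT f ->
  (forall A, measurable A -> nu A = mu (f @^-1` A)) ->
  (forall A : set mR, measurable A -> nu' A = (n.+1%:R^-1 * \sum_(i < n.+1) \1_A (g i))%:E) ->
  \sum_(i < n.+1) \int[mu]_(z in S i) (`|(f z : R) - g i| ^+ p)%:E <= b%:E ->
  (b < e ^+ p)%R -> wasserstein p nu nu' < e%:E.
Proof.
move=> e0 mf nuE nuE' ib be.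
have mfT : measurable_fun [set: mR] (fun z => (f z, T z)) by exact: measurable_fun_pair.
apply: (@wasserstein_lt _ _ _ (prob_image mu mfT) b) => //.
  split=> A mA.
    rewrite nuE// /prob_image/= /pushforward; congr (mu _).
    by apply/seteqP; split => [z []|z ?] //; split.
  rewrite nuE'//; transitivity (mu (T @^-1` A)).
    by congr (mu _); apply/seteqP; split => [z []|z ?] //; split.
  have mTA : measurable (T @^-1` A) by rewrite -[X in measurable X]setTI; exact: mT.
  rewrite -[T @^-1` A]setIT -integral_indic// (ge0_integral_partition mu mS disjS covS).
  - rewrite EFinM -sumEFin ge0_sume_distrr//; last first.
    apply: eq_bigr => i _; transitivity (\int[mu]_(z in S i) cst (\1_A (g i) : R)%:E z).
      apply: eq_integral => z; rewrite inE => Siz; congr EFin.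
      by rewrite -(TE (ltn_ord i) Siz).
    rewrite (integral_cst mu (mS i)) muleC; congr (_ * _).
    exact: muS (ltn_ord i).
  - by apply/measurable_EFinP; exact: measurable_indic.
  - by move=> z; rewrite lee_fin.
have mdp : measurable_fun setT (fun z : mR * mR => (`|(z.1 : R) - z.2| ^+ p)%:E).
  rewrite (_ : (fun _ => _) = fun z : mR * mR => (`|(z.2 : R) - z.1| ^+ p)%:E).
    exact: measurable_dist_pow.
  by apply/funext => z; rewrite distrC.
rewrite ge0_integral_prob_image; last 2 first.
- exact: mdp.
- by move=> z; rewrite lee_fin exprn_ge0.
rewrite (ge0_integral_partition mu mS disjS covS); last 2 first.
- exact: (measurableT_comp mdp mfT).
- by move=> z; rewrite lee_fin exprn_ge0.
apply: le_trans ib; apply: lee_sum => i _; rewrite le_eqVlt; apply/orP; left; apply/eqP.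
apply: eq_integral => z; rewrite inE => Siz /=.
by rewrite (TE (ltn_ord i) Siz).
Qed.

End partition.
End wasserstein_upper.

(** The bound is linear in [h], by [h^p <= h], so that the displacement and the transport cost can
    simply be added. *)
Lemma exprD_le {R : realDomainType} p (h y : R) : (0 < p)%N -> 0 <= h <= 1 -> 0 <= y ->
  (h + y) ^+ p <= 2 ^+ p * (h + y ^+ p).
Proof.
move=> p0 /andP[h0 h1] y0; have [hy|yh] := leP h y.
  apply: (@le_trans _ _ ((2 * y) ^+ p)).
    by apply: lerXn2r; rewrite ?nnegrE; lra.
  by rewrite exprMn ler_wpM2l ?exprn_ge0// lerDr.
apply: (@le_trans _ _ ((2 * h) ^+ p)).
  by apply: lerXn2r; rewrite ?nnegrE; lra.
rewrite exprMn ler_wpM2l ?exprn_ge0// -[leLHS]addr0 lerD ?exprn_ge0//.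
by case: p p0 => // q _; rewrite exprS ler_piMr// exprn_ile1//; lra.
Qed.

Lemma two_div_square_le {R : realType} (m : R) : 0 < m ->
  exists n0, forall n, (n0 <= n)%N -> 2 / n.+2%:R ^+ 2 <= m.
Proof.
move=> m0; exists (Num.truncn (2 / m)).+1 => n n0.
have N1 : 1 <= n.+2%:R :> R by rewrite (ler_nat _ 1).
have : 2 / m < n.+2%:R.
  apply: (lt_le_trans (truncnS_gt _)); by rewrite ler_nat (leq_trans n0)// leqW// leqW.
rewrite ltr_pdivrMr// ler_pdivrMr ?exprn_gt0//.
by move: (n.+2%:R : R) N1 => N N1 h; nra.
Qed.

Section ball.
Context {R : realType}.
Local Notation mR := (measurableTypeR R).

Lemma box_bounds N (x : nat -> R) (eta : R) (l : N.-tuple mR) (i : 'I_N) :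
  0 < eta -> box_corner x eta i <= tnth l i <= box_corner x eta i + eta ->
  0 <= (tnth l i : R) - x i <= 2 * N%:R * eta.
Proof.
rewrite /box_corner => e0 /andP[f1 f2].
have iN : (i%:R + 1 <= N%:R :> R) by rewrite natr1 ler_nat.
have i0 : 0 <= i%:R :> R by [].
by apply/andP; split; nra.
Qed.

Lemma order_stat_sorted n (l : n.-tuple mR) (i : 'I_n) :
  sorted <%R (l : seq R) -> order_stat l i = tnth l i.
Proof.
rewrite lt_sorted_uniq_le => /andP[_ sl].
by rewrite /order_stat (sorted_sort le_trans sl) (tnth_nth 0).
Qed.

Variables (p : nat) (V : {poly R}) (C beta : R).
Let U (x : R) : R := V.[x] + C.
Hypothesis p_ge2 : (2 <= p)%N.
Hypothesis beta_gt0 : 0 < beta.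
Hypothesis confU : confining p U.
Local Notation weight n A := (@gibbs_weight R n V beta A).
Local Notation halfline := (`[0, +oo[%classic : set mR).

Let p_gt0 : (0 < p)%N. Proof. exact: ltnW. Qed.

(** Cell [i] is matched with particle [i]; reflection by [c - z] turns this matching into a
    transport from [nu] to the gap measure. *)
Lemma gap_box_wasserstein (c : R) (nu : M1p halfline p) n (x : nat -> R)
    (S : nat -> set mR) (l : n.+2.-tuple mR) (h e1 e : R) :
  0 < e -> 0 <= h <= 1 -> 2 ^+ p * (h + e1) < e ^+ p ->
  (forall i, measurable (S i)) ->
  (forall i, (i < n.+1)%N -> flip c nu (S i) = (n.+1%:R^-1)%:E) ->
  (forall i j z, S i z -> S j z -> i = j) ->
  (forall y, exists2 i, (i < n.+1)%N & S i y) ->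
  (\sum_(i < n.+1) \int[flip c nu]_(y in S i) (`|(y : R) - x i| ^+ p)%:E <= e1%:E)%E ->
  0 <= largest l - c <= h ->
  (forall i, (i < n.+1)%N -> 0 <= order_stat l i - x i <= h) ->
  (wasserstein p nu (gap_M1p l p) < e%:E)%E.
Proof.
move=> e0 h01 he mS nuS disjS covS hS hc hx.
have [h0 h1] := andP h01.
have mdx (a : R) : measurable_fun [set: mR] (fun z : mR => (`|(z : R) - a| ^+ p)%:E).
  apply/measurable_EFinP; apply: measurable_funX; apply: measurableT_comp => //.
  exact: measurable_funB.
have mflip : measurable_fun [set: mR] (fun z : mR => c - z : mR) by exact: measurable_flip.
apply: (@wasserstein_partition _ (flip c nu) p n S p_gt0 mS nuS disjS covS
  (fun i => largest l - order_stat l i) (fun z => c - z : mR) nu (gap_M1p l p)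
  (2 ^+ p * (h + e1)) e e0 mflip) => //.
- move=> A mA; congr (M1p_val nu _); apply/seteqP.
  by split => z /=; rewrite subKr.
- by move=> A mA; exact: gap_borelE.
have -> : (2 ^+ p * (h + e1))%:E =
    (\sum_(i < n.+1) (2 ^+ p * h * n.+1%:R^-1)%:E + (2 ^+ p)%:E * e1%:E)%E.
  rewrite sumEFin sumr_const card_ord -[(_ *+ n.+1)%R]mulr_natr divfK ?pnatr_eq0//.
  by rewrite -EFinM -EFinD mulrDr.
have q0 : 0 <= 2 ^+ p :> R by rewrite exprn_ge0.
apply: (@le_trans _ _ (\sum_(i < n.+1) ((2 ^+ p * h * n.+1%:R^-1)%:E + (2 ^+ p)%:E *
    \int[flip c nu]_(y in S i) (`|(y : R) - x i| ^+ p)%:E))%E); last first.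
  rewrite big_split/= leeD2l// -ge0_sume_distrr.
    by rewrite lee_wpmul2l// lee_fin.
  by move=> i _; apply: integral_ge0 => z _; rewrite lee_fin exprn_ge0.
apply: lee_sum => i _.
have -> : ((2 ^+ p * h * n.+1%:R^-1)%:E =
    \int[flip c nu]_(y in S i) cst (2 ^+ p * h)%:E y)%E.
  rewrite (integral_cst (flip c nu) (mS i)) EFinM; congr (_ * _)%E.
  exact/esym/nuS.
rewrite -ge0_integralZl_EFin//; last exact: measurable_funTS.
rewrite -ge0_integralD//; last 2 first.
- by move=> z _; rewrite /= lee_fin mulr_ge0.
- by apply: measurable_funTS; exact: emeasurable_funM.
apply: ge0_le_integral => //.
- apply: measurable_funTS; apply/measurable_EFinP; apply: measurable_funX.
  by apply: measurableT_comp => //; apply: measurable_funB.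
- apply: measurable_funTS; apply: emeasurable_funD => //; exact: emeasurable_funM.
move=> z _; rewrite /= -EFinM -EFinD lee_fin -mulrDr.
apply: (le_trans _ (exprD_le p_gt0 h01 (normr_ge0 _))).
apply: lerXn2r; rewrite ?nnegrE ?addr_ge0//.
have := hx i (ltn_ord i); move: hc; move: (largest l) (order_stat l i) (x i) => L o xi.
move=> /andP[a1 a2] /andP[a3 a4].
(* The displacements of the particle and of the maximum both lie in [[0, h]], so they differ by at
   most [h]. *)
have -> : c - z - (L - o) = ((o - xi) - (L - c)) - (z - xi) :> R by ring.
apply: (le_trans (ler_normB _ _)); rewrite lerD2r ler_norml.
by apply/andP; split; lra.
Qed.

(** Points drawn from this measure can be chosen at most [c], so a particle added at [c] comes
    last. *)
Lemma flip_halfline (c : R) (nu : M1p halfline p) :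
  flip c nu (`]-oo, c]%classic : set mR) = 1%E.
Proof.
rewrite -(M1p_carrier nu); congr (M1p_val nu _); apply/seteqP.
by split => z /=; rewrite !in_itv/= ?andbT; lra.
Qed.

Lemma gibbs_weight_ball_ge (c : R) (nu : M1p halfline p) (r e d : R) :
  (energy U (flip c nu) < +oo)%E -> 0 < r -> 0 < e -> 0 < d ->
  exists n0, forall n, (n0 <= n)%N ->
  ((expR (beta / 2 * (n.+2%:R ^+ 2 * C -
      n.+2%:R ^+ 2 * (fine (energy U (flip c nu)) + d))))%:E <=
   weight n.+2 [set l | (`|largest l - c| < r)%R /\
     (wasserstein p nu (gap_M1p l p) < e%:E)%E])%E.
Proof.
move=> fin r0 e0 d0; set J := fine (energy U (flip c nu)).
have J0 : 0 <= J by apply/fine_ge0/(energy_ge0 confU).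
(* [h1] and [e1] each get a quarter of [e^p / 2^p], so that [2^p (h1 + e1)] is at most half of
   [e^p]. *)
have t0 : 0 < e ^+ p / 2 ^+ p / 4 by rewrite !divr_gt0 ?exprn_gt0.
have [e1 [e1_gt0 e1d e1t]] : exists e1, [/\ 0 < e1, e1 <= d / 4 & e1 <= e ^+ p / 2 ^+ p / 4].
  exists (Num.min (d / 4) (e ^+ p / 2 ^+ p / 4)); split.
  - by rewrite lt_min t0 divr_gt0.
  - by rewrite ge_min lexx.
  - by rewrite ge_min lexx orbT.
have [h1 [h1_gt0 h1r h1t h11]] : exists h1, [/\ 0 < h1, h1 < r, h1 <= e ^+ p / 2 ^+ p / 4 & h1 <= 1].
  exists (Num.min (Num.min (r / 2) 1) (e ^+ p / 2 ^+ p / 4)); split.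
  - by rewrite !lt_min t0 divr_gt0//= ltr01.
  - by rewrite !gt_min; apply/orP; left; apply/orP; left; lra.
  - by rewrite ge_min lexx orbT.
  - by rewrite !ge_min lexx orbT.
have [n0 H0] := energy_configuration p_gt0 confU fin (measurable_itv _) (flip_halfline c nu) e1_gt0.
have [K K0 HK] := box_energy_top confU (J + e1) c.
have K1 : 0 <= K + 6 / beta by rewrite addr_ge0// divr_ge0// ltW.
have [n1 H1] := nlogn_le_square K1 (divr_gt0 d0 (@ltr0n R 2)).
have [n2 H2] := two_div_square_le h1_gt0.
exists (maxn (maxn 3 n0) (maxn n1 n2)) => n.
rewrite !geq_max -!andbA => /and4P[n3 nn0 nn1 nn2].
have [x0 [S [mS nuS ordS covS [Sx hB hS]]]] := H0 n nn0.
rewrite -/J in hB.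
(* The largest particle is added at index [n.+1]; only the others follow the configuration of
   [flip c nu]. *)
pose x i := if (i < n.+1)%N then x0 i else c.
have xE i : (i < n.+1)%N -> x i = x0 i by rewrite /x => ->.
have xn : x n.+1 = c by rewrite /x ltnn.
have xs i j : (i < j)%N -> (j < n.+1)%N -> x i < x j.
  move=> ij jn; rewrite !xE//; last exact: ltn_trans jn.
  by apply: (ordS _ _ _ _ ij (Sx _ (ltn_trans ij jn)).1 (Sx _ jn).1).
have xc i : (i < n.+1)%N -> x i <= c.
  by move=> iN; rewrite xE//; have [_] := Sx _ iN; rewrite /= in_itv.
have xw i j : (i < j)%N -> (j < n.+2)%N -> x i <= x j.
  move=> ij; rewrite ltnS leq_eqVlt => /predU1P[jn|jn]; last exact/ltW/xs.
  by rewrite jn xn; apply: xc; rewrite -jn.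
have hBx : n%:R * \sum_(i < n.+1) U (x i) -
    \sum_(i < n.+1) \sum_(j < n.+1) ln `|x i - x j| <= n.+1%:R ^+ 2 * (J + e1).
  rewrite (eq_bigr (fun i : 'I_n.+1 => U (x0 i))) => [|i _]; last by rewrite xE.
  rewrite [X in _ - X](eq_bigr (fun i : 'I_n.+1 =>
    \sum_(j < n.+1) ln `|x0 i - x0 j|)) => [//|i _].
  by apply: eq_bigr => j _; rewrite !xE.
have disjS i j z : S i z -> S j z -> i = j.
  move=> Si Sj; apply/eqP; case: ltngtP => // ij.
    by have := ordS _ _ _ _ ij Si Sj; rewrite ltxx.
  by have := ordS _ _ _ _ ij Sj Si; rewrite ltxx.
have [eta0 _ hE _] := @box_scale R n.+2 isT.
have h2 := H2 n nn2; rewrite -hE in h2.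
have b0 : 0 <= beta / 2 by rewrite divr_ge0// ltW.
have := gibbs_weight_exp_ge (V := V) (C := C) beta_gt0 (n := n.+2)
  (A := [set l | `|largest l - c| < r /\ (wasserstein p nu (gap_M1p l p) < e%:E)%E])
  (a := box_corner x (n.+2%:R ^- 3))
  (M := n.+1%:R ^+ 2 * (J + e1) + K * n.+2%:R * (1 + ln n.+2%:R)) isT.
move=> H; apply: le_trans (H _); last first; last clear H.
  move=> l hl; have sl := box_increasing eta0 xw hl.
  split; [|exact: lt_sorted_uniq|exact: HK hl].
  have xb i : (i < n.+2)%N -> 0 <= order_stat l i - x i <= h1.
    move=> iN; rewrite (order_stat_sorted (Ordinal iN) sl).
    have /andP[-> h3] := box_bounds eta0 (hl (Ordinal iN)).
    by rewrite (le_trans h3).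
  have cb : 0 <= largest l - c <= h1 by have := xb n.+1 (ltnSn _); rewrite xn.
  split; first by have /andP[c1 c2] := cb; rewrite ger0_norm// (le_lt_trans c2).
  apply: (@gap_box_wasserstein c nu n x0 S l h1 e1) => //.
  - by rewrite ltW.
  - have p2 : 0 < 2 ^+ p :> R by rewrite exprn_gt0.
    apply: (@le_lt_trans _ _ (2 ^+ p * (e ^+ p / 2 ^+ p / 2))).
      by rewrite ler_pM2l//; move: (e ^+ p / 2 ^+ p) h1t e1t => q; lra.
    have -> : 2 ^+ p * (e ^+ p / 2 ^+ p / 2) = e ^+ p / 2 by field; rewrite gt_eqF.
    by have := exprn_gt0 p e0; move: (e ^+ p) => q; lra.
  - by move=> i iN; rewrite -xE// xb// ltnW.
rewrite lee_fin ler_expR.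
have := H1 n.+2 (leqW (leqW nn1)).
have N1 : 1 <= n.+2%:R :> R by rewrite (ler_nat _ 1).
have L0 := ln_ge0 N1.
have nE : n.+1%:R = n.+2%:R - 1 :> R by rewrite -[in RHS]natr1 addrK.
rewrite {}nE; move: (n.+2%:R : R) N1 L0 => N N1 L0 hN.
have : beta / 2 * ((K + 6 / beta) * N * (1 + ln N)) <= beta / 2 * (d / 2 * N ^+ 2).
  by rewrite ler_wpM2l.
have -> : beta / 2 * ((K + 6 / beta) * N * (1 + ln N)) =
    beta / 2 * (K * N * (1 + ln N)) + 3 * N * (1 + ln N) by field; rewrite gt_eqF.
have : beta / 2 * ((N - 1) ^+ 2 * (J + e1)) <= beta / 2 * (N ^+ 2 * (J + d / 2)).
  rewrite ler_wpM2l//; apply: ler_pM; rewrite ?sqr_ge0//; [lra| |lra].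
  by apply: lerXn2r; rewrite ?nnegrE; lra.
have : 0 <= 3 * N by lra.
by lra.
Qed.

Lemma gibbs_weight_subset n (A B : set (n.-tuple mR)) :
  A `<=` B -> (weight n A <= weight n B)%E.
Proof.
move=> AB; apply: ge0_le_integral_subset => // l.
by rewrite lee_fin gibbs_density_ge0.
Qed.

Lemma gibbs_ball_ge (c : R) (nu : M1p halfline p) (r e d : R) :
  (energy U (flip c nu) < +oo)%E -> 0 < r -> 0 < e -> 0 < d ->
  exists n0, forall n (A : set (n.+2.-tuple mR)), (n0 <= n)%N ->
  [set l | `|largest l - c| < r /\ (wasserstein p nu (gap_M1p l p) < e%:E)%E] `<=` A ->
  ((expR (- (beta * n.+2%:R ^+ 2 / 2 *
      (fine (energy U (flip c nu)) - energy_min V C + d))))%:E <= gibbs n.+2 V beta A)%E.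
Proof.
move=> fin r0 e0 d0; have d2 : 0 < d / 2 by rewrite divr_gt0.
have [n0 H0] := gibbs_weight_ball_ge fin r0 e0 d2.
have [n1 H1] := partition_ge p_ge2 beta_gt0 confU d2.
have [n2 H2] := partition_le p_ge2 beta_gt0 confU d2.
exists (maxn n0 (maxn n1 n2)) => n A; rewrite !geq_max => /and3P[nn0 nn1 nn2] sA.
have hw := le_trans (H0 n nn0) (gibbs_weight_subset sA).
apply: le_trans (gibbs_ge hw (H1 n.+1 (leqW nn1)) (H2 n.+2 (leqW (leqW nn2)))).
by rewrite lee_fin ler_expR; lra.
Qed.

End ball.

Lemma scaled_lne_ge {R : realType} (v b : R) (x : \bar R) : 0 < v ->
  ((expR (v * b))%:E <= x -> b%:E <= (v^-1)%:E * lne x)%E.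
Proof. by move=> v0 /lne_ge_expR; rewrite lee_pdivlMl// EFinM. Qed.

Lemma scaled_lne_le {R : realType} (v b : R) (x : \bar R) : 0 < v ->
  (x <= (expR (v * b))%:E -> (v^-1)%:E * lne x <= b%:E)%E.
Proof. by move=> v0 /lne_le_expR; rewrite lee_pdivrMl// EFinM. Qed.

Theorem corollary2p8 (R : realType) (V : {poly R}) (p : nat) (beta : R)
  (V_convex : convex_function [set: R] (fun x : R => V.[x]))
  (V_degree : size V = p.+1) (p_even : ~~ odd p) (p_ge2 : (2 <= p)%N)
  (beta_gt0 : 0 < beta) :
  @weak_LDP R
    (R * M1p (`[0, +oo[ : set (measurableTypeR R)) p)%type
    _ (fun n => n.+2.-tuple (measurableTypeR R))
    (fun n => gibbs n.+2 V beta)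
    (fun n l => (largest l, gap_M1p l p))
    (fun n => beta * n.+2%:R ^+ 2 / 2)
    (@rate_V R V _ p).
Proof.
have [C confU] := convex_poly_confining V_convex V_degree p_even p_ge2.
have p_gt0 : (0 < p)%N by exact: ltnW.
set U := fun x => _ in confU.
have cfin := c_V_fin confU.
(* Adding [C] to the potential adds [C] both to the energy and to its infimum [m], so it cancels in
   the rate. *)
pose m := energy_min V C.
have mE : (c_V V + C%:E = m%:E)%E by rewrite /m /energy_min EFinD fineK.
have rateE (x : R * M1p (`[0, +oo[%classic : set (measurableTypeR R)) p) :
    rate_V V x = (energy U (flip x.1 x.2) - m%:E)%E.
  by case: x => c nu; rewrite (rate_V_energy confU _ _ cfin) mE.
have rate_gt a (x : R * M1p (`[0, +oo[%classic : set (measurableTypeR R)) p) :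
    (a%:E < rate_V V x)%E = ((a + m)%:E < energy U (flip x.1 x.2))%E.
  by rewrite rateE lteBrDr.
have v0 n : 0 < beta * n.+2%:R ^+ 2 / 2 by rewrite !divr_gt0// mulr_gt0// exprn_gt0.
split.
- move=> x; rewrite rateE sube_ge0//; exact: (energy_ge_min confU).
- move=> x a; rewrite rate_gt.
  move=> /(lower_semicontinuous_energy_flip confU p_gt0)[A xA hA].
  by exists A => // y /hA; rewrite rate_gt.
- move=> G oG; apply: limn_einf_ge => b.
  rewrite lteNr => /ereal_inf_lt[_ [[c nu] Gx <-]]; rewrite rateE/= => hb.
  have fin : (energy U (flip c nu) < +oo)%E.
    by move: hb; case: (energy U _) => [r||] //; rewrite ?ltry.
  have enE : energy U (flip c nu) = (fine (energy U (flip c nu)))%:E.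
    by rewrite fineK// ge0_fin_numE// (energy_ge0 confU).
  (* The whole margin between [- b] and the rate at the chosen point is spent as error. *)
  pose d := - b - (fine (energy U (flip c nu)) - m).
  have d0 : 0 < d by rewrite /d subr_gt0 -lte_fin EFinB -enE.
  have : nbhs (c, nu) G by exact: open_nbhs_nbhs.
  case=> -[A B] /= [/nbhs_ballP[r r0 rA] nB] AB.
  move: nB; rewrite nbhsE => -[B' [oB' B'nu] B'B].
  have [e e0 eB'] := oB' nu B'nu.
  have [n0 H0] := gibbs_ball_ge p_ge2 beta_gt0 confU fin r0 e0 d0.
  exists n0 => // n /= nn0; apply: scaled_lne_ge => //.
  apply: le_trans (H0 n _ nn0 _); last first.
    move=> l [lc W]; apply: AB; split => /=; last exact/B'B/eB'.
    by apply: rA; rewrite /ball/= distrC.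
  by rewrite lee_fin ler_expR /d/m; lra.
- move=> K cK; apply: limn_esup_le => b; rewrite lteNl => hb.
  have [a' ba' a'I] : exists2 a', - b < a' & (a'%:E < ereal_inf (@rate_V R V _ p @` K))%E.
    move: hb; case: (ereal_inf _) => [s| |//].
      rewrite lte_fin => bs; exists ((s - b) / 2); first by lra.
      by rewrite lte_fin; lra.
    by move=> _; exists (1 - b); [lra|rewrite ltry].
  have aK x : K x -> ((a' + m)%:E < energy U (flip x.1 x.2))%E.
    move=> Kx; have : (a'%:E < rate_V V x)%E.
      by apply: (lt_le_trans a'I); apply: ereal_inf_lbound; exists x.
    by rewrite rate_gt.
  (* With this error the exponent [m - (a' + m) + (a' + b)] is exactly [b]. *)
  have e0 : 0 < a' + b by lra.
  have [n0 H0] := gibbs_compact_le p_ge2 beta_gt0 confU cK aK e0.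
  exists n0 => // n /= nn0; apply: scaled_lne_le => //.
  apply: (le_trans (H0 n nn0)); rewrite lee_fin ler_expR -/m.
  by rewrite (_ : m - _ + _ = b)//; ring.
Qed.
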